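(* Let $-2<\alpha<0$ and let $B$ be the unit ball in $\mathbb{R}^2$ centered at the origin. Then there is a number $\widetilde q>2$ such that the following holds. If $q>\widetilde q$ and $u$ is a minimizer of the problem $$\inf\left\{\frac{\int_{B}|\nabla v|^2|x|^{\alpha}\,dx}{\left(\int_{B}|v|^q|x|^{\alpha}\,dx\right)^{2/q}}:\ v\in W^{1,2}(B,|x|^\alpha,|x|^\alpha)\setminus\{0\},\ \int_B|x|^\alpha v\,dx=0\right\}$$ which is symmetric (even) with respect to $x_1$, then $u$ is not antisymmetric (odd) with respect to $x_2$.
   Context: $W^{1,2}(B,|x|^\alpha,|x|^\alpha)$ is the set of $u$ with $\int_B|u|^2|x|^\alpha dx<\infty$ having distributional first derivatives with $\int_B|\nabla u|^2|x|^\alpha dx<\infty$. A function $u$ on $B$ is symmetric (even) with respect to $x_1$ if $u(-x_1,x_2)=u(x_1,x_2)$, and antisymmetric (odd) with respect to $x_2$ if $u(x_1,-x_2)=-u(x_1,x_2)$ (a.e. in $B$). *)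

(* Defs.v *)
From mathcomp Require Import all_boot all_order all_algebra.
From mathcomp Require Import all_classical all_reals all_analysis.

Set Implicit Arguments.
Unset Strict Implicit.
Unset Printing Implicit Defensive.

Import Order.TTheory GRing.Theory Num.Theory.
Import numFieldNormedType.Exports.

Local Open Scope classical_set_scope.
Local Open Scope ring_scope.

Section WeightedSobolev.
Context {R : realType}.

(* Measurability on R * R refers to the product (Borel) sigma-algebra, so an
   almost-everywhere class is represented by a Borel function. *)
Local Notation leb2 := (@lebesgue_measure R \x @lebesgue_measure R)%E.

(* The library norm on R * R is the sup norm. *)
Definition enorm (x : R * R) : R := Num.sqrt (x.1 ^+ 2 + x.2 ^+ 2).

Definition unit_ball : set (R * R) := [set x | enorm x < 1].

Local Notation B := unit_ball.

(* [0 `^ alpha = 0] for [alpha != 0]: the value at the origin, a null set. *)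
Definition weight (alpha : R) (x : R * R) : R := enorm x `^ alpha.

Definition e1 : R * R := (1, 0).
Definition e2 : R * R := (0, 1).

Definition iter_partial (s : seq (R * R)) (phi : R * R -> R) : R * R -> R :=
  foldr (fun e (f : R * R -> R) => 'D_e f) phi s.

Definition smooth (phi : R * R -> R) : Prop :=
  forall s : seq (R * R), {subset s <= [:: e1; e2]} ->
    continuous (iter_partial s phi) /\
    (forall x, derivable (iter_partial s phi) x e1 /\
               derivable (iter_partial s phi) x e2).

Definition test_function (phi : R * R -> R) : Prop :=
  smooth phi /\
  exists K : set (R * R), [/\ compact K, K `<=` B &
                              forall x, ~ K x -> phi x = 0].

Definition locally_integrable2 (f : R * R -> R) : Prop :=
  measurable_fun (B : set (measurableTypeR R * measurableTypeR R)) f /\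
  forall K : set (R * R), compact K -> K `<=` B ->
    (\int[leb2]_(x in K) `|f x|%:E < +oo)%E.

Definition weak_partial (e : R * R) (u f : R * R -> R) : Prop :=
  [/\ locally_integrable2 u, locally_integrable2 f &
      forall phi, test_function phi ->
        (\int[leb2]_(x in B) (u x * 'D_e phi x)%:E =
         - \int[leb2]_(x in B) (f x * phi x)%:E)%E].

Definition weak_gradient (u : R * R -> R) (g : R * R -> R * R) : Prop :=
  weak_partial e1 u (fun x => (g x).1) /\ weak_partial e2 u (fun x => (g x).2).

(* [u] belongs to W^{1,2}(B, |x|^alpha, |x|^alpha), with distributional
   gradient (a version of) [g]; [g] is determined by [u] almost everywhere. *)
Definition W12 (alpha : R) (u : R * R -> R) (g : R * R -> R * R) : Prop :=
  [/\ weak_gradient u g,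
      (\int[leb2]_(x in B) (`|u x| ^+ 2 * weight alpha x)%:E < +oo)%E &
      (\int[leb2]_(x in B) (enorm (g x) ^+ 2 * weight alpha x)%:E < +oo)%E].

Definition admissible (alpha : R) (v : R * R -> R) (g : R * R -> R * R) : Prop :=
  [/\ W12 alpha v g,
      ~ {ae leb2, forall x, B x -> v x = 0} &
      (\int[leb2]_(x in B) (weight alpha x * v x)%:E = 0)%E].

Definition quotient (alpha q : R) (v : R * R -> R) (g : R * R -> R * R)
    : \bar R :=
  ((\int[leb2]_(x in B) (enorm (g x) ^+ 2 * weight alpha x)%:E) /
   (\int[leb2]_(x in B) (`|v x| `^ q * weight alpha x)%:E) `^ (2 / q))%E.

Definition minimizer (alpha q : R) (u : R * R -> R) : Prop :=
  exists2 g, admissible alpha u g &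
    quotient alpha q u g =
    ereal_inf [set r | exists v h, admissible alpha v h /\
                                   r = quotient alpha q v h].

Definition symmetric_x1 (u : R * R -> R) : Prop :=
  {ae leb2, forall x, B x -> u (- x.1, x.2) = u x}.

Definition antisymmetric_x2 (u : R * R -> R) : Prop :=
  {ae leb2, forall x, B x -> u (x.1, - x.2) = - u x}.

End WeightedSobolev.

(* Main.v *)
Require Import Defs.
From mathcomp Require Import all_boot all_order all_algebra.
From mathcomp Require Import all_classical all_reals all_analysis.
From mathcomp Require Import measurable_realfun ring lra.

(** Let u be a minimizer that is odd in x2; write E for its energy, M for
    the integral of |u|^q |x|^alpha over the disc, so that the infimum is
    E / M^(2/q).  Since u is odd, its restriction to either half disc, extended
    by zero, is again a Sobolev function on the whole disc.  Both restrictions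
    carry the mass M / 2, and one of them, V, has energy at most E / 2.
    If V had weighted mean zero, it would be a competitor whose quotient is at
    most 2^(2/q - 1) times the infimum.  One has to subtract the mean c of V,
    and this is harmless when q is large: |c| <= K sqrt E with K independent of
    q, whereas the infimum tends to 0 as q grows, so that sqrt E, hence c, is
    much smaller than M^(1/q).  The quotient of V - c is then smaller than the
    infimum.

    This rests on four facts.

    - [weak_pair_cut]: the indicator of a half disc times an odd function has
      the expected weak gradient.  Near the axis, cut-offs have a derivative of
      order 1/|x2|, but the oddness of u leaves only the odd part of the test
      function, which is O(|x2|).

    - [moment_bound] and [weighted_mean_bound]: the upper half V is bounded in
      every L^(2k) by its energy, and by oddness so is the lower half.  Since V
      vanishes below the axis, almost every value of V is the integral of a
      directional derivative along a line that enters the upper half disc from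
      below ([representation]); using the directions (0, 1), (1, 1) and (-1, 1)
      gives an inequality of Gagliardo-Nirenberg type, which is iterated over k.
      Young's inequality then brings in the weight, because |x|^b is integrable
      for b > -2.  This yields K, and shows that M is finite.

    - [small_quotient]: the infimum tends to 0.  A logarithmic dipole,
      regularized at scale 2^-N and odd in x1 (hence of mean zero), has energy
      O(N) while it is at least N ln 2 on a small square; for q >= 2N the
      measure of this square to the power 2/q is bounded below.

    - [competitor_beats]: the final comparison between V - c and u. *)

Set Implicit Arguments.
Unset Strict Implicit.
Unset Printing Implicit Defensive.
Import Order.TTheory GRing.Theory Num.Theory.
Import numFieldNormedType.Exports.
Local Open Scope classical_set_scope.
Local Open Scope ring_scope.

(** * Smooth functions of one and two variables *)

Section Smooth.
Context {R : realType}.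
Implicit Types (f g : R -> R) (t : R).

Lemma is_derive_ext {V W : normedModType R} (f g : V -> W) x v df df' :
  is_derive x v f df -> f =1 g -> df = df' -> is_derive x v g df'.
Proof. by move=> h /funext <- <-. Qed.

(** Up to linear combinations, these are all the derivatives of exp(-1/t),
    extended by zero. *)
Definition flat (n : nat) (t : R) : R :=
  if 0 < t then t^-1 ^+ n * expR (- t^-1) else 0.

(** The inequality exp(1/t) >= t^-(n+2) / (n+2)! leaves a factor t^2, which
    makes the difference quotients at 0 tend to 0. *)
Lemma flat_bound n (t : R) : 0 <= flat n t <= (n.+2)`!%:R * t ^+ 2.
Proof.
rewrite /flat; case: ifPn => [t0|_]; last by rewrite lexx mulr_ge0 ?sqr_ge0.
have tV : 0 < t^-1 by rewrite invr_gt0.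
apply/andP; split; first by rewrite mulr_ge0 ?expR_ge0 ?exprn_ge0// ltW.
rewrite expRN ler_pdivrMr ?expR_gt0//.
have := expR_ge1Dxn n.+1 (ltW tV).
have e : t^-1 ^+ n = (n.+2)`!%:R * t ^+ 2 * (t^-1 ^+ n.+2 / n.+2`!%:R).
  rewrite !exprS expr0; have f0 : (n.+2)`!%:R != 0 :> R by rewrite pnatr_eq0 -lt0n fact_gt0.
  field; by rewrite f0/= gt_eqF.
rewrite e => h; apply: ler_wpM2l; first by rewrite mulr_ge0 ?sqr_ge0.
by apply: le_trans h; rewrite lerDr.
Qed.

Lemma is_derive_flat n t :
  is_derive t 1 (flat n) (flat n.+2 t - n%:R * flat n.+1 t).
Proof.
have [t0|t0|t0] := ltgtP t 0.
- rewrite /flat !ltNge (ltW t0) /= mulr0 subr0.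
  apply: (@near_eq_is_derive _ _ _ (cst 0)).
  by apply: filterS (lt_nbhsl t0) => y y0; rewrite /flat ltNge (ltW y0).
- apply: (@near_eq_is_derive _ _ _ (fun t => t^-1 ^+ n * expR (- t^-1))).
    by apply: filterS (lt_nbhsr t0) => y y0; rewrite /flat y0.
  have tN : t != 0 by rewrite gt_eqF.
  have dV : is_derive t 1 (fun t => t^-1) (- t ^- 2).
    have := @is_deriveV R (@id R) t 1 1 tN _; rewrite /= scaler1; apply.
  have dN : is_derive t 1 (fun t => - t^-1) (t ^- 2).
    by have := is_deriveN dV; rewrite opprK.
  have dE := @is_derive1_comp _ expR (fun t => - t^-1) t _ _ (is_derive_expR (- t^-1)) dN.
  have dX := is_deriveX n dV.
  apply: (is_derive_ext (is_deriveM dX dE)) => [z|]; first by rewrite fctE exprfctE.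
  rewrite exprfctE /flat t0 /GRing.scale/=.
  case: n {dX} => [|n]; first by rewrite !expr0 mulr0n; field.
  rewrite -mulr_natl /= !exprS; field; exact: tN.
- subst t.
  have f0 m : flat m 0 = 0 by rewrite /flat ltxx.
  rewrite !f0 mulr0 subr0.
  apply/is_derive1_caratheodory; exists (fun z => flat n z / z); split.
  + move=> z; rewrite f0 !subr0; have [->|z0] := eqVneq z 0.
      by rewrite f0 mulr0.
    by rewrite mulfVK.
  + rewrite /prop_for /continuous_at; apply/cvgrPdist_le => e e0.
    have e1 : 0 < e / (n.+2)`!%:R by rewrite divr_gt0// ltr0n fact_gt0.
    apply: (filterS _ (@nbhs0_le R R _ e1)) => z ze; rewrite invr0 mulr0 sub0r normrN normrM normfV.
    have /andP[h1 h2] := flat_bound n z.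
    have [->|z0] := eqVneq z 0; first by rewrite normr0 invr0 mulr0 ltW.
    rewrite ler_pdivrMr ?normr_gt0// ger0_norm//.
    apply: le_trans h2 _; rewrite -[z ^+ 2]ger0_norm ?sqr_ge0// normrX expr2 mulrA.
    rewrite ler_wpM2r// mulrC -ler_pdivlMr ?ltr0n ?fact_gt0//.
  + by rewrite invr0 mulr0.
Qed.

Lemma is_derive_affine (p q t : R) : is_derive t 1 (fun t => p * t + q) p.
Proof.
apply: (is_derive_ext (is_deriveD (is_deriveZ p (is_derive_id t 1)) (is_derive_cst q t 1))) => //.
by rewrite addr0 /GRing.scale/= mulr1.
Qed.

(** A class that is visibly closed under differentiation, so that infinite
    differentiability follows by induction on the construction of a function
    instead of on the order of the derivative. *)
Inductive smooth1 : (R -> R) -> Prop :=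
| smooth1_cst c : smooth1 (fun=> c)
| smooth1_flat n : smooth1 (flat n)
| smooth1_add f g : smooth1 f -> smooth1 g -> smooth1 (fun t => f t + g t)
| smooth1_mul f g : smooth1 f -> smooth1 g -> smooth1 (fun t => f t * g t)
| smooth1_affine p q f : smooth1 f -> smooth1 (fun t => f (p * t + q))
| smooth1_primitive f F :
    smooth1 f -> (forall t, is_derive t 1 F (f t)) -> smooth1 F.

Lemma smooth1_derive f : smooth1 f ->
  exists2 f', smooth1 f' & forall t, is_derive t 1 f (f' t).
Proof.
elim => {f} [c|n|f g _ [f' sf df] _ [g' sg dg]|f g sf0 [f' sf df] sg0 [g' sg dg]
            |p q f _ [f' sf df]|f F sf _ dF].
- exists (fun=> 0); [exact: smooth1_cst|move=> t; exact: is_derive_cst].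
- exists (fun t => flat n.+2 t + (- n%:R) * flat n.+1 t).
    apply: smooth1_add; first exact: smooth1_flat.
    apply: smooth1_mul; [exact: smooth1_cst|exact: smooth1_flat].
  by move=> t; rewrite mulNr; exact: is_derive_flat.
- exists (fun t => f' t + g' t); first exact: smooth1_add.
  by move=> t; exact: is_deriveD.
- exists (fun t => f' t * g t + f t * g' t).
    by apply: smooth1_add; exact: smooth1_mul.
  move=> t; apply: (is_derive_ext (is_deriveM (df t) (dg t))) => //.
  by rewrite addrC /GRing.scale/= mulrC.
- exists (fun t => f' (p * t + q) * p).
    by apply: smooth1_mul; [exact: smooth1_affine|exact: smooth1_cst].
  move=> t; apply: (@is_derive1_comp _ f (fun t => p * t + q)).
  exact: is_derive_affine.
- by exists f.
Qed.

Lemma smooth1_continuous f : smooth1 f -> continuous f.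
Proof.
move=> /smooth1_derive[f' _ df] t; apply/differentiable_continuous.
by apply/derivable1_diffP; apply: ex_derive.
Qed.

Lemma is_derive_slice (f : R * R -> R) (x v : R * R) (g : R -> R) (y : R) d :
  (forall h : R, f (h *: v + x) = g (h + y)) -> is_derive x v f d <-> is_derive y 1 g d.
Proof.
move=> fg.
have e h : h^-1 *: ((f \o shift x) (h *: v) - f x) =
  h^-1 *: ((g \o shift y) (h *: 1) - g y).
  congr (_ *: (_ - _)); first by rewrite /= fg scaler1.
  by have := fg 0; rewrite scale0r !add0r.
have D : derivable f x v = derivable g y 1.
  by apply: (congr1 (fun F : R -> R => cvg (F @ 0^'))); apply/funext => h; exact: e.
have E : 'D_v f x = 'D_1 g y.
  by apply: (congr1 (fun F : R -> R => lim (F @ 0^'))); apply/funext => h; exact: e.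
by split => -[h1 h2]; apply: DeriveDef; [rewrite -D | rewrite -E | rewrite D | rewrite E].
Qed.

Lemma is_derive_e1 (f : R * R -> R) (x : R * R) d :
  is_derive x e1 f d <-> is_derive x.1 1 (fun t => f (t, x.2)) d.
Proof.
apply: is_derive_slice => h; case: x => a b; congr f; congr pair => /=.
  by rewrite scaler1.
by rewrite scaler0 add0r.
Qed.

Lemma is_derive_e2 (f : R * R -> R) (x : R * R) d :
  is_derive x e2 f d <-> is_derive x.2 1 (fun t => f (x.1, t)) d.
Proof.
apply: is_derive_slice => h; case: x => a b; congr f; congr pair => /=.
  by rewrite scaler0 add0r.
by rewrite scaler1.
Qed.

(** The base case contains the test functions themselves, so that their
    products with cut-offs are covered. *)
Inductive smooth2 : (R * R -> R) -> Prop :=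
| smooth2_base phi : smooth phi -> smooth2 phi
| smooth2_linear a p q : smooth1 a -> smooth2 (fun x => a (p * x.1 + q * x.2))
| smooth2_add phi psi :
    smooth2 phi -> smooth2 psi -> smooth2 (fun x => phi x + psi x)
| smooth2_mul phi psi :
    smooth2 phi -> smooth2 psi -> smooth2 (fun x => phi x * psi x).

Lemma smooth_partial (phi : R * R -> R) (e : R * R) : smooth phi -> e \in [:: e1; e2] -> smooth ('D_e phi).
Proof.
move=> sphi ee s se.
have -> : iter_partial s ('D_e phi) = iter_partial (rcons s e) phi.
  by rewrite /iter_partial foldr_rcons.
by apply: sphi => v; rewrite mem_rcons inE => /predU1P[->//|/se].
Qed.

Lemma is_derive_linear a a' (p q : R) (x v : R * R) :
  is_derive (p * x.1 + q * x.2) 1 a (a' (p * x.1 + q * x.2)) ->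
  is_derive x v (fun x => a (p * x.1 + q * x.2))
    ((p * v.1 + q * v.2) * a' (p * x.1 + q * x.2)).
Proof.
move=> da; apply/(@is_derive_slice _ _ _
    (fun h => a ((p * v.1 + q * v.2) * h + (p * x.1 + q * x.2))) 0).
  move=> h; congr a; case: x v {da} => x1 x2 [v1 v2] /=.
  by rewrite /GRing.scale/=; ring.
set c := p * v.1 + _; set y := p * x.1 + _.
rewrite mulrC; apply: (@is_derive1_comp _ a (fun t => c * t + y)).
  by rewrite mulr0 add0r.
exact: is_derive_affine.
Qed.

Lemma smooth2_derive phi : smooth2 phi -> continuous phi /\
  forall e, e \in [:: e1; e2] ->
    exists2 psi, smooth2 psi & forall x, is_derive x e phi (psi x).
Proof.
elim => {phi} [phi sphi|a p q sa|phi psi _ [cphi dphi] _ [cpsi dpsi]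
              |phi psi s0 [cphi dphi] s1 [cpsi dpsi]].
- have [|c d] := sphi [::]; first by [].
  split => // e ee; exists ('D_e phi); first exact/smooth2_base/smooth_partial.
  move=> x; apply: DeriveDef => //; have [d1 d2] := d x.
  by move: ee; rewrite !inE => /orP[/eqP->|/eqP->]; [exact: d1|exact: d2].
- split.
    move=> x; apply: (@continuous_comp _ _ _ (fun x : R * R => p * x.1 + q * x.2) a).
      apply: continuousD; apply: continuousM; try exact: cvg_cst.
      exact: cvg_fst.
      exact: cvg_snd.
    exact: smooth1_continuous.
  have [a' sa' da] := smooth1_derive sa.
  move=> e ee; exists (fun x => (p * e.1 + q * e.2) * a' (p * x.1 + q * x.2)).
    apply: smooth2_mul; last exact: smooth2_linear.
    exact: (@smooth2_linear (fun=> p * e.1 + q * e.2) 0 0 (smooth1_cst _)).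
  by move=> x; exact: is_derive_linear.
- split; first by move=> x; apply: continuousD; [exact: cphi|exact: cpsi].
  move=> e ee; have [f sf df] := dphi e ee; have [g sg dg] := dpsi e ee.
  by exists (fun x => f x + g x); [exact: smooth2_add|move=> x; exact: is_deriveD].
- split; first by move=> x; apply: continuousM; [exact: cphi|exact: cpsi].
  move=> e ee; have [f sf df] := dphi e ee; have [g sg dg] := dpsi e ee.
  exists (fun x => f x * psi x + phi x * g x).
    by apply: smooth2_add; exact: smooth2_mul.
  move=> x; apply: (is_derive_ext (is_deriveM (df x) (dg x))) => //.
  by rewrite addrC /GRing.scale/= mulrC.
Qed.

Lemma smooth2_smooth phi : smooth2 phi -> smooth phi.
Proof.
move=> sphi s se.
have sip : smooth2 (iter_partial s phi).
  elim: s se => [//|e s ih] se /=.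
  have /smooth2_derive[_ d] : smooth2 (iter_partial s phi).
    by apply: ih => v vs; apply: se; rewrite inE vs orbT.
  have [|psi spsi dpsi] := d e; first by apply: se; rewrite mem_head.
  suff -> : 'D_e (iter_partial s phi) = psi by [].
  by apply/funext => x; rewrite derive_val.
have [c d] := smooth2_derive sip; split => // x.
have [|f _ df] := d e1; first by rewrite !inE eqxx.
have [|g _ dg] := d e2; first by rewrite !inE eqxx orbT.
by split; apply: ex_derive.
Qed.

End Smooth.

(** * A smooth step *)

Section Bump.
Context {R : realType}.
Implicit Types (f : R -> R) (t : R).
Local Notation mu := (@lebesgue_measure R).

Lemma integrable_compact_support f (c d : R) : continuous f ->
  (forall t, t <= c -> f t = 0) -> (forall t, d <= t -> f t = 0) ->
  mu.-integrable setT (EFin \o f).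
Proof.
move=> cf fc fd.
have h : mu.-integrable `[c, d] (EFin \o f).
  apply: continuous_compact_integrable; first exact: segment_compact.
  exact: continuous_subspaceT.
have -> : EFin \o f = (EFin \o f) \_ `[c, d].
  apply/funext => t; rewrite patchE; case: ifPn => // /negP.
  rewrite inE/= in_itv/= => /negP; rewrite negb_and -!ltNge => /orP[/ltW/fc->|/ltW/fd->] //.
by rewrite -integrable_mkcond.
Qed.

Definition primitive f (x : R) := (\int[mu]_(t in `]-oo, x]) f t)%R.

Section Primitive.
Variables (f : R -> R) (c d : R).
Hypotheses (sf : smooth1 f) (fc : forall t, t <= c -> f t = 0)
  (fd : forall t, d <= t -> f t = 0).

Let intf : mu.-integrable setT (EFin \o f).
Proof. exact: integrable_compact_support (smooth1_continuous sf) fc fd. Qed.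

Lemma is_derive_primitive (x : R) : is_derive x 1 (primitive f) (f x).
Proof.
have [//||||h1 h2] := @continuous_FTC1 R f -oo%O x (x + 1).
- by rewrite ltrDl.
- exact: integrableS intf.
- by rewrite ltNyr.
- exact: smooth1_continuous.
- by apply: DeriveDef; [exact: h1|rewrite -derive1E; exact: h2].
Qed.

Lemma smooth1_primitive_int : smooth1 (primitive f).
Proof. exact: smooth1_primitive sf is_derive_primitive. Qed.

Lemma primitive_left x : x <= c -> primitive f x = 0.
Proof.
move=> xc; rewrite /primitive (@eq_Rintegral _ _ _ mu _ (fun=> 0)) ?Rintegral_cst ?mul0r//.
by move=> t; rewrite inE/= in_itv/= => tx; apply: fc; exact: le_trans xc.
Qed.

Lemma primitive_right x : d <= x -> primitive f x = (\int[mu]_t f t)%R.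
Proof.
move=> dx; rewrite /primitive [LHS]Rintegral_mkcond; apply: eq_Rintegral => t _.
rewrite patchE; case: ifPn => // /negP; rewrite inE/= in_itv/= => /negP.
by rewrite -ltNge => /ltW xt; rewrite fd// (le_trans dx).
Qed.

End Primitive.

(** The normalized primitive of the bump exp(-1/t) exp(-1/(1-t)).  The
    symmetry of its derivative about 1/2 is what makes the cut-offs of
    [smooth_cutoff] have an even derivative. *)
Lemma smooth_step : exists th th' : R -> R, exists C : R,
  [/\ smooth1 th, (forall t, is_derive t 1 th (th' t)) & (forall t, 0 <= th t <= 1)] /\
  [/\ (forall t, t <= 0 -> th t = 0), (forall t, 1 <= t -> th t = 1),
     (forall t, th' (1 - t) = th' t), (forall t, 0 <= th' t <= C) &
     (forall t, 1 <= t -> th' t = 0)].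
Proof.
pose b t := @flat R 0 t * flat 0 (-1 * t + 1).
have sb : smooth1 b.
  apply: smooth1_mul; first exact: smooth1_flat.
  by apply: (@smooth1_affine _ (-1) 1 (flat 0)); exact: smooth1_flat.
have f0 t : t <= 0 -> @flat R 0 t = 0 by rewrite /flat leNgt => /negbTE->.
have fg t : 0 <= @flat R 0 t by have /andP[] := flat_bound 0 t.
have fl1 t : @flat R 0 t <= 1.
  rewrite /flat; case: ifPn => // t0; rewrite mul1r -expR0 ler_expR.
  by rewrite oppr_le0 invr_ge0 ltW.
have b0 t : t <= 0 -> b t = 0 by move=> t0; rewrite /b f0 ?mul0r.
have b1 t : 1 <= t -> b t = 0 by move=> t0; rewrite /b (f0 (_ + _)) ?mulr0//; lra.
have bge t : 0 <= b t by rewrite mulr_ge0.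
have dP := is_derive_primitive sb b0 b1.
set P := primitive b in dP.
have intb : mu.-integrable setT (EFin \o b).
  exact: integrable_compact_support (smooth1_continuous sb) b0 b1.
set m := (\int[mu]_t b t)%R.
have Pm x : 0 <= P x <= m.
  rewrite /P /primitive Rintegral_ge0//= /m [leLHS]Rintegral_mkcond.
  apply: le_Rintegral => //.
    by rewrite -restrict_EFin; rewrite -integrable_mkcond//; exact: integrableS intb.
  by move=> t _; rewrite patchE; case: ifP.
have m0 : 0 < m.
  rewrite lt_neqAle; apply/andP; split; last exact: Rintegral_ge0.
  apply/eqP => m0; have P0 : P = cst 0.
    by apply/funext => x; have := Pm x; rewrite -m0 => ?; apply/eqP; rewrite eq_le andbC.
  have := dP (2^-1); rewrite P0 => -[_]; rewrite derive_cst => /esym/eqP.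
  have p0 (t : R) : 0 < t -> 0 < flat 0 t by move=> t0; rewrite /flat t0 mul1r expR_gt0.
  by rewrite /b gt_eqF// mulr_gt0 ?p0//; lra.
exists (fun t => P t * m^-1), (fun t => b t * m^-1), m^-1; split; split.
- by apply: smooth1_mul; [exact: smooth1_primitive_int sb b0 b1|exact: smooth1_cst].
- move=> t; apply: (is_derive_ext (is_deriveM (dP t) (is_derive_cst m^-1 t 1))) => //.
  by rewrite scaler0 add0r /GRing.scale/= mulrC.
- move=> t; have /andP[h1 h2] := Pm t.
  by rewrite divr_ge0//= ?(ltW m0)// ler_pdivrMr// mul1r.
- by move=> t t0; rewrite [P t](primitive_left b0)// mul0r.
- by move=> t t1; rewrite [P t](primitive_right b1)// divff// gt_eqF.
- move=> t; congr (_ * _); rewrite /b mulrC; congr (flat 0 _ * flat 0 _); ring.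
- move=> t; rewrite divr_ge0//= ?(ltW m0)// -[leRHS]mul1r ler_pM2r ?invr_gt0//.
  by rewrite -[1]mulr1 ler_pM.
- by move=> t t1; rewrite b1 ?mul0r.
Qed.
End Bump.

(** * Measure-preserving maps of the plane *)

Section MeasurePreserving.
Context d (T : measurableType d) (R : realType) (mu : {measure set T -> \bar R}).
Variable phi : T -> T.
Hypothesis mphi : measurable_fun setT phi.
Hypothesis hpres : forall A, measurable A -> mu (phi @^-1` A) = mu A.

Lemma ge0_integral_preserving (f : T -> \bar R) : measurable_fun [set: T] f ->
  (forall x, 0 <= f x)%E -> (\int[mu]_x f (phi x) = \int[mu]_x f x)%E.
Proof.
move=> mf f0.
rewrite -[LHS](@ge0_integral_pushforward _ _ _ _ _ phi mphi mu setT f)//.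
apply: eq_measure_integral => A mA _ ; exact: hpres.
Qed.

Lemma integral_preserving (f : T -> \bar R) : measurable_fun [set: T] f ->
  (\int[mu]_x f (phi x) = \int[mu]_x f x)%E.
Proof.
move=> mf; rewrite integralE [RHS]integralE.
rewrite -(ge0_integral_preserving (measurable_funepos mf) (funepos_ge0 f)).
rewrite -(ge0_integral_preserving (measurable_funeneg mf) (funeneg_ge0 f)).
by rewrite -[fun x0 => f (phi x0)]/(f \o phi) funepos_comp funeneg_comp.
Qed.

Lemma ae_preserving (Q : T -> Prop) : {ae mu, forall x, Q x} -> {ae mu, forall x, Q (phi x)}.
Proof.
move=> [N [mN N0 QN]]; exists (phi @^-1` N); split.
- by rewrite -[_ @^-1` _]setTI; exact: mphi.
- by rewrite hpres.
- by move=> x /= nQ; apply: QN.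
Qed.

End MeasurePreserving.

Section Plane.
Context {R : realType}.
Local Notation MR := (measurableTypeR R).
Local Notation leb := (@lebesgue_measure R).
Local Notation leb2 := (leb \x leb)%E.

(** By uniqueness of Lebesgue measure, half-open intervals suffice. *)
Lemma lebesgue_preserving (phi : MR -> MR) (A : set MR) : measurable_fun setT phi ->
  (forall a b : R, a <= b -> leb (phi @^-1` `]a, b]) = (b - a)%:E) ->
  measurable A -> leb (phi @^-1` A) = leb A.
Proof.
move=> mphi h mA; apply/esym.
apply: (@lebesgue_measure_unique R (pushforward leb phi)) => //.
move=> X /ocitvP[->|[[a b]/= ab ->]]; first by rewrite !measure0.
by rewrite lebesgue_measure_itv/= lte_fin ab /pushforward h// ltW.
Qed.

Lemma lebesgue_translate (c : R) (A : set MR) : measurable A ->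
  leb ((fun x => x + c) @^-1` A) = leb A.
Proof.
apply: lebesgue_preserving; first exact: measurable_funD.
move=> a b ab; have -> : (fun x => x + c) @^-1` `]a, b] = `]a - c, b - c]%classic.
  by apply/seteqP; split => x; rewrite /= !in_itv/= ltrBlDr lerBrDr.
by rewrite lebesgue_measure_itv/= lte_fin; case: ltP => h; [rewrite -EFinD; congr EFin; ring|
  congr EFin; lra].
Qed.

Lemma lebesgue_opp (A : set MR) : measurable A -> leb (-%R @^-1` A) = leb A.
Proof.
apply: lebesgue_preserving; first exact: measurable_funN.
move=> a b ab; have -> : -%R @^-1` `]a, b] = `[- b, - a[%classic.
  by apply/seteqP; split => x; rewrite /= !in_itv/= => ?; lra.
by rewrite lebesgue_measure_itv/= lte_fin; case: ltP => h; [rewrite -EFinD; congr EFin; ring|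
  congr EFin; lra].
Qed.

Lemma measurable_opp_preimage (A : set MR) : measurable A -> measurable (-%R @^-1` A).
Proof.
move=> mA; have m : measurable_fun setT (fun x : MR => - x : MR) by exact: measurable_funN.
by have := m measurableT A mA; rewrite setTI.
Qed.

Definition refl1 (x : MR * MR) : MR * MR := (- x.1, x.2).
Definition refl2 (x : MR * MR) : MR * MR := (x.1, - x.2).
Definition shear (s : R) (x : MR * MR) : MR * MR := (x.1 + s * x.2, x.2).

Lemma measurable_refl1 : measurable_fun setT refl1.
Proof. by apply/measurable_fun_pair => //; apply: measurableT_comp. Qed.

Lemma measurable_refl2 : measurable_fun setT refl2.
Proof. by apply/measurable_fun_pair => //; apply: measurableT_comp. Qed.

Lemma measurable_shear s : measurable_fun setT (shear s).
Proof.
apply/measurable_fun_pair => //; apply: measurable_funD => //.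
exact: measurable_funM.
Qed.

Lemma leb2_refl1 A : measurable A -> leb2 (refl1 @^-1` A) = leb2 A.
Proof.
move=> mA; apply/esym; apply: (@product_measure_unique _ _ _ _ _ _ _ (pushforward leb2 refl1)) => //.
  exact: measurable_refl1.
move=> mr X Y mX mY.
change (leb2 ((-%R @^-1` X) `*` Y) = (leb X * leb Y)%E).
rewrite product_measure1E//; last exact: measurable_opp_preimage.
by congr (_ * _)%E; exact: lebesgue_opp.
Qed.

Lemma leb2_refl2 A : measurable A -> leb2 (refl2 @^-1` A) = leb2 A.
Proof.
move=> mA; apply/esym; apply: (@product_measure_unique _ _ _ _ _ _ _ (pushforward leb2 refl2)) => //.
  exact: measurable_refl2.
move=> mr X Y mX mY.
change (leb2 (X `*` (-%R @^-1` Y)) = (leb X * leb Y)%E).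
rewrite product_measure1E//; last exact: measurable_opp_preimage.
by congr (_ * _)%E; exact: lebesgue_opp.
Qed.

(** Every horizontal section is translated. *)
Lemma leb2_shear s A : measurable A -> leb2 (shear s @^-1` A) = leb2 A.
Proof.
move=> mA.
have mS : measurable (shear s @^-1` A) by rewrite -[_ @^-1` _]setTI; exact: measurable_shear.
have E B : measurable B -> leb2 B = (\int[leb]_y leb (ysection B y))%E.
  move=> mB; apply: (@product_measure_unique _ _ _ _ _ leb leb (leb \x^ leb)%E) => // X Y mX mY.
  exact: product_measure2E.
rewrite !E//; apply: eq_integral => y _.
rewrite -[RHS](lebesgue_translate (s * y)); last exact: measurable_ysection.
congr (leb _); apply/seteqP; split => x; rewrite /ysection/= !inE//.
Qed.

End Plane.

(** * Primitives of integrable functions on the line *)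

Section Dominated.
Context d (T : measurableType d) (R : realType) (mu : {measure set T -> \bar R}).
Implicit Types (D : set T) (f g h : T -> R).

Lemma integrable_dom D f g : measurable D -> mu.-integrable D (EFin \o g) ->
  measurable_fun D f -> (forall x, D x -> `|f x| <= `|g x|) ->
  mu.-integrable D (EFin \o f).
Proof.
move=> mD ig mf fg; apply: (le_integrable mD _ _ ig); first exact/measurable_EFinP.
by move=> x Dx; rewrite /= lee_fin fg.
Qed.

Lemma integrable_mulb D f h (C : R) : measurable D -> mu.-integrable D (EFin \o f) ->
  measurable_fun D h -> (forall x, D x -> `|h x| <= C) ->
  mu.-integrable D (fun x => (h x * f x)%:E).
Proof.
move=> mD intf mh hC; apply: (@integrable_dom D (fun x => h x * f x) (fun x => C * f x)) => //.
- exact: (integrableZl mD C intf).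
- by apply: measurable_funM => //; apply/measurable_EFinP; exact: measurable_int intf.
- by move=> x Dx; rewrite !normrM ler_wpM2r// (le_trans (hC _ Dx))// ler_norm.
Qed.

End Dominated.

Section Line.
Context {R : realType}.
Local Notation MR := (measurableTypeR R).
Local Notation leb := (@lebesgue_measure R).
Implicit Types (a b h : MR -> R).

Definition below (a : MR -> R) (t : MR) : R := \int[leb]_(tau in `]-oo, t[) a tau.
Definition above (a : MR -> R) (t : MR) : R := \int[leb]_(tau in `]t, +oo[) a tau.

(** Jointly in the parameter and in the endpoint: the primitive is a
    parametric integral of f against the indicator of a half-plane. *)
Lemma measurable_below (d : measure_display) (Z : measurableType d) (f : Z * MR -> R) :
  measurable_fun setT f ->
  measurable_fun setT (fun x : Z * MR => below (fun tau => f (x.1, tau)) x.2).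
Proof.
move=> mf.
pose k (x : (Z * MR) * MR) : R := f (x.1.1, x.2) * \1_([set y | y.2 < y.1.2]) x.
have mk : measurable_fun setT (EFin \o k).
  apply/measurable_EFinP; apply: measurable_funM.
    apply: measurableT_comp => //; apply/measurable_fun_pair => //.
    by apply: measurableT_comp.
  apply: measurable_indic.
  have -> : [set y : (Z * MR) * MR | y.2 < y.1.2] = (fun y => y.2 < y.1.2) @^-1` [set true].
    by apply/seteqP; split => y /=; [move=> ->|move=> /eqP; rewrite eqb_id].
  rewrite -[X in measurable X]setTI; apply: measurable_fun_ltr => //.
  exact: measurableT_comp.
have -> : (fun x : Z * MR => below (fun tau => f (x.1, tau)) x.2) =
  fun x => fine (\int[leb]_tau (EFin \o k) (x, tau))%E.
  apply/funext => x; rewrite /below Rintegral_mkcond; congr fine; apply: eq_integral => t _.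
  rewrite /k /= patchE indicE.
  rewrite mem_setE in_itv/= -[_ \in _]/(_ \in [set y | y.2 < y.1.2]).
  have -> : ((x, t) \in [set y : (Z * MR) * MR | y.2 < y.1.2]) = (t < x.2).
    by apply/idP/idP; rewrite in_setE.
  by case: ifP; rewrite ?mulr1 ?mulr0.
apply: measurableT_comp => //.
have hp x : (fun t => (EFin \o k) (x, t))^\+%E = (fun t => ((EFin \o k)^\+)%E (x, t)).
  exact: (funepos_comp (EFin \o k) (pair x)).
have hn x : (fun t => (EFin \o k) (x, t))^\-%E = (fun t => ((EFin \o k)^\-)%E (x, t)).
  exact: (funeneg_comp (EFin \o k) (pair x)).
under eq_fun do rewrite integralE hp hn.
apply: emeasurable_funB.
  exact: (@measurable_fun_fubini_tonelli_F _ _ _ _ _ leb _ (measurable_funepos mk) (funepos_ge0 _)).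
exact: (@measurable_fun_fubini_tonelli_F _ _ _ _ _ leb _ (measurable_funeneg mk) (funeneg_ge0 _)).
Qed.

Lemma measurable_below1 a : measurable_fun setT a -> measurable_fun setT (below a).
Proof.
move=> ma; have m := @measurable_below _ MR (fun x => a x.2) (measurableT_comp ma measurable_snd).
have mp : measurable_fun setT (fun t : MR => (0 : MR, t)) by apply/measurable_fun_pair.
exact: (measurableT_comp m mp).
Qed.

Lemma normr_Rintegral_le (D : set MR) a : measurable D ->
  leb.-integrable setT (EFin \o a) ->
  `|\int[leb]_(x in D) a x| <= \int[leb]_x `|a x|.
Proof.
move=> mD ia; have iaD : leb.-integrable D (EFin \o a) by exact: integrableS ia.
apply: le_trans (le_normr_Rintegral mD iaD) _.
rewrite [leLHS]Rintegral_mkcond; apply: le_Rintegral => //.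
- by rewrite -restrict_EFin -integrable_mkcond//; exact: integrable_norm.
- exact: integrable_norm.
- by move=> x _; rewrite patchE; case: ifP => // _; exact: normr_ge0.
Qed.

(** Fubini on the triangle sigma < tau: integration by parts for primitives of
    functions that are only integrable. *)
Lemma integral_swap a b : leb.-integrable setT (EFin \o a) ->
  leb.-integrable setT (EFin \o b) ->
  \int[leb]_sigma (a sigma * above b sigma) = \int[leb]_tau (b tau * below a tau).
Proof.
move=> ia ib.
have ma : measurable_fun setT a by apply/measurable_EFinP; exact: measurable_int ia.
have mb : measurable_fun setT b by apply/measurable_EFinP; exact: measurable_int ib.
pose S : set (MR * MR) := [set y | y.1 < y.2].
have mS : measurable S.
  have -> : S = (fun y => y.1 < y.2) @^-1` [set true].
    by apply/seteqP; split => y /=; [move=> ->|move=> /eqP; rewrite eqb_id].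
  by rewrite -[X in measurable X]setTI; apply: measurable_fun_ltr.
pose k (x : MR * MR) : R := \1_S x * (a x.1 * b x.2).
have ma1 : measurable_fun setT (fun x : MR * MR => a x.1) by exact: measurableT_comp.
have mb1 : measurable_fun setT (fun x : MR * MR => b x.2) by exact: measurableT_comp.
have mk : measurable_fun setT (EFin \o k).
  by apply/measurable_EFinP; apply: measurable_funM; [exact: measurable_indic|exact: measurable_funM].
have iab : (leb \x leb)%E.-integrable setT (fun x : MR * MR => (a x.1 * b x.2)%:E).
  apply/integrable12ltyP; first by apply/measurable_EFinP; exact: measurable_funM.
  have -> : (\int[leb]_x \int[leb]_y `|(a (x, y).1 * b (x, y).2)%:E| =
      \int[leb]_x (`|a x|%:E * \int[leb]_y `|b y|%:E))%E.
    apply: eq_integral => x _; rewrite -ge0_integralZl//.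
      by apply: eq_integral => y _; rewrite /= normrM EFinM.
    by apply/measurable_EFinP; exact: measurableT_comp.
  rewrite ge0_integralZr//.
  - move/integrableP: ia => [_ ia]; move/integrableP: ib => [_ ib].
    by apply: lte_mul_pinfty => //; rewrite ?integral_ge0// ge0_fin_numE ?integral_ge0.
  - by apply/measurable_EFinP; exact: measurableT_comp.
  - exact: integral_ge0.
have ik : (leb \x leb)%E.-integrable setT (EFin \o k).
  apply: (@integrable_dom _ _ _ _ _ k _ measurableT iab); first exact/measurable_EFinP.
  move=> x _; rewrite /k normrM ler_piMl// indicE; case: (_ \in _); rewrite ?normr1 ?normr0//.
have E c f (D : set MR) : measurable D -> leb.-integrable setT (EFin \o f) ->
    ((c * \int[leb]_(y in D) f y)%:E = \int[leb]_y (\1_D y * (c * f y))%:E)%E.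
  move=> mD jf; have jD : leb.-integrable D (EFin \o f) by exact: integrableS jf.
  rewrite EFinM fineK; last exact: integrable_fin_num.
  rewrite -integralZl// integral_mkcond; apply: eq_integral => y _.
  by rewrite patchE indicE; case: ifP; rewrite ?mul1r ?mul0r//.
have := Fubini ik.
move=> /(congr1 fine) F; rewrite /Rintegral; etransitivity; [|etransitivity; [exact: F|]].
- congr fine; apply: eq_integral => x _; rewrite /above E//.
  apply: eq_integral => y _; rewrite /k /= !indicE.
  have -> : ((x, y) \in S) = (x < y) by apply/idP/idP; rewrite in_setE.
  by rewrite mem_setE in_itv/= andbT.
- congr fine; apply: eq_integral => x _; rewrite /below E//.
  apply: eq_integral => y _; rewrite /k /= !indicE [b x * _]mulrC.
  have -> : ((y, x) \in S) = (y < x) by apply/idP/idP; rewrite in_setE.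
  by rewrite mem_setE in_itv/=.
Qed.

Lemma below_bound a t : leb.-integrable setT (EFin \o a) ->
  `|below a t| <= \int[leb]_x `|a x|.
Proof. exact: normr_Rintegral_le. Qed.

Lemma integrable_mul_below a b : leb.-integrable setT (EFin \o a) ->
  leb.-integrable setT (EFin \o b) ->
  leb.-integrable setT (fun t => (below a t * b t)%:E).
Proof.
move=> ia ib; apply: (integrable_mulb (C := \int[leb]_x `|a x|)) => //.
  by apply: measurable_below1; apply/measurable_EFinP; exact: measurable_int ia.
by move=> t _; exact: below_bound.
Qed.

Lemma below_above a x : leb.-integrable setT (EFin \o a) ->
  \int[leb]_y a y = below a x + above a x.
Proof.
move=> ia; have h : below a x = \int[leb]_(y in `]-oo, x]) a y.
  by rewrite -(@Rintegral_itv_bndo_bndc _ -oo%O)//; exact: integrableS ia.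
have := @Rintegral_itvB R a -oo%O +oo%O x.
rewrite set_itvE => /(_ ia); rewrite -h /above => <- //.
by rewrite addrC subrK.
Qed.

(** The product rule for absolutely continuous functions, in integrated form.
    Cutting both functions at t reduces the claim to [integral_swap]. *)
Lemma below_mul a b t : leb.-integrable setT (EFin \o a) ->
  leb.-integrable setT (EFin \o b) ->
  below a t * below b t = below (fun tau => a tau * below b tau + b tau * below a tau) t.
Proof.
move=> ia ib.
pose cut (f : MR -> R) : MR -> R := f \_ `]-oo, t[%classic.
have icut f : leb.-integrable setT (EFin \o f) -> leb.-integrable setT (EFin \o cut f).
  by move=> jf; rewrite /cut -restrict_EFin -integrable_mkcond//; exact: integrableS jf.
have bE f : below f t = \int[leb]_x cut f x by rewrite /below Rintegral_mkcond.
have cutE f x : cut f x = if x < t then f x else 0 by rewrite /cut patchE mem_setE in_itv.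
have bcut f x : x < t -> below (cut f) x = below f x.
  move=> xt; apply: eq_Rintegral => y; rewrite inE/= in_itv/= => yx.
  by rewrite cutE (lt_trans yx xt).
have mcut f : leb.-integrable setT (EFin \o f) -> measurable_fun setT (cut f).
  by move=> /icut jf; apply/measurable_EFinP; exact: measurable_int jf.
have i1 f g : leb.-integrable setT (EFin \o f) -> leb.-integrable setT (EFin \o g) ->
    leb.-integrable setT (fun x => (cut f x * below (cut g) x)%:E).
  move=> jf jg; under eq_fun do rewrite mulrC.
  exact: (integrable_mul_below (icut _ jg) (icut _ jf)).
rewrite bE [below b t]bE -RintegralZr//; last exact: icut.
transitivity (\int[leb]_x (cut a x * below (cut b) x + cut a x * above (cut b) x)).
  by apply: eq_Rintegral => x _; rewrite (below_above x (icut _ ib)) mulrDr.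
rewrite RintegralD//; [|exact: i1|].
  rewrite integral_swap; [|exact: icut|exact: icut].
  rewrite -(RintegralD measurableT (i1 _ _ ia ib) (i1 _ _ ib ia)) [RHS]bE; apply: eq_Rintegral => x _; rewrite !cutE; case: ifPn => [xt|_].
    by rewrite !bcut.
  by rewrite !mul0r addr0.
have -> : EFin \o (fun x => cut a x * above (cut b) x) =
    ((fun x => (cut a x * \int[leb]_y cut b y)%:E) \- (fun x => (cut a x * below (cut b) x)%:E))%E.
  apply/funext => x; rewrite /= -EFinB; congr EFin.
  by rewrite (below_above x (icut _ ib)); ring.
apply: integrableB => //; last exact: i1.
exact: (integrableZr measurableT _ (icut _ ia)).
Qed.

Lemma below_exp h k t : leb.-integrable setT (EFin \o h) ->
  below h t ^+ k.+1 = k.+1%:R * below (fun tau => below h tau ^+ k * h tau) t.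
Proof.
move=> ih.
have mh : measurable_fun setT (below h).
  by apply: measurable_below1; apply/measurable_EFinP; exact: measurable_int ih.
have ik n : leb.-integrable setT (fun tau => (below h tau ^+ n * h tau)%:E).
  apply: (integrable_mulb (C := (\int[leb]_x `|h x|) ^+ n)) => //.
    exact: measurable_funX.
  by move=> x _; rewrite normrX lerXn2r// ?nnegrE ?Rintegral_ge0//; exact: below_bound.
elim: k t => [|k ih1] t.
  by rewrite expr1 mul1r; apply: eq_Rintegral => x _; rewrite expr0 mul1r.
rewrite exprSr ih1 -mulrA below_mul//; last exact: ik.
transitivity (k.+1%:R * below (fun tau => (1 + k.+1%:R^-1) * (below h tau ^+ k.+1 * h tau)) t).
  congr (_ * _); apply: eq_Rintegral => x _.
  have -> : below (fun tau => below h tau ^+ k * h tau) x = k.+1%:R^-1 * below h x ^+ k.+1.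
    by rewrite ih1 mulKf// pnatr_eq0.
  by rewrite exprS; ring.
rewrite {1}/below RintegralZl//; last exact: integrableS (ik _).
rewrite mulrA; congr (_ * _).
by rewrite mulrDr mulr1 divff ?pnatr_eq0// natr1.
Qed.

(** A primitive U satisfies |U|^(k+1) <= (k+1) * integral of |U|^k |U'|: this
    is how a power of a function is controlled along one line. *)
Lemma normr_below_exp h k t : leb.-integrable setT (EFin \o h) ->
  ((`|below h t| ^+ k.+1)%:E <=
   k.+1%:R%:E * \int[leb]_tau (`|below h tau| ^+ k * `|h tau|)%:E)%E.
Proof.
move=> ih.
have mh : measurable_fun setT (below h).
  by apply: measurable_below1; apply/measurable_EFinP; exact: measurable_int ih.
have ik : leb.-integrable setT (fun tau => (below h tau ^+ k * h tau)%:E).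
  apply: (integrable_mulb (C := (\int[leb]_x `|h x|) ^+ k)) => //.
    exact: measurable_funX.
  by move=> x _; rewrite normrX lerXn2r// ?nnegrE ?Rintegral_ge0//; exact: below_bound.
rewrite -normrX below_exp// normrM normr_nat EFinM lee_wpmul2l ?lee_fin//.
apply: le_trans (_ : (\int[leb]_x `|below h x ^+ k * h x|)%R%:E <= _)%E.
  by rewrite lee_fin; exact: normr_Rintegral_le.
rewrite fineK; last by apply: integrable_fin_num => //; exact: integrable_norm.
by under eq_integral do rewrite normrM normrX.
Qed.
End Line.

(** * Functions with zero integral over all rectangles *)

Section Rectangles.
Context {R : realType}.
Local Notation MR := (measurableTypeR R).
Local Notation leb := (@lebesgue_measure R).
Local Notation leb2 := (leb \x leb)%E.

(** Sets whose preimage has zero integral form a Dynkin system. *)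
Lemma integral_eq0_dynkin d1 d2 (X : measurableType d1) (Y : measurableType d2)
    (mu : {measure set X -> \bar R}) (phi : X -> Y) (G : set (set Y)) (F : X -> \bar R) :
  measurable_fun setT phi -> mu.-integrable setT F ->
  @measurable _ Y = <<s G >> -> setI_closed G ->
  (\int[mu]_x F x = 0)%E ->
  (forall A, G A -> \int[mu]_(x in phi @^-1` A) F x = 0)%E ->
  (forall A, measurable A -> \int[mu]_(x in phi @^-1` A) F x = 0)%E.
Proof.
move=> mphi iF GE GI FT FG A; rewrite GE.
have mp B : measurable B -> measurable (phi @^-1` B).
  by move=> mB; rewrite -[_ @^-1` _]setTI; exact: mphi.
apply: (@dynkin_induction _ Y G (fun A => \int[mu]_(x in phi @^-1` A) F x = 0)%E) => //.
- move=> S mS S0; have := FT; rewrite -(setvU (phi @^-1` S)) integral_setU//.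
  + by rewrite S0 adde0.
  + by apply: measurableC; exact: mp.
  + exact: mp.
  + by apply: (@measurable_funS _ _ _ _ setT) => //; exact: measurable_int iF.
  + by rewrite disj_set2E; apply/eqP; rewrite setICl.
- move=> S mS tS S0; rewrite preimage_bigcup integral_bigcup//.
  + by apply: eseries0 => i _ _; exact: S0.
  + apply/trivIsetP => i j _ _ ij; rewrite -preimage_setI.
    by move/trivIsetP : tS => /(_ i j I I ij) ->; rewrite preimage_set0.
  + by move=> k; exact: mp.
  + by apply: (integrableS measurableT) => //; apply: bigcup_measurable => k _; exact: mp.
Qed.

Lemma ooitv_setI : setI_closed (@RGenOpens.G R).
Proof.
move=> A B [a [b ->]] [c [e ->]]; exists (Num.max a c), (Num.min b e).
by apply/seteqP; split => x; rewrite /= !in_itv/= gt_max lt_min => *; lra.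
Qed.

(** The previous lemma is applied to each coordinate in turn, then to products
    of measurable sets.  Bounded support is used to write the integral over
    the whole plane as one over a rectangle. *)
Lemma ae_eq0_rectangles (F : MR * MR -> R) (M : R) :
  leb2.-integrable setT (EFin \o F) ->
  (forall x, F x != 0 -> - M < x.1 < M /\ - M < x.2 < M) ->
  (forall a b c d : R, \int[leb2]_(x in `]a, b[ `*` `]c, d[) (F x)%:E = 0)%E ->
  {ae leb2, forall x, F x = 0}.
Proof.
move=> iF FM F0.
have mF : measurable_fun setT (EFin \o F) by exact: measurable_int iF.
have mo (a b : R) : measurable (`]a, b[%classic : set MR) by exact: measurable_itv.
have mG : @measurable _ MR = <<s @RGenOpens.G R >> by exact: RGenOpens.measurableE.
have restr (S D : set (MR * MR)) : (forall x, F x != 0 -> (D x <-> S x)) ->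
   (\int[leb2]_(x in D) (F x)%:E = \int[leb2]_(x in S) (F x)%:E)%E.
  move=> DS; rewrite integral_mkcond [RHS]integral_mkcond; apply: eq_integral => x _.
  rewrite !patchE; have [->|/DS e] := eqVneq (F x) 0; first by case: ifP; case: ifP.
  suff -> : (x \in D) = (x \in S) by [].
  by apply/idP/idP; rewrite !in_setE; apply e.
have itvM (t : R) : - M < t < M <-> `]- M, M[%classic t by rewrite /= in_itv.
have step1 (c d : R) (A : set MR) : measurable A -> (\int[leb2]_(x in A `*` `]c, d[) (F x)%:E = 0)%E.
  move=> mA.
  have -> : A `*` `]c, d[ = (fst @^-1` A) `&` (setT `*` `]c, d[) :> set (MR * MR).
    by apply/seteqP; split => [x [? ?]|x [? [_ ?]]].
  have mT : measurable (setT `*` `]c, d[ : set (MR * MR)) by exact: measurableX.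
  rewrite integral_mkcondr.
  apply: (@integral_eq0_dynkin _ _ _ MR leb2 fst (@RGenOpens.G R)) => //.
  - by rewrite -integrable_mkcond//; exact: integrableS iF.
  - exact: ooitv_setI.
  - rewrite -integral_mkcond -[RHS](F0 (- M) M c d); apply: restr => x /FM[/itvM x1 _].
    by split => [[_ ?]|[_ ?]].
  - move=> B [a [b ->]]; rewrite -integral_mkcondr -[RHS](F0 a b c d).
    by apply: restr => x _; split => [[? [_ ?]]|[? ?]].
have step2 (A B : set MR) : measurable A -> measurable B -> (\int[leb2]_(x in A `*` B) (F x)%:E = 0)%E.
  move=> mA mB.
  have -> : A `*` B = (snd @^-1` B) `&` (A `*` setT) :> set (MR * MR).
    by apply/seteqP; split => [x [? ?]|x [? [? _]]].
  have mT : measurable (A `*` setT : set (MR * MR)) by exact: measurableX.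
  rewrite integral_mkcondr.
  apply: (@integral_eq0_dynkin _ _ _ MR leb2 snd (@RGenOpens.G R)) => //.
  - by rewrite -integrable_mkcond//; exact: integrableS iF.
  - exact: ooitv_setI.
  - rewrite -integral_mkcond -[RHS](step1 (- M) M A mA); apply: restr => x /FM[_ /itvM x1].
    by split => [[? _]|[? _]].
  - move=> C [c [d ->]]; rewrite -integral_mkcondr -[RHS](step1 c d A mA).
    by apply: restr => x _; split => [[? [? _]]|[? ?]].
have step3 (E : set (MR * MR)) : measurable E -> (\int[leb2]_(x in E) (F x)%:E = 0)%E.
  apply: (@integral_eq0_dynkin _ _ _ _ leb2 id
    [set A `*` B | A in (measurable : set (set MR)) & B in (measurable : set (set MR))]) => //.
  - exact: measurable_prod_measurableType.
  - move=> _ _ [A mA [B mB <-]] [A' mA' [B' mB' <-]]; rewrite -setXI.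
    exists (A `&` A'); first exact: measurableI.
    by exists (B `&` B') => //; exact: measurableI.
  - by rewrite -setXTT; apply: step2.
  - by move=> _ [A mA [B mB <-]]; exact: step2.
have := @integral_ae_eq _ _ _ leb2 setT measurableT (cst 0%E) (EFin \o F) iF.
move=> /(_ (measurable_cst _)) h.
have {h} : ae_eq leb2 setT (EFin \o F) (cst 0%E).
  by apply: h => E _ mE; rewrite step3// integral0.
by apply: filterS => x /(_ I)[].
Qed.

End Rectangles.

(** * Topology of the plane and test functions *)

Section AlmostEverywhere.
Context d (T : measurableType d) (R : realType) (mu : {measure set T -> \bar R}).

Lemma ae_mono (P Q : T -> Prop) : (forall x, P x -> Q x) ->
  {ae mu, forall x, P x} -> {ae mu, forall x, Q x}.
Proof. by move=> PQ; apply: filterS. Qed.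

Lemma ae_and (P Q : T -> Prop) : {ae mu, forall x, P x} -> {ae mu, forall x, Q x} ->
  {ae mu, forall x, P x /\ Q x}.
Proof. by move=> p q; apply: filterI. Qed.

End AlmostEverywhere.

Section PlaneTopology.
Context {R : realType}.
Local Notation MR := (measurableTypeR R).
Local Notation leb := (@lebesgue_measure R).
Local Notation leb2 := (leb \x leb)%E.
Local Notation B := (@unit_ball R).

(** Countably many boxes that form a basis of the topology. *)
Definition rat_box (q : rat * rat * rat) : set (R * R) :=
  ball ((ratr q.1.1, ratr q.1.2) : R * R) (ratr q.2 : R).

Lemma ball_planeE (x y : R * R) (e : R) :
  ball x e y <-> `|x.1 - y.1| < e /\ `|x.2 - y.2| < e.
Proof. by split => -[]; split. Qed.

Lemma rat_boxP (x : R * R) (e : R) : 0 < e ->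
  exists q, rat_box q x /\ rat_box q `<=` ball x e.
Proof.
move=> e0.
have [r] := @rat_in_itvoo R (e / 4) (e / 2) ltac:(lra).
have [a] := @rat_in_itvoo R (x.1 - e / 4) (x.1 + e / 4) ltac:(lra).
have [b] := @rat_in_itvoo R (x.2 - e / 4) (x.2 + e / 4) ltac:(lra).
rewrite !in_itv/= => /andP[b1 b2] /andP[a1 a2] /andP[r1 r2].
exists (a, b, r); split.
  by apply/ball_planeE; split => /=; rewrite ltr_distlC; apply/andP; split; lra.
move=> y /ball_planeE[]/=; rewrite !ltr_distlC => /andP[y1 y2] /andP[y3 y4].
by apply/ball_planeE; split; rewrite ltr_distlC; apply/andP; split; lra.
Qed.

Lemma open_measurable2 (O : set (R * R)) : open O -> measurable (O : set (MR * MR)).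
Proof.
move=> oO.
have mball (x : R * R) (e : R) : measurable (ball x e : set (MR * MR)).
  have -> : ball x e = (ball x.1 e `*` ball x.2 e) :> set (MR * MR).
    by apply/seteqP; split => y [].
  by apply: measurableX; exact: measurable_ball.
have -> : O = \bigcup_n (if unpickle n is Some q then
    if `[< rat_box q `<=` O >] then rat_box q else set0 else set0).
  apply/seteqP; split => x.
    move=> Ox; have /nbhs_ballP[e e0 eO] : nbhs x O by exact: open_nbhs_nbhs.
    have [q [qx qe]] := rat_boxP x e0.
    exists (pickle q); first exact: I.
    rewrite pickleK; case: asboolP => [_|[]]; first exact: qx.
    exact: subset_trans qe eO.
  move=> [n _]; case: unpickle => [q|]; last by case.
  by case: asboolP => [qO /qO|_ []].
apply: bigcup_measurable => n _; case: unpickle => [q|]; last exact: measurable0.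
by case: asboolP => _; [exact: mball|exact: measurable0].
Qed.

Lemma continuous_measurable2 (f : R * R -> R) : continuous f ->
  measurable_fun setT (f : MR * MR -> MR).
Proof.
move=> cf; apply: (measurability (@RGenOpens.G R)); first exact: RGenOpens.measurableE.
move=> _ [_ [a [b ->]] <-]; rewrite setTI; apply: open_measurable2.
by move/continuousP : cf; apply; exact: interval_open.
Qed.

(** The null sets can be collected over the countably many rational boxes. *)
Lemma ae_local (Q : MR * MR -> Prop) (Om : set (R * R)) :
  (forall x, Om x -> exists2 e : R, 0 < e & {ae leb2, forall y, ball x e y -> Q y}) ->
  {ae leb2, forall x, Om x -> Q x}.
Proof.
move=> h.
pose good q := {ae leb2, forall y : MR * MR, rat_box q y -> Q y}.
have : {ae leb2, forall x, forall n : nat,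
    if unpickle n is Some q then good q -> rat_box q x -> Q x else True}.
  apply: ae_foralln => n; case: unpickle => [q|]; last exact: aeW.
  have [gq|ngq] := pselect (good q); last by apply: aeW => x /ngq.
  by move: (gq); apply: ae_mono => x Qx _; exact: Qx.
apply: ae_mono => x hx Ox.
have [e e0 ae] := h _ Ox.
have [q [qx qe]] := rat_boxP x e0.
have := hx (pickle q); rewrite pickleK; apply => //.
by move: ae; apply: ae_mono => y hy /qe.
Qed.

Lemma test_function_continuous (phi : R * R -> R) : test_function phi -> continuous phi.
Proof. by move=> [/(_ [::])[]]. Qed.

Lemma test_function_derive (phi : R * R -> R) (e : R * R) : test_function phi ->
  e \in [:: e1; e2] -> test_function ('D_e phi).
Proof.
move=> [sphi [K [cK KB phi0]]] ee; split; first exact: smooth_partial.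
exists K; split => // x nKx.
have cl : closed K by apply: compact_closed => //; exact: norm_hausdorff.
have n0 : \forall y \near x, phi y = 0.
  have : nbhs x (~` K) by apply: open_nbhs_nbhs; split => //; exact: closed_openC.
  by apply: filterS => y /phi0.
have := @near_eq_is_derive R _ R (cst 0) phi x e 0 _ (is_derive_cst 0 x e).
by case => //; by apply: filterS n0 => y ->.
Qed.

Lemma test_function_bounded (phi : R * R -> R) : test_function phi ->
  exists C, forall x, `|phi x| <= C.
Proof.
move=> tphi; have cphi := test_function_continuous tphi.
have [_ [K [cK KB phi0]]] := tphi.
have : compact (phi @` K) by apply: continuous_compact => //; exact: continuous_subspaceT.
move=> /compact_bounded [M [_ hM]]; exists (`|M| + 1) => x.
have [Kx|nKx] := pselect (K x); last by rewrite phi0// normr0 addr_ge0.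
by apply: (hM (`|M| + 1)); [rewrite ltr_pwDr// ler_norm|exists x].
Qed.

Lemma test_function_outside (phi : R * R -> R) x : test_function phi -> ~ B x -> phi x = 0.
Proof. by move=> [_ [K [_ KB h]]] nBx; apply: h => /KB. Qed.

Lemma measurable_test_function (phi : R * R -> R) : test_function phi ->
  measurable_fun setT (phi : MR * MR -> MR).
Proof. by move=> /test_function_continuous; exact: continuous_measurable2. Qed.

End PlaneTopology.

(** * Test functions in slanted coordinates *)

Section SlantedTest.
Context {R : realType}.
Local Notation leb := (@lebesgue_measure R).
Local Notation B := (@unit_ball R).

(** In the coordinates (z, t) with x = (z + s t, t), the operator s D_1 + D_2
    is the derivative in t, so it does not see the factor al(z). *)
Lemma test_slanted (s : R) (al be al' be' : R -> R) (a b e d : R) :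
  smooth1 al -> smooth1 be -> (forall t : R, is_derive t 1 al (al' t)) ->
  (forall t : R, is_derive t 1 be (be' t)) ->
  (forall z, ~ (a <= z <= b) -> al z = 0) -> (forall t, ~ (e <= t <= d) -> be t = 0) ->
  (forall z t, a <= z <= b -> e <= t <= d -> B (z + s * t, t)) ->
  let phi (x : R * R) := al (x.1 - s * x.2) * be x.2 in
  test_function phi /\
  forall x, s * 'D_e1 phi x + 'D_e2 phi x = al (x.1 - s * x.2) * be' x.2.
Proof.
move=> sal sbe dal dbe al0 be0 KB phi.
pose phi2 (x : R * R) := al (1 * x.1 + (- s) * x.2) * be (0 * x.1 + 1 * x.2).
have e12 : phi = phi2.
  by apply/funext => x; rewrite /phi /phi2 !mul1r mul0r add0r mulNr.
have dphi v x : is_derive x v phi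
    (al (x.1 - s * x.2) * (v.2 * be' x.2) + be x.2 * ((v.1 - s * v.2) * al' (x.1 - s * x.2))).
  rewrite e12.
  have := is_deriveM (@is_derive_linear R al al' 1 (- s) x v (dal _))
    (@is_derive_linear R be be' 0 1 x v (dbe _)).
  move=> h; apply: (is_derive_ext h) => //.
  by rewrite /GRing.scale/= !mul1r !mul0r !add0r !mulNr.
split; last by move=> x; rewrite !derive_val /= ; ring.
split.
  rewrite e12; apply/smooth2_smooth/smooth2_mul; exact: smooth2_linear.
exists ((fun x : R * R => (x.1 + s * x.2, x.2)) @` (`[a, b] `*` `[e, d])); split.
- apply: continuous_compact; last by apply: compact_setX; exact: segment_compact.
  apply: continuous_subspaceT => x.
  apply: (@cvg_pair _ _ _ _ (nbhs (x.1 + s * x.2)) (nbhs x.2)); last exact: cvg_snd.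
  by apply: cvgD; [exact: cvg_fst|apply: cvgM; [exact: cvg_cst|exact: cvg_snd]].
- by move=> _ [[z t] [/= zab ted] <-]; apply: KB; rewrite -?in_itv.
- move=> x nK; rewrite /phi.
  have [zab|/al0->] := pselect (a <= x.1 - s * x.2 <= b); last by rewrite mul0r.
  have [ted|/be0->] := pselect (e <= x.2 <= d); last by rewrite mulr0.
  exfalso; apply: nK; exists (x.1 - s * x.2, x.2); first by split; rewrite /= in_itv.
  by case: x {zab ted} => x1 x2 /=; rewrite subrK.
Qed.

Lemma bump_itv (a b : R) : exists f : nat -> R -> R,
  [/\ forall n, smooth1 (f n), forall n t, 0 <= f n t <= 1,
      forall n t, ~ (a < t < b) -> f n t = 0 &
      forall t, a < t < b -> \forall n \near \oo, f n t = 1].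
Proof.
have [th [_ [_ [[sth _ th01] [th0 th1 _ _ _]]]]] := @smooth_step R.
exists (fun n t => th (n%:R * t + (- (n%:R * a))) * th (- n%:R * t + n%:R * b)); split.
- by move=> n; apply: smooth1_mul; exact: smooth1_affine.
- move=> n t; have /andP[h1 h2] := th01 (n%:R * t + (- (n%:R * a))).
  have /andP[h3 h4] := th01 (- n%:R * t + n%:R * b).
  by rewrite mulr_ge0//= mulr_ile1.
- move=> n t tab; have [ta|ta] := leP t a.
    rewrite th0 ?mul0r// -mulrBr mulr_ge0_le0//; lra.
  have tb : b <= t by rewrite leNgt; apply/negP => tb; apply: tab; rewrite ta.
  rewrite [X in _ * X]th0 ?mulr0// mulNr addrC -mulrBr mulr_ge0_le0//; lra.
- move=> t /andP[ta tb].
  near=> n; rewrite !th1 ?mulr1//.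
    rewrite mulNr addrC -mulrBr -ler_pdivrMr ?subr_gt0//.
    near: n; exact: nbhs_infty_ger.
  rewrite -mulrBr -ler_pdivrMr ?subr_gt0//.
  near: n; exact: nbhs_infty_ger.
Unshelve. all: by end_near. Qed.

Lemma above_primitive (f : R -> R) (c d : R) : smooth1 f ->
  (forall t, t <= c -> f t = 0) -> (forall t, d <= t -> f t = 0) ->
  [/\ smooth1 (above f), forall t : R, is_derive t 1 (above f) (- f t) &
      forall t, d <= t -> above f t = 0].
Proof.
move=> sf fc fd.
have jf : leb.-integrable setT (EFin \o f).
  exact: integrable_compact_support (smooth1_continuous sf) fc fd.
have E : above f = fun t => \int[leb]_x f x + (-1) * primitive f t.
  apply/funext => t; rewrite (below_above t jf) mulN1r.
  rewrite [X in _ = X + _ - _](_ : _ = primitive f t); first by rewrite addrAC subrr add0r.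
  by rewrite /below /primitive -(@Rintegral_itv_bndo_bndc _ -oo%O)//; exact: integrableS jf.
split.
- rewrite E; apply: smooth1_add; first exact: smooth1_cst.
  by apply: smooth1_mul; [exact: smooth1_cst|exact: smooth1_primitive_int fc fd].
- move=> t; rewrite E.
  have := is_deriveD (is_derive_cst (\int[leb]_x f x) t 1) (is_deriveZ (-1) (is_derive_primitive sf fc fd t)).
  by move=> h; apply: (is_derive_ext h) => //; rewrite add0r scaleN1r.
- by move=> t dt; rewrite E (primitive_right fd)// mulN1r subrr.
Qed.

End SlantedTest.

(** * Primitives along vertical lines *)

Section Slices.
Context {R : realType}.
Local Notation MR := (measurableTypeR R).
Local Notation leb := (@lebesgue_measure R).
Local Notation leb2 := (leb \x leb)%E.

Lemma integrable_measurable (f : MR * MR -> R) :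
  leb2.-integrable setT (EFin \o f) -> measurable_fun setT f.
Proof. by move=> jf; apply/measurable_EFinP; exact: measurable_int jf. Qed.

Lemma integrable_mulb2 (f h : MR * MR -> R) (C : R) : leb2.-integrable setT (EFin \o f) ->
  measurable_fun setT h -> (forall x, `|h x| <= C) ->
  leb2.-integrable setT (fun x => (f x * h x)%:E).
Proof.
move=> jf mh hC; under eq_fun do rewrite mulrC.
by apply: (integrable_mulb (C := C)).
Qed.

Variable h : MR * MR -> R.
Hypothesis ih : leb2.-integrable setT (EFin \o h).

Definition slice_below (x : MR * MR) : R := below (fun tau => h (x.1, tau)) x.2.

Let mh : measurable_fun setT h. Proof. exact: integrable_measurable. Qed.

Lemma measurable_slice z : measurable_fun setT (fun tau => h (z, tau)).
Proof.
have mp : measurable_fun setT (fun t : MR => (z : MR, t)) by apply/measurable_fun_pair.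
exact: (measurableT_comp mh mp).
Qed.

Lemma measurable_slice_below : measurable_fun setT slice_below.
Proof. exact: measurable_below mh. Qed.

Definition slice_mass (z : MR) : \bar R := (\int[leb]_tau `|h (z, tau)|%:E)%E.

Lemma slice_below_le x : (`|slice_below x|%:E <= slice_mass x.1)%E.
Proof.
have [fin|] := ltP (slice_mass x.1) +oo%E; last by rewrite leye_eq => /eqP ->; rewrite leey.
have iz : leb.-integrable setT (EFin \o (fun tau => h (x.1, tau))).
  by apply/integrableP; split; [apply/measurable_EFinP; exact: measurable_slice|].
apply: le_trans (_ : (\int[leb]_tau `|h (x.1, tau)|)%R%:E <= _)%E.
  by rewrite lee_fin; exact: below_bound.
by rewrite fineK//; apply: integrable_fin_num => //; exact: integrable_norm.
Qed.

(** The primitive along a line is bounded by the mass of the integrand on that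
    line, which is integrable across the lines; the cut-off to a strip gives
    integrability along them. *)
Lemma integrable_slice_below (c d : R) (chi : MR * MR -> R) : measurable_fun setT chi ->
  (forall x, `|chi x| <= \1_(`]c, d[%classic) x.2) ->
  leb2.-integrable setT (fun x => (slice_below x * chi x)%:E).
Proof.
move=> mchi hchi.
have mm : measurable_fun setT slice_mass.
  apply: (@measurable_fun_fubini_tonelli_F _ _ _ _ _ leb (fun x => `|h x|%:E)) => //.
  by apply/measurable_EFinP; exact: measurableT_comp.
have mprod : measurable_fun setT (fun x => (slice_below x * chi x)%:E).
  apply/measurable_EFinP; apply: measurable_funM => //; exact: measurable_slice_below.
apply/integrable12ltyP => //.
pose L := leb `]c, d[%classic.
have m0 z : (0 <= slice_mass z)%E by exact: integral_ge0.
have mI : measurable_fun setT (fun t : MR => (\1_(`]c, d[%classic : set MR) t)%:E : \bar R).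
  by apply/measurable_EFinP; exact: measurable_indic.
have le1 z : (\int[leb]_t `|(slice_below (z, t) * chi (z, t))%:E| <= slice_mass z * L)%E.
  apply: (@le_trans _ _ (\int[leb]_t (slice_mass z * (\1_(`]c, d[%classic : set MR) t)%:E))%E).
    apply: ge0_le_integral => //.
    - apply: measurableT_comp => //.
      have mp : measurable_fun setT (fun t : MR => (z : MR, t)) by apply/measurable_fun_pair.
      exact: (measurableT_comp mprod mp).
    - exact: measurable_funeM.
    - move=> t _; rewrite abse_EFin normrM EFinM; apply: lee_pmul => //.
        exact: (slice_below_le (z, t)).
      by rewrite lee_fin; exact: (hchi (z, t)).
  rewrite ge0_integralZl//.
  by rewrite integral_indic// setIT.
apply: (@le_lt_trans _ _ (\int[leb]_z (slice_mass z * L))%E).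
  apply: ge0_le_integral => //.
  - by move=> z _; exact: integral_ge0.
  - apply: (@measurable_fun_fubini_tonelli_F _ _ _ _ _ leb (fun x => `|(slice_below x * chi x)%:E|%E)) => //.
    exact: measurableT_comp.
  - by under eq_fun do rewrite muleC; exact: measurable_funeM.
have [L0 Lfin] : (0 <= L)%E /\ (L < +oo)%E.
  by rewrite /L lebesgue_measure_itv/=; case: ifP => // cd; rewrite -EFinB lee_fin ltry subr_ge0 ltW.
rewrite ge0_integralZr// lte_mul_pinfty ?integral_ge0//.
have /(integrable12ltyP leb leb) : measurable_fun setT (EFin \o h) by exact/measurable_EFinP.
by move=> /iffLR /(_ ih) jj; rewrite ge0_fin_numE ?integral_ge0.
Qed.

End Slices.

(** * Testing along slanted lines *)

Section SlantedLines.
Context {R : realType}.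
Local Notation MR := (measurableTypeR R).
Local Notation leb := (@lebesgue_measure R).
Local Notation leb2 := (leb \x leb)%E.
Local Notation B := (@unit_ball R).

Definition half_ball : set (R * R) := [set x | B x /\ 0 < x.2].

(** The form that [weak_partial] takes for integrable functions extended by
    zero to the whole plane. *)
Definition weak_pair (V : MR * MR -> R) (i : R * R) (G : MR * MR -> R) : Prop :=
  forall phi, test_function phi ->
    \int[leb2]_x (V x * 'D_i phi x) = - \int[leb2]_x (G x * phi x).

Variables V G1 G2 : MR * MR -> R.
Hypotheses (iV : leb2.-integrable setT (EFin \o V))
  (iG1 : leb2.-integrable setT (EFin \o G1))
  (iG2 : leb2.-integrable setT (EFin \o G2)).
Hypotheses (V0 : forall x, ~ half_ball x -> V x = 0)
  (G10 : forall x, ~ half_ball x -> G1 x = 0) (G20 : forall x, ~ half_ball x -> G2 x = 0).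
Hypotheses (w1 : weak_pair V e1 G1) (w2 : weak_pair V e2 G2).

Variable s : R.

(** The derivative of V in the direction (s, 1). *)
Definition slant (x : MR * MR) : R := s * G1 x + G2 x.
Definition slantS : MR * MR -> R := slant \o shear s.
Let VS : MR * MR -> R := V \o shear s.
Let U : MR * MR -> R := slice_below slantS.

Lemma integrable_shear (f : MR * MR -> R) : leb2.-integrable setT (EFin \o f) ->
  leb2.-integrable setT (EFin \o (f \o shear s)).
Proof.
move=> jf; have mf := measurable_int _ jf; apply/integrableP; split.
  exact: (measurableT_comp mf (@measurable_shear R s)).
have mn : measurable_fun setT (fun x => `|(f x)%:E|%E) by exact: measurableT_comp.
have := @integral_preserving _ _ _ leb2 _ (@measurable_shear R s) (@leb2_shear R s) _ mn.
by move=> /= ->; move/integrableP : jf => [].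
Qed.

Lemma integrable_slant : leb2.-integrable setT (EFin \o slant).
Proof. exact: (integrableD measurableT (integrableZl measurableT s iG1) iG2). Qed.

Let mV : measurable_fun setT V := integrable_measurable iV.
Let mG1 : measurable_fun setT G1 := integrable_measurable iG1.
Let mG2 : measurable_fun setT G2 := integrable_measurable iG2.

Lemma weak_slanted phi : test_function phi ->
  \int[leb2]_x (V x * (s * 'D_e1 phi x + 'D_e2 phi x)) = - \int[leb2]_x (slant x * phi x).
Proof.
move=> tphi.
have t1 : test_function ('D_e1 phi) by apply: test_function_derive => //; rewrite !inE eqxx.
have t2 : test_function ('D_e2 phi) by apply: test_function_derive => //; rewrite !inE eqxx orbT.
have ib f psi : leb2.-integrable setT (EFin \o f) -> test_function psi ->
    leb2.-integrable setT (EFin \o (fun x => f x * psi x)).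
  move=> jf tpsi; have [C hC] := test_function_bounded tpsi.
  exact: (integrable_mulb2 jf (measurable_test_function tpsi) hC).
transitivity (s * \int[leb2]_x (V x * 'D_e1 phi x) + \int[leb2]_x (V x * 'D_e2 phi x)).
  rewrite -RintegralZl//; last exact: ib.
  rewrite -RintegralD//; [|exact: (integrableZl measurableT s (ib _ _ iV t1))|exact: ib].
  by apply: eq_Rintegral => x _; ring.
rewrite (w1 tphi) (w2 tphi) mulrN -opprD; congr (- _).
rewrite -RintegralZl//; last exact: ib.
rewrite -RintegralD//; [|exact: (integrableZl measurableT s (ib _ _ iG1 tphi))|exact: ib].
by apply: eq_Rintegral => x _; rewrite /slant; ring.
Qed.

Section Rectangle.
Variables a b c d delta : R.
Hypotheses (delta0 : 0 < delta).
Hypothesis inB : forall z t, a <= z <= b -> - delta <= t <= d -> B (z + s * t, t).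

(** Test with al(z) times the primitive of psi that vanishes for large t: its
    derivative in t is - al(z) psi(t) where t >= 0.  The factor eta brings it
    back to zero below the axis, where V vanishes; this is where the zero
    extension of V enters. *)
Lemma integral_VS_test (al psi : R -> R) : smooth1 al -> smooth1 psi ->
  (forall z, ~ (a < z < b) -> al z = 0) -> (forall t, ~ (c < t < d) -> psi t = 0) ->
  (forall z, `|al z| <= 1) -> (forall t, `|psi t| <= 1) ->
  \int[leb2]_x (VS x * (al x.1 * psi x.2)) = \int[leb2]_x (slantS x * (al x.1 * above psi x.2)).
Proof.
move=> sal spsi al0 psi0 al1 psi1.
have psic t : t <= c -> psi t = 0 by move=> tc; apply: psi0 => ?; lra.
have psid t : d <= t -> psi t = 0 by move=> tc; apply: psi0 => ?; lra.
have [sab dab abd] := above_primitive spsi psic psid.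
have [th [th' [_ [[sth dth _] [th0 th1 _ _ th1']]]]] := @smooth_step R.
have [al' _ dal] := smooth1_derive sal.
pose eta t := th (delta^-1 * t + 1).
pose eta' t := delta^-1 * th' (delta^-1 * t + 1).
have seta : smooth1 eta by exact: smooth1_affine.
have deta (t : R) : is_derive t 1 eta (eta' t).
  rewrite /eta' mulrC; apply: (@is_derive1_comp _ th (fun t => delta^-1 * t + 1)).
  exact: is_derive_affine.
have eta_r t : 0 <= t -> eta t = 1.
  by move=> t0; rewrite /eta th1// lerDr mulr_ge0// invr_ge0 ltW.
have eta_r' t : 0 <= t -> eta' t = 0.
  by move=> t0; rewrite /eta' th1' ?mulr0// lerDr mulr_ge0// invr_ge0 ltW.
have eta_l t : t <= - delta -> eta t = 0.
  by move=> td; rewrite /eta th0// -lerBrDr sub0r mulrC ler_pdivrMr// mulN1r.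
have [|||||tphi dphi] := @test_slanted R s al (fun t => eta t * above psi t) al'
    (fun t => eta' t * above psi t + eta t * - psi t) a b (- delta) d sal _ dal.
- exact: smooth1_mul.
- move=> t; apply: (is_derive_ext (is_deriveM (deta t) (dab t))) => //.
  by rewrite addrC /GRing.scale/= [above psi t * _]mulrC.
- by move=> z nz; apply: al0 => ?; apply: nz; lra.
- move=> t nt; have [td|td] := leP t (- delta); first by rewrite eta_l ?mul0r.
  by rewrite abd ?mulr0// leNgt; apply/negP => ?; apply: nt; lra.
- exact: inB.
set phi := fun x : R * R => _ in tphi dphi.
have mshear := @measurable_shear R s.
have shearE (f : MR * MR -> R) : measurable_fun setT f ->
    \int[leb2]_x f (shear s x) = \int[leb2]_x f x.
  move=> mf; congr fine.
  apply: (@integral_preserving _ _ _ leb2 _ mshear (@leb2_shear R s) (EFin \o f)).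
  exact/measurable_EFinP.
have mcomp (f : R -> R) : smooth1 f -> measurable_fun setT (f : MR -> MR).
  by move=> /smooth1_continuous; exact: continuous_measurable_fun.
have m1 : measurable_fun setT (fun x : MR * MR => (x.1 - s * x.2 : MR)).
  by apply: measurable_funB => //; exact: measurable_funM.
have mal : measurable_fun setT (fun x : MR * MR => al (x.1 - s * x.2)).
  exact: (measurableT_comp (mcomp _ sal) m1).
have mpsi : measurable_fun setT (fun x : MR * MR => psi x.2).
  exact: (measurableT_comp (mcomp _ spsi)).
have mab : measurable_fun setT (fun x : MR * MR => above psi x.2).
  exact: (measurableT_comp (mcomp _ sab)).
transitivity (\int[leb2]_x (V x * (al (x.1 - s * x.2) * psi x.2))).
  rewrite -[RHS]shearE; last by do 2 apply: measurable_funM => //.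
  by apply: eq_Rintegral => x _; rewrite /= addrK.
transitivity (\int[leb2]_x (slant x * (al (x.1 - s * x.2) * above psi x.2))); last first.
  rewrite -[LHS]shearE; last first.
    by apply: measurable_funM; [exact: integrable_measurable integrable_slant|exact: measurable_funM].
  by apply: eq_Rintegral => x _; rewrite /= addrK.
have pos x : ~ half_ball x \/ 0 <= x.2.
  by have [[_ /ltW]|] := pselect (half_ball x); [right|left].
have -> : \int[leb2]_x (slant x * (al (x.1 - s * x.2) * above psi x.2)) =
    \int[leb2]_x (slant x * phi x).
  apply: eq_Rintegral => x _; rewrite /phi; have [nx|x2] := pos x.
    by rewrite /slant G10// G20// mulr0 addr0 !mul0r.
  by rewrite eta_r// mul1r.
apply: oppr_inj; rewrite -weak_slanted// -[LHS]mulN1r -RintegralZl//.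
  apply: eq_Rintegral => x _; rewrite dphi; have [nx|x2] := pos x.
    by rewrite V0// !mul0r mulr0.
  by rewrite eta_r// eta_r'// mul0r; ring.
apply: (integrable_mulb2 (C := 1) iV); first exact: measurable_funM.
by move=> x; rewrite normrM mulr_ile1.
Qed.

Lemma integrable_primitive_strip (chi : MR * MR -> R) : measurable_fun setT chi ->
  (forall x, `|chi x| <= \1_(`]c, d[%classic) x.2) ->
  leb2.-integrable setT (fun x => (U x * chi x)%:E).
Proof. exact: (integrable_slice_below (integrable_shear integrable_slant)). Qed.

Lemma integral_U_test (al psi : R -> R) : smooth1 al -> smooth1 psi ->
  (forall z, ~ (a < z < b) -> al z = 0) -> (forall t, ~ (c < t < d) -> psi t = 0) ->
  (forall z, `|al z| <= 1) -> (forall t, `|psi t| <= 1) ->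
  \int[leb2]_x (slantS x * (al x.1 * above psi x.2)) = \int[leb2]_x (U x * (al x.1 * psi x.2)).
Proof.
move=> sal spsi al0 psi0 al1 psi1.
have psic t : t <= c -> psi t = 0 by move=> tc; apply: psi0 => ?; lra.
have psid t : d <= t -> psi t = 0 by move=> tc; apply: psi0 => ?; lra.
have [sab _ _] := above_primitive spsi psic psid.
have jpsi : leb.-integrable setT (EFin \o psi).
  exact: integrable_compact_support (smooth1_continuous spsi) psic psid.
have mcomp (f : R -> R) : smooth1 f -> measurable_fun setT (f : MR -> MR).
  by move=> /smooth1_continuous; exact: continuous_measurable_fun.
have mal : measurable_fun setT (fun x : MR * MR => al x.1).
  exact: (measurableT_comp (mcomp _ sal)).
have mpsi : measurable_fun setT (fun x : MR * MR => psi x.2).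
  exact: (measurableT_comp (mcomp _ spsi)).
have mab : measurable_fun setT (fun x : MR * MR => above psi x.2).
  exact: (measurableT_comp (mcomp _ sab)).
have jS := integrable_shear integrable_slant.
have j1 : leb2.-integrable setT (fun x => (slantS x * (al x.1 * above psi x.2))%:E).
  apply: (integrable_mulb2 (C := \int[leb]_x `|psi x|) jS); first exact: measurable_funM.
  move=> x; rewrite normrM -[leRHS]mul1r; apply: ler_pM => //.
  exact: normr_Rintegral_le.
have j2 : leb2.-integrable setT (fun x => (U x * (al x.1 * psi x.2))%:E).
  apply: integrable_primitive_strip; first exact: measurable_funM.
  move=> x; rewrite indicE mem_setE in_itv/=; case: (boolP (c < x.2 < d)) => [_|/negP h].
    by rewrite normrM mulr_ile1.
  by rewrite psi0 ?mulr0 ?normr0.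
congr fine; rewrite -(integral12_prod_meas1 j1) -(integral12_prod_meas1 j2).
apply: ae_eq_integral => //.
- exact: measurable_fubini_F j1.
- exact: measurable_fubini_F j2.
have := ae_integrable1 jS; have := ae_integrable1 j1; have := ae_integrable1 j2.
move=> A1 A2 A3.
have := ae_and A1 (ae_and A2 A3); apply: ae_mono => z [i2 [i1 i3]] _.
rewrite /fubini_F/=.
rewrite -[LHS]fineK; last exact: integrable_fin_num.
rewrite -[RHS]fineK; last exact: integrable_fin_num.
congr EFin; rewrite -!/(Rintegral _ _ _).
transitivity (al z * \int[leb]_t (slantS (z, t) * above psi t)).
  rewrite -RintegralZl//; first by apply: eq_Rintegral => t _ /=; ring.
  have -> : EFin \o (fun t => slantS (z, t) * above psi t) =
      (fun t => (above psi t * slantS (z, t))%:E) by apply/funext => t /=; rewrite mulrC.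
  apply: (integrable_mulb (C := \int[leb]_x `|psi x|)) => //; first exact: mcomp.
  by move=> t _; exact: normr_Rintegral_le.
rewrite (integral_swap i3 jpsi) -RintegralZl//.
  by apply: eq_Rintegral => t _ /=; rewrite /U /slice_below/=; ring.
have -> : EFin \o (fun t => psi t * below (fun tau => slantS (z, tau)) t) =
    (fun t => (below (fun tau => slantS (z, tau)) t * psi t)%:E).
  by apply/funext => t /=; rewrite mulrC.
exact: integrable_mul_below i3 jpsi.
Qed.

(** The function V and the primitive U agree against products of bumps, which
    converge to the indicator of the rectangle. *)
Lemma integral_rectangle : (\int[leb2]_(x in `]a, b[ `*` `]c, d[) (VS x - U x)%:E = 0)%E.
Proof.
have [f [sf f01 f0 f1]] := bump_itv a b; have [g [sg g01 g0 g1]] := bump_itv c d.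
have fn n z : `|f n z| <= 1 by have /andP[h0 h1] := f01 n z; rewrite ger0_norm.
have gn n z : `|g n z| <= 1 by have /andP[h0 h1] := g01 n z; rewrite ger0_norm.
have mcomp (h : R -> R) : smooth1 h -> measurable_fun setT (h : MR -> MR).
  by move=> /smooth1_continuous; exact: continuous_measurable_fun.
have mfg n : measurable_fun setT (fun x : MR * MR => f n x.1 * g n x.2).
  apply: measurable_funM.
    exact: (measurableT_comp (mcomp _ (sf n))).
  exact: (measurableT_comp (mcomp _ (sg n))).
pose Q : set (MR * MR) := `]a, b[ `*` `]c, d[.
have mQ : measurable Q by apply: measurableX; exact: measurable_itv.
have jVS : leb2.-integrable setT (EFin \o VS) by exact: integrable_shear.
have QE (x : MR * MR) : \1_Q x = \1_(`]a, b[%classic) x.1 * \1_(`]c, d[%classic) x.2 :> R.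
  by rewrite !indicE /Q in_setX -natrM mulnb.
have i1 (chi : MR * MR -> R) : measurable_fun setT chi -> (forall x, `|chi x| <= \1_Q x) ->
    leb2.-integrable setT (EFin \o (fun x => (VS x - U x) * chi x)).
  move=> mchi hchi.
  have -> : EFin \o (fun x => (VS x - U x) * chi x) =
      ((fun x => (VS x * chi x)%:E) \- (fun x => (U x * chi x)%:E))%E.
    by apply/funext => x; rewrite /= -EFinB mulrBl.
  apply: integrableB => //.
    apply: (integrable_mulb2 (C := 1) jVS) => // x; apply: le_trans (hchi x) _.
    by rewrite indicE; case: (_ \in _).
  apply: integrable_primitive_strip => // x; apply: le_trans (hchi x) _.
  by rewrite QE ler_piMl// indicE; case: (_ \in _).
have fgQ n x : `|f n x.1 * g n x.2| <= \1_Q x.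
  rewrite QE normrM !indicE !mem_setE !in_itv/=.
  case: (boolP (a < x.1 < b)) => [_|/negP h]; last by rewrite f0// normr0 !mul0r.
  case: (boolP (c < x.2 < d)) => [_|/negP h]; last by rewrite g0// normr0 !mulr0.
  by rewrite mul1r mulr_ile1.
have zero n : (\int[leb2]_x ((VS x - U x) * (f n x.1 * g n x.2))%:E = 0)%E.
  rewrite -[LHS]fineK; last by apply: integrable_fin_num => //; exact: i1.
  congr EFin; rewrite -/(Rintegral _ _ _).
  transitivity (\int[leb2]_x (VS x * (f n x.1 * g n x.2) - U x * (f n x.1 * g n x.2))).
    by apply: eq_Rintegral => x _; rewrite mulrBl.
  rewrite RintegralB//; last 2 first.
  - apply: (integrable_mulb2 (C := 1) jVS) => // x; apply: le_trans (fgQ n x) _.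
    by rewrite indicE; case: (_ \in _).
  - apply: integrable_primitive_strip => // x; apply: le_trans (fgQ n x) _.
    by rewrite QE ler_piMl// indicE; case: (_ \in _).
  have E1 := integral_VS_test (sf n) (sg n) (f0 n) (g0 n) (fn n) (gn n).
  have E2 := integral_U_test (sf n) (sg n) (f0 n) (g0 n) (fn n) (gn n).
  by apply/eqP; rewrite subr_eq0; apply/eqP; exact: (etrans E1 E2).
have j1 := i1 (\1_Q : MR * MR -> R) (measurable_indic mQ).
have {j1} : leb2.-integrable setT (EFin \o (fun x => (VS x - U x) * \1_Q x)).
  by apply: j1 => x; rewrite ger0_norm.
move=> j1.
have [|||||_ _] := @dominated_convergence _ _ _ leb2 setT measurableT
  (fun n x => ((VS x - U x) * (f n x.1 * g n x.2))%:E)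
  (EFin \o (fun x => (VS x - U x) * \1_Q x))
  (fun x => `|(VS x - U x) * \1_Q x|%:E).
- by move=> n; apply: measurable_int (i1 _ (mfg n) (fgQ n)).
- exact: measurable_int j1.
- apply: aeW => x _; apply: cvg_near_cst.
  have [Qx|nQx] := boolP (x \in Q); last first.
    apply: nearW => n /=; have := fgQ n x; rewrite indicE (negbTE nQx) normr_le0 => /eqP ->.
    by [].
  move: (Qx); rewrite in_setE => -[/= + +]; rewrite !in_itv/= => /f1 fx /g1 gx.
  by apply: filterS2 fx gx => n h1 h2 /=; rewrite indicE Qx h1 h2 mulr1.
- exact: integrable_norm.
- apply: aeW => x n _; rewrite abse_EFin lee_fin !normrM ler_wpM2l//.
  by rewrite -normrM (le_trans (fgQ n x))// ler_norm.
under eq_fun do rewrite zero.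
move=> /cvg_lim h; rewrite integral_mkcond.
transitivity (\int[leb2]_x ((VS x - U x) * \1_Q x)%:E)%E.
  by apply: eq_integral => x _; rewrite patchE /= indicE; case: ifP; rewrite ?mulr1 ?mulr0.
by rewrite -[LHS](h (@ereal_hausdorff R)) lim_cst//; exact: ereal_hausdorff.
Qed.

End Rectangle.
End SlantedLines.

(** * Room around a segment of the disc *)

Section SlantedMargin.
Context {R : realType}.
Local Notation B := (@unit_ball R).

Lemma unit_ballE (x : R * R) : B x <-> x.1 ^+ 2 + x.2 ^+ 2 < 1.
Proof. by rewrite /unit_ball /= /enorm -[X in _ < X]sqrtr1 ltr_sqrt. Qed.

(** By convexity, the segment from a point of the disc to the foot (z0, 0) of
    its line stays in the disc, with room to spare. *)
Lemma slanted_margin (s z0 t0 : R) : -1 <= s <= 1 -> `|z0| < 1 -> 0 < t0 ->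
  (z0 + s * t0) ^+ 2 + t0 ^+ 2 < 1 ->
  exists2 e : R, 0 < e <= t0 / 2 & forall z t, z0 - e <= z <= z0 + e ->
    - e <= t <= t0 + e -> (z + s * t) ^+ 2 + t ^+ 2 < 1.
Proof.
move=> /andP[s1 s2] z1 t00 q0.
have z2 : z0 ^+ 2 < 1 by rewrite -(real_normK (num_real z0)) expr_lt1.
pose rho := Num.max (z0 ^+ 2) ((z0 + s * t0) ^+ 2 + t0 ^+ 2).
have rho1 : rho < 1 by rewrite gt_max z2.
(* The first coordinate will move by at most 2 e and the second by at most e,
   which changes the squared norm by at most 6 e + 5 e^2 < 12 e. *)
pose e := Num.min ((1 - rho) / 12) (t0 / 2).
have e0 : 0 < e by rewrite lt_min; apply/andP; split; lra.
have e1 : e <= (1 - rho) / 12 by rewrite ge_min lexx.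
have e2 : e <= t0 / 2 by rewrite ge_min lexx orbT.
have rho0 : 0 <= rho by rewrite le_max sqr_ge0.
exists e; first by rewrite e0.
move=> z t /andP[z3 z4] /andP[t1 t2].
(* t' is the point of the segment [0, t0] closest to t. *)
have [t' [t'0 t't0 tt']] : exists t', [/\ 0 <= t', t' <= t0 & `|t - t'| <= e].
  have [t_0|t_0] := leP t 0; first by exists 0; rewrite subr0 ler_norml; split; lra.
  have [tt0|tt0] := leP t t0; first by exists t; rewrite subrr normr0; split; lra.
  by exists t0; rewrite ler_norml; split; lra.
have q' : (z0 + s * t') ^+ 2 + t' ^+ 2 <= rho.
  pose l := t' / t0.
  have l0 : 0 <= l by rewrite divr_ge0// ltW.
  have l1 : l <= 1 by rewrite ler_pdivrMr// mul1r.
  have -> : t' = l * t0 by rewrite mulfVK// gt_eqF.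
  have r1 : z0 ^+ 2 <= rho by rewrite le_max lexx.
  have r2 : (z0 + s * t0) ^+ 2 + t0 ^+ 2 <= rho by rewrite le_max lexx orbT.
  apply: (@le_trans _ _ ((1 - l) * z0 ^+ 2 + l * ((z0 + s * t0) ^+ 2 + t0 ^+ 2))).
    rewrite -subr_ge0.
    have -> : (1 - l) * z0 ^+ 2 + l * ((z0 + s * t0) ^+ 2 + t0 ^+ 2) -
      ((z0 + s * (l * t0)) ^+ 2 + (l * t0) ^+ 2) = (s ^+ 2 + 1) * t0 ^+ 2 * (l * (1 - l)) by ring.
    have h1 : 0 <= s ^+ 2 + 1 by rewrite addr_ge0 ?sqr_ge0.
    have h2 : 0 <= 1 - l by lra.
    by rewrite mulr_ge0 ?(mulr_ge0 l0 h2)// mulr_ge0// sqr_ge0.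
  have : (1 - l) * z0 ^+ 2 <= (1 - l) * rho by rewrite ler_wpM2l//; lra.
  have : l * ((z0 + s * t0) ^+ 2 + t0 ^+ 2) <= l * rho by rewrite ler_wpM2l.
  lra.
pose p := z0 + s * t'.
have p2 : p ^+ 2 < 1 by apply: le_lt_trans rho1; apply: le_trans q'; rewrite lerDl sqr_ge0.
have p1 : `|p| < 1 by rewrite -(@expr_lt1 _ 2)// (real_normK (num_real p)).
have t'2 : t' ^+ 2 < 1 by apply: le_lt_trans rho1; apply: le_trans q'; rewrite lerDr sqr_ge0.
have t'1 : t' < 1 by rewrite -(@expr_lt1 _ 2).
have d1 : `|z + s * t - p| <= 2 * e.
  have -> : z + s * t - p = (z - z0) + s * (t - t') by rewrite /p; ring.
  apply: le_trans (ler_normD _ _) _.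
  have : `|z - z0| <= e by rewrite ler_norml; lra.
  have : `|s * (t - t')| <= e.
    by rewrite normrM -[leRHS]mul1r ler_pM// ler_norml s1.
  lra.
move: d1 tt' p1; rewrite !ler_norml ltr_norml => /andP[d1 d2] /andP[d3 d4] /andP[d5 d6].
have : p ^+ 2 + t' ^+ 2 <= rho by [].
set P := z + s * t in d1 d2 *.
have h1 : P ^+ 2 <= p ^+ 2 + 4 * e + 4 * e ^+ 2.
  have -> : P = p + (P - p) by ring.
  set D := P - p in d1 d2 *; nra.
have h2 : t ^+ 2 <= t' ^+ 2 + 2 * e + e ^+ 2.
  have -> : t = t' + (t - t') by ring.
  set D := t - t' in d3 d4 *; nra.
have : e ^+ 2 <= e by rewrite expr2 ler_piMr ?(ltW e0)//; lra.
lra.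
Qed.

End SlantedMargin.

(** * Representation by integrals along lines *)

Section LineRepresentation.
Context {R : realType}.
Local Notation MR := (measurableTypeR R).
Local Notation leb := (@lebesgue_measure R).
Local Notation leb2 := (leb \x leb)%E.
Local Notation B := (@unit_ball R).
Variables V G1 G2 : MR * MR -> R.
Hypotheses (iV : leb2.-integrable setT (EFin \o V))
  (iG1 : leb2.-integrable setT (EFin \o G1))
  (iG2 : leb2.-integrable setT (EFin \o G2)).
Hypotheses (V0 : forall x, ~ half_ball x -> V x = 0)
  (G10 : forall x, ~ half_ball x -> G1 x = 0) (G20 : forall x, ~ half_ball x -> G2 x = 0).
Hypotheses (w1 : weak_pair V e1 G1) (w2 : weak_pair V e2 G2).

(** Around each point the hypotheses of [integral_rectangle] hold on a small
    box, so that the difference of both sides has zero integral over every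
    rectangle in that box. *)
Lemma representation (s : R) : -1 <= s <= 1 ->
  {ae leb2, forall x, (`|x.1| < 1 /\ half_ball (shear s x)) ->
    V (shear s x) = slice_below (slantS G1 G2 s) x}.
Proof.
move=> s1.
apply: (@ae_local R (fun x => V (shear s x) = slice_below (slantS G1 G2 s) x)
  [set x | `|x.1| < 1 /\ half_ball (shear s x)]).
move=> [z0 t0] /= [z01 [/unit_ballE/= q0 /= t00]].
have [e /andP[e0 et] margin] := slanted_margin s1 z01 t00 q0.
exists e => //.
have inB z t : z0 - e <= z <= z0 + e -> - e <= t <= t0 + e -> B (z + s * t, t).
  by move=> hz ht; apply/unit_ballE; exact: margin.
pose D x := V (shear s x) - slice_below (slantS G1 G2 s) x.
pose Q : set (MR * MR) := `]z0 - e, z0 + e[ `*` `]t0 - e, t0 + e[.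
have mQ : measurable Q by apply: measurableX; exact: measurable_itv.
pose F x := D x * \1_Q x.
have FQ x : x \in Q -> F x = D x by move=> Qx; rewrite /F indicE Qx mulr1.
have FnQ x : x \notin Q -> F x = 0 by move=> Qx; rewrite /F indicE (negbTE Qx) mulr0.
have QE x : Q x <-> (z0 - e < x.1 < z0 + e) && (t0 - e < x.2 < t0 + e).
  by rewrite /Q /= !in_itv/=; split => [[-> ->]|/andP[]].
suff : {ae leb2, forall x, F x = 0}.
  apply: ae_mono => x F0 /ball_planeE[/=]; rewrite !ltr_distlC => h1 h2.
  have Qx : x \in Q.
    by rewrite in_setE; apply/QE; move: h1 h2 => /andP[? ?] /andP[? ?]; apply/andP; split; lra.
  by move: F0; rewrite FQ// => /eqP; rewrite subr_eq0 => /eqP.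
apply: (@ae_eq0_rectangles R F (`|z0| + t0 + e + 1)).
- have -> : EFin \o F = ((fun x => (V (shear s x) * \1_Q x)%:E) \-
    (fun x => (slice_below (slantS G1 G2 s) x * \1_Q x)%:E))%E.
    by apply/funext => x; rewrite /= -EFinB /F /D mulrBl.
  apply: integrableB => //.
    apply: (integrable_mulb2 (C := 1) (integrable_shear s iV)) => // x.
    by rewrite ger0_norm// indicE; case: (_ \in _).
  apply: (@integrable_primitive_strip R G1 G2 iG1 iG2 s (t0 - e) (t0 + e)) => // x.
  rewrite ger0_norm// !indicE; case: (boolP (x \in Q)) => //.
  by rewrite in_setE => /QE/andP[_ h]; rewrite mem_setE in_itv/= h.
- move=> x; have [|/FnQ ->] := boolP (x \in Q); last by rewrite eqxx.
  rewrite in_setE => /QE/andP[/andP[h1 h2] /andP[h3 h4]] _.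
  have := ler_norm z0; have := ler_norm (- z0); rewrite normrN => h5 h6.
  have := normr_ge0 z0.
  by split; apply/andP; split; lra.
- move=> a b c d.
  pose a' := Num.max a (z0 - e); pose b' := Num.min b (z0 + e).
  pose c' := Num.max c (t0 - e); pose d' := Num.min d (t0 + e).
  have -> : (\int[leb2]_(x in `]a, b[ `*` `]c, d[) (F x)%:E =
      \int[leb2]_(x in `]a', b'[ `*` `]c', d'[) (D x)%:E)%E.
    rewrite integral_mkcond [RHS]integral_mkcond; apply: eq_integral => x _.
    rewrite !patchE !in_setX !mem_setE !in_itv/= !gt_max !lt_min.
    have [Qx|nQx] := boolP (x \in Q).
      rewrite FQ//; move: Qx; rewrite in_setE => /QE/andP[/andP[h1 h2] /andP[h3 h4]].
      by rewrite h1 h2 h3 h4 !andbT.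
    rewrite FnQ//; move: nQx; rewrite -(rwP negP) in_setE => nQ.
    case: ifPn => _; case: ifPn => // h; exfalso; apply: nQ; apply/QE; lra.
  have [ab|ba] := ltP a' b'; last first.
    by rewrite [`]a', b'[%classic]set_itv_ge ?set0X ?integral_set0// bnd_simp -leNgt.
  have [cd|dc] := ltP c' d'; last first.
    by rewrite [`]c', d'[%classic]set_itv_ge ?setX0 ?integral_set0// bnd_simp -leNgt.
  apply: (@integral_rectangle R V G1 G2 iV iG1 iG2 V0 G10 G20 w1 w2 s a' b' c' d' e) => //.
    have h1 : z0 - e <= a' by rewrite le_max lexx orbT.
    have h2 : b' <= z0 + e by rewrite ge_min lexx orbT.
    have h3 : d' <= t0 + e by rewrite ge_min lexx orbT.
    by move=> z t hz ht; apply: inB; lra.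
Qed.

End LineRepresentation.

(** * Cauchy-Schwarz and null sets *)

Section CauchySchwarz.
Context d (T : measurableType d) (R : realType) (mu : {measure set T -> \bar R}).

Lemma cauchy_schwarz (f g : T -> R) (a b : R) :
  measurable_fun setT f -> measurable_fun setT g -> 0 <= a -> 0 <= b ->
  (\int[mu]_x (f x ^+ 2)%:E <= a%:E)%E -> (\int[mu]_x (g x ^+ 2)%:E <= b%:E)%E ->
  (\int[mu]_x (`|f x * g x|)%:E <= (Num.sqrt a * Num.sqrt b)%:E)%E.
Proof.
move=> mf mg a0 b0 fa gb.
have N2 (h : T -> R) c : 0 <= c -> (\int[mu]_x (h x ^+ 2)%:E <= c%:E)%E ->
    ('N[mu]_2%:E[EFin \o h] <= (Num.sqrt c)%:E)%E.
  move=> c0 hc; rewrite unlock /Lnorm.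
  rewrite -powR12_sqrt// -poweR_EFin.
  apply: gt0_ler_poweR; rewrite ?in_itv/= ?andbT ?leey ?integral_ge0 ?lee_fin//; first by rewrite c0.
  apply: le_trans hc; rewrite le_eqVlt; apply/orP; left; apply/eqP; apply: eq_integral => x _ /=.
  by rewrite powR_mulrn// -normrX ger0_norm// sqr_ge0.
have := @hoelder _ _ _ mu f g 2 2 mf mg ltac:(lra) ltac:(lra) ltac:(lra).
rewrite Lnorm1 /= => /le_trans; apply.
by rewrite EFinM; apply: lee_pmul; rewrite ?Lnorm_ge0// N2.
Qed.

End CauchySchwarz.

Section NullSlices.
Context {R : realType}.
Local Notation MR := (measurableTypeR R).
Local Notation leb := (@lebesgue_measure R).
Local Notation leb2 := (leb \x leb)%E.

Lemma ae_slices (Q : MR * MR -> Prop) : {ae leb2, forall x, Q x} ->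
  {ae leb, forall z, {ae leb, forall t, Q (z, t)}}.
Proof.
move=> [N [mN N0 QN]].
have : ae_eq leb setT (leb \o xsection N) (cst 0%E).
  apply/ae_eq_integral_abs => //; first exact: measurable_fun_xsection.
  by rewrite -[RHS]N0; apply: eq_integral => x _; rewrite gee0_abs.
apply: ae_mono => z /(_ I) /= h; exists (xsection N z); split => //.
  exact: measurable_xsection.
by move=> t nQ; rewrite /xsection/= in_setE; exact: QN.
Qed.

Lemma ae_fst (Q : MR -> Prop) : {ae leb, forall z, Q z} -> {ae leb2, forall x : MR * MR, Q x.1}.
Proof.
move=> [N [mN N0 QN]]; exists (N `*` setT); split.
- exact: measurableX.
- apply: (etrans (product_measure1E leb leb mN measurableT)).
  by rewrite [X in (X * _)%E](_ : _ = 0%E) ?mul0e.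
- by move=> x nQ; split => //; exact: QN.
Qed.

End NullSlices.

(** * An inequality of Gagliardo-Nirenberg type *)

Section GagliardoNirenberg.
Context {R : realType}.
Local Notation MR := (measurableTypeR R).
Local Notation leb := (@lebesgue_measure R).
Local Notation leb2 := (leb \x leb)%E.

Lemma measurable_half_ball : measurable (@half_ball R : set (MR * MR)).
Proof.
have -> : @half_ball R = [set x : MR * MR | x.1 ^+ 2 + x.2 ^+ 2 < 1] `&` [set x | 0 < x.2].
  by apply/seteqP; split => x; rewrite /half_ball /= => -[/unit_ballE].
have E (f g : MR * MR -> R) : measurable_fun setT f -> measurable_fun setT g ->
    measurable [set x | f x < g x].
  move=> mf mg; have -> : [set x | f x < g x] = (fun x => f x < g x) @^-1` [set true].
    by apply/seteqP; split => y /=; [move=> ->|move=> /eqP; rewrite eqb_id].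
  by rewrite -[X in measurable X]setTI; apply: measurable_fun_ltr.
apply: measurableI; apply: E => //.
by apply: measurable_funD; apply: measurable_funX.
Qed.

Lemma ge0_integral_translate (f : MR -> \bar R) (z : R) : measurable_fun setT f ->
  (forall t, 0 <= f t)%E -> (\int[leb]_t f (z + t)%R = \int[leb]_t f t)%E.
Proof.
move=> mf f0; under eq_integral do rewrite addrC.
have mphi : measurable_fun setT (fun t : MR => t + z : MR) by exact: measurable_funD.
exact: (ge0_integral_preserving mphi (@lebesgue_translate R z)).
Qed.

Lemma ge0_integral_reflect (f : MR -> \bar R) (z : R) : measurable_fun setT f ->
  (forall t, 0 <= f t)%E -> (\int[leb]_t f (z - t)%R = \int[leb]_t f t)%E.
Proof.
move=> mf f0.
have mphi : measurable_fun setT (fun t : MR => - t : MR) by exact: measurable_funN.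
have mz : measurable_fun setT (fun t : MR => z + t : MR) by exact: measurable_funD.
rewrite -[RHS](ge0_integral_translate z mf f0).
exact: (@ge0_integral_preserving _ _ _ leb _ mphi (@lebesgue_opp R) (fun t => f (z + t)) (measurableT_comp mf mz)).
Qed.

Variables V G1 G2 : MR * MR -> R.
Hypotheses (iV : leb2.-integrable setT (EFin \o V))
  (iG1 : leb2.-integrable setT (EFin \o G1))
  (iG2 : leb2.-integrable setT (EFin \o G2)).
Hypotheses (V0 : forall x, ~ half_ball x -> V x = 0)
  (G10 : forall x, ~ half_ball x -> G1 x = 0) (G20 : forall x, ~ half_ball x -> G2 x = 0).
Hypotheses (w1 : weak_pair V e1 G1) (w2 : weak_pair V e2 G2).

Local Notation H s := (slant G1 G2 s).

(** Up to the factor k + 1, a bound for |V|^(k+1) on the whole line through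
    (z, 0) with direction (s, 1). *)
Definition line_mass (s : R) (k : nat) (z : MR) : \bar R :=
  (\int[leb]_tau (`|V (shear s (z, tau))| ^+ k * `|H s (shear s (z, tau))|)%:E)%E.

Let mVH s k : measurable_fun setT (fun x => (`|V x| ^+ k * `|H s x|)%:E).
Proof.
have mV := integrable_measurable iV.
have mH := integrable_measurable (integrable_slant iG1 iG2 s).
apply/measurable_EFinP; apply: measurable_funM; last exact: measurableT_comp.
by apply: measurable_funX; exact: measurableT_comp.
Qed.

Let mVHS s k : measurable_fun setT (fun x => (`|V (shear s x)| ^+ k * `|H s (shear s x)|)%:E).
Proof. exact: (measurableT_comp (mVH s k) (@measurable_shear R s)). Qed.

Lemma measurable_line_mass s k : measurable_fun setT (line_mass s k).
Proof.
by apply: (@measurable_fun_fubini_tonelli_F _ _ _ _ _ leb _ (mVHS s k)) => x; rewrite lee_fin mulr_ge0.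
Qed.

Lemma line_mass_ge0 s k z : (0 <= line_mass s k z)%E.
Proof. by apply: integral_ge0 => t _; rewrite lee_fin mulr_ge0. Qed.

Lemma integral_line_mass s k :
  (\int[leb]_z line_mass s k z = \int[leb2]_x (`|V x| ^+ k * `|H s x|)%:E)%E.
Proof.
rewrite -(ge0_integral_preserving (@measurable_shear R s) (@leb2_shear R s) (mVH s k)); last first.
  by move=> x; rewrite lee_fin mulr_ge0.
by rewrite (@fubini_tonelli1 _ _ _ _ _ leb leb _ (mVHS s k)).
Qed.

Lemma power_bound_shear s k : -1 <= s <= 1 ->
  {ae leb2, forall x, (`|x.1| < 1 /\ half_ball (shear s x)) ->
    ((`|V (shear s x)| ^+ k.+1)%:E <= k.+1%:R%:E * line_mass s k x.1)%E}.
Proof.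
move=> s1.
have rep := representation iV iG1 iG2 V0 G10 G20 w1 w2 s1.
have islice := ae_fst (ae_integrable1 (integrable_shear s (integrable_slant iG1 iG2 s))).
have := ae_and rep (ae_and islice (ae_fst (ae_slices rep))).
apply: ae_mono => -[z t] [Vz [ih Uz]] zhb; rewrite (Vz zhb); have [/= z1 _] := zhb.
rewrite {1}/slice_below/=.
apply: le_trans (normr_below_exp k t ih) _.
rewrite lee_wpmul2l ?lee_fin// /line_mass le_eqVlt; apply/orP; left; apply/eqP.
apply: ae_eq_integral => //.
- have mh : measurable_fun setT (fun tau => slantS G1 G2 s (z, tau)).
    exact: measurable_slice (integrable_shear s (integrable_slant iG1 iG2 s)) _.
  apply/measurable_EFinP; apply: measurable_funM; last exact: measurableT_comp.
  by apply: measurable_funX; apply: measurableT_comp => //; exact: measurable_below1.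
- have mp : measurable_fun setT (fun t : MR => (z : MR, t)) by apply/measurable_fun_pair.
  exact: (measurableT_comp (mVHS s k) mp).
- move: Uz; apply: ae_mono => tau Utau _; congr EFin.
  have [hb|nhb] := pselect (half_ball (shear s (z, tau))).
    by rewrite Utau.
  have e : H s (shear s (z, tau)) = 0 by rewrite /slant G10// G20// mulr0 addr0.
  by rewrite [(H s \o _) _]e e normr0 !mulr0.
Qed.

(** [power_bound_shear] expressed at the point itself: x lies on the line of
    direction (s, 1) with foot (x.1 - s x.2, 0). *)
Lemma power_bound s k : -1 <= s <= 1 ->
  {ae leb2, forall x, half_ball x -> `|x.1 - s * x.2| < 1 ->
    ((`|V x| ^+ k.+1)%:E <= k.+1%:R%:E * line_mass s k (x.1 - s * x.2)%R)%E}.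
Proof.
move=> s1; have := power_bound_shear k s1.
move=> /(ae_preserving (@measurable_shear R (- s)) (@leb2_shear R (- s))).
apply: ae_mono => -[x1 x2]; rewrite /shear/= mulNr subrK => h hb x11; exact: h.
Qed.

(** One factor |V|^(k+1) is bounded along the vertical line through x, the
    other along a line of direction (1, 1) or (-1, 1).  The bounds depend on
    x.1 and on x.1 -+ x.2 only, so the integral of their product factorizes.
    Two oblique directions are needed because the foot of the line has to lie
    in ]-1, 1[: (1, 1) serves when x.1 >= 0, and (-1, 1) when x.1 < 0. *)
Lemma gagliardo_nirenberg k :
  (\int[leb2]_(x in half_ball) (`|V x| ^+ k.+1.*2)%:E <=
   k.+1%:R%:E * \int[leb2]_x (`|V x| ^+ k * `|H 0 x|)%:E *
   (k.+1%:R%:E * \int[leb2]_x (`|V x| ^+ k * `|H 1 x|)%:E +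
    k.+1%:R%:E * \int[leb2]_x (`|V x| ^+ k * `|H (-1) x|)%:E))%E.
Proof.
have mV := integrable_measurable iV.
pose A s (z : R) : \bar R := (k.+1%:R%:E * line_mass s k z)%E.
have mA s : measurable_fun setT (A s : MR -> \bar R).
  by apply: measurable_funeM; exact: measurable_line_mass.
have A0 s z : (0 <= A s z)%E by rewrite mule_ge0 ?lee_fin// line_mass_ge0.
have AE s : (\int[leb]_z A s z = k.+1%:R%:E * \int[leb2]_x (`|V x| ^+ k * `|H s x|)%:E)%E.
  rewrite ge0_integralZl ?integral_line_mass ?lee_fin//; first exact: measurable_line_mass.
  by move=> z _; exact: line_mass_ge0.
have hA (s : R) : -1 <= s <= 1 -> {ae leb2, forall x, half_ball x -> `|x.1 - s * x.2| < 1 ->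
    ((`|V x| ^+ k.+1)%:E <= A s (x.1 - s * x.2)%R)%E} by exact: power_bound.
clearbody A.
pose F (x : MR * MR) : \bar R := (A 0%R x.1 * (A 1%R (x.1 - x.2)%R + A (-1)%R (x.1 + x.2)%R))%E.
have F0 x : (0 <= F x)%E by rewrite mule_ge0// adde_ge0.
have mF : measurable_fun setT F.
  apply: emeasurable_funM; first exact: measurableT_comp.
  have mm : measurable_fun setT (fun x : MR * MR => x.1 - x.2 : MR) by exact: measurable_funB.
  have mp : measurable_fun setT (fun x : MR * MR => x.1 + x.2 : MR) by exact: measurable_funD.
  by apply: emeasurable_funD; [exact: (measurableT_comp (mA 1) mm)|exact: (measurableT_comp (mA (-1)) mp)].
apply: (@le_trans _ _ (\int[leb2]_(x in half_ball) F x)%E).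
  apply: ae_ge0_le_integral => //.
  - exact: measurable_half_ball.
  - apply/measurable_EFinP; apply: measurable_funTS; apply: measurable_funX.
    exact: measurableT_comp.
  - exact: measurable_funTS.
  have s0 : -1 <= (0 : R) <= 1 by lra.
  have s1 : -1 <= (1 : R) <= 1 by lra.
  have s2 : -1 <= (-1 : R) <= 1 by lra.
  have := ae_and (hA _ s0) (ae_and (hA _ s1) (hA _ s2)).
  apply: ae_mono => x [p0 [p1 p2]] hb.
  have [/unit_ballE xB x2] := hb.
  have x11 : `|x.1| < 1.
    rewrite -(@expr_lt1 _ 2)// (real_normK (num_real _)); apply: le_lt_trans xB.
    by rewrite lerDl sqr_ge0.
  have x21 : x.2 < 1.
    rewrite -(@expr_lt1 _ 2)// ?(ltW x2)//; apply: le_lt_trans xB.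
    by rewrite lerDr sqr_ge0.
  have -> : (`|V x| ^+ k.+1.*2)%:E = ((`|V x| ^+ k.+1)%:E * (`|V x| ^+ k.+1)%:E)%E.
    by rewrite -EFinM -exprD addnn.
  rewrite /F; apply: lee_pmul; rewrite ?lee_fin//.
    by have := p0 hb; rewrite mul0r subr0; apply.
  move: x11; rewrite ltr_norml => /andP[x12 x13].
  have [x10|x10] := leP 0 x.1.
    apply: (@le_trans _ _ (A 1 (x.1 - x.2))); last by rewrite leeDl.
    by have := p1 hb; rewrite mul1r; apply; rewrite ltr_norml; apply/andP; split; lra.
  apply: (@le_trans _ _ (A (-1) (x.1 + x.2))); last by rewrite leeDr.
  by have := p2 hb; rewrite mulN1r opprK; apply; rewrite ltr_norml; apply/andP; split; lra.
apply: le_trans (ge0_subset_integral _ measurable_half_ball measurableT mF _ _) _ => //.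
rewrite fubini_tonelli1// /fubini_F/= -!AE.
rewrite -[leRHS]ge0_integralZr//; last by rewrite adde_ge0// integral_ge0.
rewrite le_eqVlt; apply/orP; left; apply/eqP; apply: eq_integral => z _.
have m1 : measurable_fun setT (fun t : MR => A 1 (z - t)%R).
  have mm : measurable_fun setT (fun t : MR => z - t : MR) by exact: measurable_funB.
  exact: (measurableT_comp (mA 1) mm).
have m2 : measurable_fun setT (fun t : MR => A (-1) (z + t)%R).
  have mm : measurable_fun setT (fun t : MR => z + t : MR) by exact: measurable_funD.
  exact: (measurableT_comp (mA (-1)) mm).
rewrite /F/= ge0_integralZl//; last first.
- by move=> t _; exact: adde_ge0.
- exact: emeasurable_funD.
suff -> : (\int[leb]_t (A 1%R (z - t)%R + A (-1)%R (z + t)%R) =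
  \int[leb]_t A 1%R t + \int[leb]_t A (-1)%R t)%E by [].
rewrite (@ge0_integralD _ _ _ leb setT measurableT) //.
have -> := @ge0_integral_reflect (A 1) z (mA 1) (A0 1).
by have -> := @ge0_integral_translate (A (-1)) z (mA (-1)) (A0 (-1)).
Qed.

End GagliardoNirenberg.

(** * Moments of all orders *)

Section Moments.
Context {R : realType}.
Local Notation MR := (measurableTypeR R).
Local Notation leb := (@lebesgue_measure R).
Local Notation leb2 := (leb \x leb)%E.
Local Notation B := (@unit_ball R).

Lemma unit_ball_box (x : R * R) : B x -> -1 < x.1 < 1 /\ -1 < x.2 < 1.
Proof.
move=> /unit_ballE xB; rewrite -!ltr_norml; split;
  rewrite -(@expr_lt1 _ 2)// (real_normK (num_real _)); apply: le_lt_trans xB.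
  by rewrite lerDl sqr_ge0.
by rewrite lerDr sqr_ge0.
Qed.

Lemma leb2_box (a b c d : R) : a < b -> c < d ->
  leb2 (`]a, b[ `*` `]c, d[) = ((b - a) * (d - c))%:E.
Proof.
move=> ab cd; apply: (etrans (product_measure1E leb leb (measurable_itv _) (measurable_itv _))).
by rewrite EFinM; congr (_ * _)%E; apply: (etrans (lebesgue_measure_itv _)); rewrite /= lte_fin ?ab ?cd EFinB.
Qed.

Lemma leb2_in_ball (A : set (MR * MR)) : measurable A -> A `<=` B -> (leb2 A <= 4%:E)%E.
Proof.
move=> mA AB; apply: (@le_trans _ _ (leb2 (`]-1, 1[ `*` `]-1, 1[))).
  apply: le_measure; rewrite ?inE//; first by apply: measurableX; exact: measurable_itv.
  by move=> x /AB /unit_ball_box[? ?]; split; rewrite /= in_itv.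
by rewrite leb2_box// lee_fin; lra.
Qed.

Variables V G1 G2 : MR * MR -> R.
Hypotheses (iV : leb2.-integrable setT (EFin \o V))
  (iG1 : leb2.-integrable setT (EFin \o G1))
  (iG2 : leb2.-integrable setT (EFin \o G2)).
Hypotheses (V0 : forall x, ~ half_ball x -> V x = 0)
  (G10 : forall x, ~ half_ball x -> G1 x = 0) (G20 : forall x, ~ half_ball x -> G2 x = 0).
Hypotheses (w1 : weak_pair V e1 G1) (w2 : weak_pair V e2 G2).
Variable E : R.
Hypotheses (E0 : 0 <= E) (hE : (\int[leb2]_x (G1 x ^+ 2 + G2 x ^+ 2)%:E <= E%:E)%E).
Local Notation H s := (slant G1 G2 s).

Lemma integral_slant_sqr (s : R) : -1 <= s <= 1 ->
  (\int[leb2]_x (H s x ^+ 2)%:E <= (2 * E)%:E)%E.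
Proof.
move=> /andP[s1 s2].
have mG1 := integrable_measurable iG1; have mG2 := integrable_measurable iG2.
have mH := integrable_measurable (integrable_slant iG1 iG2 s).
have mG : measurable_fun setT (fun x => (G1 x ^+ 2 + G2 x ^+ 2)%:E).
  by apply/measurable_EFinP; apply: measurable_funD; exact: measurable_funX.
apply: (@le_trans _ _ (\int[leb2]_x (2%:E * (G1 x ^+ 2 + G2 x ^+ 2)%:E))%E); last first.
  rewrite ge0_integralZl//; last by move=> x _; rewrite lee_fin addr_ge0// sqr_ge0.
  by rewrite EFinM; apply: lee_wpmul2l.
apply: ge0_le_integral => //.
- by move=> x _; rewrite lee_fin sqr_ge0.
- by apply/measurable_EFinP; exact: measurable_funX.
- exact: measurable_funeM.
- move=> x _; rewrite -EFinM lee_fin /slant.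
  have s21 : s ^+ 2 <= 1 by nra.
  have h1 : (s * G1 x + G2 x) ^+ 2 <= 2 * ((s * G1 x) ^+ 2 + G2 x ^+ 2).
    rewrite -subr_ge0; have -> : 2 * ((s * G1 x) ^+ 2 + G2 x ^+ 2) - (s * G1 x + G2 x) ^+ 2 =
      (s * G1 x - G2 x) ^+ 2 by ring.
    exact: sqr_ge0.
  apply: le_trans h1 _; rewrite ler_pM2l// lerD2r exprMn.
  by apply: ler_piMl => //; exact: sqr_ge0.
Qed.

(** Write J_k for the integral on the left.  By Cauchy-Schwarz the integrals
    in [gagliardo_nirenberg] are at most sqrt (2 E J_k), whence J_(k+1) <= 4
    (k+1)^2 E J_k. *)
Lemma moment_bound k :
  (\int[leb2]_(x in half_ball) (`|V x| ^+ k.*2)%:E <=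
   (4 ^+ k.+1 * (k`!%:R) ^+ 2 * E ^+ k)%:E)%E.
Proof.
have mV := integrable_measurable iV.
have mhb := @measurable_half_ball R.
elim: k => [|k ih].
  rewrite expr1 fact0 expr1n !mulr1.
  under eq_integral do rewrite expr0.
  by rewrite integral_cst// mul1e; apply: leb2_in_ball => // x [].
set J := 4 ^+ k.+1 * k`!%:R ^+ 2 * E ^+ k in ih.
have J0 : 0 <= J by rewrite !mulr_ge0 ?exprn_ge0.
pose X := Num.sqrt J * Num.sqrt (2 * E).
have E20 : 0 <= 2 * E by rewrite mulr_ge0.
have TX s : -1 <= s <= 1 -> (\int[leb2]_x (`|V x| ^+ k * `|H s x|)%:E <= X%:E)%E.
  move=> s1.
  have mH := integrable_measurable (integrable_slant iG1 iG2 s).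
  pose f (x : MR * MR) : R := `|V x| ^+ k * \1_half_ball x.
  have mf : measurable_fun setT f.
    apply: measurable_funM; last exact: measurable_indic.
    by apply: measurable_funX; exact: measurableT_comp.
  have := cauchy_schwarz mf mH J0 E20 _ (integral_slant_sqr s1).
  have -> : (\int[leb2]_x `|f x * H s x|%:E = \int[leb2]_x (`|V x| ^+ k * `|H s x|)%:E)%E.
    apply: eq_integral => x _; congr EFin; rewrite /f indicE.
    have [hb|nhb] := boolP (x \in half_ball).
      by rewrite mulr1 normrM normrX normr_id.
    have -> : H s x = 0.
      by move: nhb; rewrite notin_setE => nhb; rewrite /slant G10// G20// mulr0 addr0.
    by rewrite normr0 !mulr0 normr0.
  apply; apply: le_trans ih; rewrite [leRHS]integral_mkcond.
  rewrite le_eqVlt; apply/orP; left; apply/eqP; apply: eq_integral => x _.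
  rewrite patchE /f indicE; case: ifP => _; last by rewrite mulr0 expr0n.
  by rewrite mulr1 -exprM muln2.
apply: le_trans (gagliardo_nirenberg iV iG1 iG2 V0 G10 G20 w1 w2 k) _.
have X0 : 0 <= X by rewrite mulr_ge0 ?sqrtr_ge0.
have T0 s : (0 <= \int[leb2]_x (`|V x| ^+ k * `|H s x|)%:E)%E.
  by apply: integral_ge0 => x _; rewrite lee_fin mulr_ge0.
have kT s : -1 <= s <= 1 ->
    (k.+1%:R%:E * \int[leb2]_x (`|V x| ^+ k * `|H s x|)%:E <= (k.+1%:R * X)%:E)%E.
  by move=> s1; rewrite EFinM; apply: lee_wpmul2l; rewrite ?lee_fin//; exact: TX.
apply: (@le_trans _ _ ((k.+1%:R * X)%:E * ((k.+1%:R * X)%:E + (k.+1%:R * X)%:E))%E).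
  apply: lee_pmul.
  - by rewrite mule_ge0 ?lee_fin.
  - by rewrite adde_ge0// mule_ge0 ?lee_fin.
  - by apply: kT; lra.
  - by apply: leeD; apply: kT; lra.
rewrite -EFinD -EFinM lee_fin.
have -> : k.+1%:R * X * (k.+1%:R * X + k.+1%:R * X) = 2 * k.+1%:R ^+ 2 * X ^+ 2 by ring.
rewrite /X exprMn !sqr_sqrtr// /J factS natrM le_eqVlt; apply/orP; left; apply/eqP.
by rewrite [4 ^+ k.+2]exprS [E ^+ k.+1]exprS; ring.
Qed.

End Moments.

(** * Cutting an odd function along its axis *)

Section Cut.
Context {R : realType}.
Local Notation MR := (measurableTypeR R).
Local Notation leb := (@lebesgue_measure R).
Local Notation leb2 := (leb \x leb)%E.

Lemma ae_snd (Q : MR -> Prop) : {ae leb, forall z, Q z} -> {ae leb2, forall x : MR * MR, Q x.2}.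
Proof.
move=> [N [mN N0 QN]]; exists (setT `*` N); split.
- exact: measurableX.
- apply: (etrans (product_measure1E leb leb measurableT mN)).
  by rewrite [X in (_ * X)%E](_ : _ = 0%E) ?mule0.
- by move=> x nQ; split => //; exact: QN.
Qed.

Lemma ae_neq0 : {ae leb2, forall x : MR * MR, x.2 != 0}.
Proof.
apply: (@ae_snd (fun z => z != 0)); exists [set 0]; split => //.
  exact: lebesgue_measure_set1.
by move=> x /= /negP; rewrite negbK => /eqP.
Qed.

Lemma smooth_is_derive (phi : R * R -> R) (e x : R * R) : smooth phi ->
  e \in [:: e1; e2] -> is_derive x e phi ('D_e phi x).
Proof.
move=> sphi ee; have [|_ d] := sphi [::]; first by [].
have [d1 d2] := d x; move: ee; rewrite !inE => /orP[/eqP->|/eqP->].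
  exact: (DeriveDef d1 erefl).
exact: (DeriveDef d2 erefl).
Qed.

Lemma test_function_lipschitz (phi : R * R -> R) : test_function phi ->
  exists L, forall a b c, `|phi (a, b) - phi (a, c)| <= L * `|b - c|.
Proof.
move=> tphi; have t2 : test_function ('D_e2 phi).
  by apply: test_function_derive => //; rewrite !inE eqxx orbT.
have [L hL] := test_function_bounded t2; exists L => a b c.
have dslice (t : R) : is_derive t 1 (fun t => phi (a, t)) ('D_e2 phi (a, t)).
  apply/(is_derive_e2 phi (a, t)); apply: smooth_is_derive; first by case: tphi.
  by rewrite !inE eqxx orbT.
wlog bc : b c / b < c.
  move=> h; have [bc|cb|->] := ltgtP b c; first exact: h.
    by rewrite distrC [`|b - c|]distrC; exact: h.
  by rewrite !subrr normr0 mulr0.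
have [|x _] := @MVT R (fun t => phi (a, t)) (fun t => 'D_e2 phi (a, t)) b c bc (fun x _ => dslice x).
  apply: continuous_subspaceT => x; apply/differentiable_continuous.
  by apply/derivable1_diffP; apply: ex_derive.
rewrite distrC [`|b - c|]distrC => ->; rewrite normrM ler_wpM2r//; exact: hL.
Qed.

(** The derivative of eta_n blows up at 0, but only like 1/|t|. *)
Lemma smooth_cutoff : exists (eta eta' : nat -> R -> R) (C : R),
  [/\ forall n, smooth1 (eta n), forall n (t : R), is_derive t 1 (eta n) (eta' n t),
      forall n t, 0 <= eta n t <= 1 & forall n t, eta' n (- t) = eta' n t] /\
  [/\ forall n t, `|eta' n t| <= n%:R * C, forall n t, `|eta' n t| * `|t| <= C,
      forall t : R, t != 0 -> \forall n \near \oo, eta' n t = 0 &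
      forall t : R, t != 0 -> \forall n \near \oo, eta n t = if 0 < t then 1 else 0].
Proof.
have [th [th' [C [[sth dth th01] [th0 th1 thsym thC th1']]]]] := @smooth_step R.
have th'0 t : t <= 0 -> th' t = 0 by move=> t0; rewrite -thsym th1'//; lra.
exists (fun n t => th (n%:R * t + 2^-1)), (fun n t => n%:R * th' (n%:R * t + 2^-1)), C.
have C0 : 0 <= C by have /andP[h1 h2] := thC 0; exact: le_trans h2.
split; split.
- by move=> n; exact: smooth1_affine.
- move=> n t; rewrite mulrC; apply: (@is_derive1_comp _ th (fun t => n%:R * t + 2^-1)).
  exact: is_derive_affine.
- by move=> n t; exact: th01.
- by move=> n t; congr (_ * _); rewrite -thsym; congr th'; field.
- move=> n t; rewrite normrM normr_nat ler_wpM2l//.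
  by have /andP[h1 h2] := thC (n%:R * t + 2^-1); rewrite ger0_norm.
- move=> n t; rewrite normrM normr_nat mulrAC.
  have /andP[h1 h2] := thC (n%:R * t + 2^-1).
  have [nt|nt] := leP (n%:R * `|t|) 2^-1.
    rewrite ger0_norm//; have n0 : 0 <= n%:R * `|t| by rewrite mulr_ge0.
    apply: le_trans (_ : 1 * C <= _); last by rewrite mul1r.
    by apply: ler_pM => //; lra.
  have -> : th' (n%:R * t + 2^-1) = 0.
    have [t0|t0] := leP 0 t.
      by apply: th1'; move: nt; rewrite ger0_norm//; lra.
    by apply: th'0; move: nt; rewrite ltr0_norm// mulrN; lra.
  by rewrite normr0 mulr0.
- move=> t t0.
  have : \forall n \near \oo, `|t|^-1 <= n%:R :> R by exact: nbhs_infty_ger.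
  apply: filterS => n; rewrite -[X in X <= _]mul1r ler_pdivrMr ?normr_gt0// => h.
  suff -> : th' (n%:R * t + 2^-1) = 0 by rewrite mulr0.
  have [tp|tn] := leP 0 t.
    by apply: th1'; move: h; rewrite ger0_norm//; lra.
  by apply: th'0; move: h; rewrite ltr0_norm// mulrN; lra.
- move=> t t0.
  have : \forall n \near \oo, `|t|^-1 <= n%:R :> R by exact: nbhs_infty_ger.
  apply: filterS => n; rewrite -[X in X <= _]mul1r ler_pdivrMr ?normr_gt0// => h.
  have [tp|tn] := ltP 0 t.
    by apply: th1; move: h; rewrite gtr0_norm//; lra.
  by apply: th0; move: h; rewrite ler0_norm// mulrN; lra.
Qed.

Lemma cvg_Rintegral_mul (f hlim : MR * MR -> R) (h : nat -> MR * MR -> R) (C : R) :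
  leb2.-integrable setT (EFin \o f) -> (forall n, measurable_fun setT (h n)) ->
  measurable_fun setT hlim -> (forall n x, `|h n x| <= C) ->
  {ae leb2, forall x, \forall n \near \oo, h n x = hlim x} ->
  \int[leb2]_x (f x * h n x) @[n --> \oo] --> \int[leb2]_x (f x * hlim x).
Proof.
move=> jf mh mhlim hC hh.
have mf := integrable_measurable jf.
have [|||||il _ lim] := @dominated_convergence _ _ _ leb2 setT measurableT
  (fun n x => (f x * h n x)%:E) (fun x => (f x * hlim x)%:E) (fun x => (C * `|f x|)%:E).
- by move=> n; apply/measurable_EFinP; exact: measurable_funM.
- by apply/measurable_EFinP; exact: measurable_funM.
- move: hh; apply: ae_mono => x hx _; apply: cvg_near_cst.
  by apply: filterS hx => n ->.
- exact: (integrableZl measurableT C (integrable_norm jf)).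
- by apply: aeW => x n _; rewrite /= lee_fin normrM mulrC ler_wpM2r.
apply: fine_cvg; rewrite fineK//; exact: integrable_fin_num.
Qed.

Section Cutting.
Variables (U G : MR * MR -> R) (e : R * R).
Hypotheses (ee : e \in [:: e1; e2]) (iU : leb2.-integrable setT (EFin \o U))
  (iG : leb2.-integrable setT (EFin \o G)) (wUG : weak_pair U e G)
  (oddU : {ae leb2, forall x : MR * MR, U (x.1, - x.2) = - U x}).

(** Against an odd function only the odd part of psi counts. *)
Lemma integral_odd_even (psi : MR * MR -> R) (C : R) : measurable_fun setT psi ->
  (forall x, `|psi x| <= C) ->
  2 * \int[leb2]_x (U x * psi x) = \int[leb2]_x (U x * (psi x - psi (x.1, - x.2))).
Proof.
move=> mpsi psiC.
have ipsi := integrable_mulb2 iU mpsi psiC.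
have mU := integrable_measurable iU.
have mr := @measurable_refl2 R.
have mUr : measurable_fun setT (fun x => U x * psi (refl2 x)).
  by apply: measurable_funM => //; exact: measurableT_comp.
have E : {ae leb2, forall x, (U (refl2 x) * psi (refl2 (refl2 x)))%:E = (- (U x * psi x))%:E}.
  move: oddU; apply: ae_mono => -[x1 x2]; rewrite /refl2/= => ->.
  by rewrite opprK mulNr.
have R1 : (\int[leb2]_x (U x * psi (refl2 x))%:E = \int[leb2]_x (- (U x * psi x))%:E)%E.
  rewrite -[LHS](integral_preserving mr (@leb2_refl2 R)); last exact/measurable_EFinP.
  apply: ae_eq_integral => //.
  - apply/measurable_EFinP; exact: (measurableT_comp mUr mr).
  - by apply/measurable_EFinP; apply: measurable_funN; exact: measurable_funM.
  - by move: E; apply: ae_mono.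
have iUr : leb2.-integrable setT (EFin \o (fun x => U x * psi (refl2 x))).
  by apply: (integrable_mulb2 (C := C) iU) => //; exact: measurableT_comp.
have R2 : \int[leb2]_x (U x * psi (refl2 x)) = \int[leb2]_x (- (U x * psi x)) by congr fine.
transitivity (\int[leb2]_x (U x * psi x) - \int[leb2]_x (U x * psi (refl2 x))).
  rewrite R2.
  have -> : \int[leb2]_x (- (U x * psi x)) = - \int[leb2]_x (U x * psi x).
    rewrite -[RHS]mulN1r -RintegralZl//; apply: eq_Rintegral => x _; ring.
  by rewrite opprK mulrDl mul1r.
by rewrite -RintegralB//; apply: eq_Rintegral => x _; rewrite /refl2; ring.
Qed.

(** Test with eta_n(x.2) phi(x), where eta_n tends to the indicator of the
    positive half-line.  The extra term U eta_n' phi tends to 0 by dominated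
    convergence: as U is odd and eta_n' even, phi may be replaced with its odd
    part, which is O(|x.2|) and compensates the blow-up of eta_n'. *)
Lemma weak_pair_cut : weak_pair (fun x => U x * (if 0 < x.2 then 1 else 0)) e
  (fun x => G x * (if 0 < x.2 then 1 else 0)).
Proof.
have [eta [eta' [C [[seta deta eta01 etasym] [etaM etaC eta'0 etalim]]]]] := smooth_cutoff.
move=> phi tphi.
have tdphi := test_function_derive tphi ee.
have [L hL] := test_function_lipschitz tphi.
have [M hM] := test_function_bounded tphi.
have [M' hM'] := test_function_bounded tdphi.
pose phin n (x : R * R) := eta n (0 * x.1 + 1 * x.2) * phi x.
have e0 (x : R * R) : 0 * x.1 + 1 * x.2 = x.2 by rewrite mul0r mul1r add0r.
have tphin n : test_function (phin n).
  have [sphi [K [cK KB K0]]] := tphi; split.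
    apply/smooth2_smooth/smooth2_mul; [exact: smooth2_linear|exact: smooth2_base].
  by exists K; split => // x /K0; rewrite /phin => ->; rewrite mulr0.
have dphin n x : 'D_e (phin n) x = eta n x.2 * 'D_e phi x + e.2 * (eta' n x.2 * phi x).
  have dphi : is_derive x e phi ('D_e phi x).
    by apply: smooth_is_derive => //; case: tphi.
  have dl := @is_derive_linear R (eta n) (eta' n) 0 1 x e (deta n _).
  have := is_deriveM dl dphi.
  move=> [_ ->]; rewrite /GRing.scale/= !e0; ring.
have mU := integrable_measurable iU.
have mcomp (f : R -> R) : smooth1 f -> measurable_fun setT (fun x : MR * MR => f x.2).
  move=> /smooth1_continuous cf.
  exact: (measurableT_comp (continuous_measurable_fun cf) measurable_snd).
have meta n := mcomp _ (seta n).
have meta' n : measurable_fun setT (fun x : MR * MR => eta' n x.2).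
  have [f sf df] := smooth1_derive (seta n).
  have -> : eta' n = f by apply/funext => t; rewrite -(@derive_val _ _ _ _ _ _ _ (deta n t)) derive_val.
  exact: mcomp.
have mphi := measurable_test_function tphi.
have mdphi := measurable_test_function tdphi.
pose pos (x : MR * MR) : R := if 0 < x.2 then 1 else 0.
have mpos : measurable_fun setT pos.
  apply: measurable_fun_ifT => //; exact: measurable_fun_ltr.
have etan n t : `|eta n t| <= 1 by have /andP[h1 h2] := eta01 n t; rewrite ger0_norm.
have A : \int[leb2]_x (U x * (eta n x.2 * 'D_e phi x)) @[n --> \oo] -->
    \int[leb2]_x (U x * (pos x * 'D_e phi x)).
  apply: (cvg_Rintegral_mul (C := 1 * M') iU).
  - by move=> n; exact: measurable_funM.
  - exact: measurable_funM.
  - by move=> n x; rewrite normrM ler_pM.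
  - move: ae_neq0; apply: ae_mono => x x20.
    by apply: filterS (etalim _ x20) => n ->.
have D : \int[leb2]_x (G x * (eta n x.2 * phi x)) @[n --> \oo] -->
    \int[leb2]_x (G x * (pos x * phi x)).
  apply: (cvg_Rintegral_mul (C := 1 * M) iG).
  - by move=> n; exact: measurable_funM.
  - exact: measurable_funM.
  - by move=> n x; rewrite normrM ler_pM.
  - move: ae_neq0; apply: ae_mono => x x20.
    by apply: filterS (etalim _ x20) => n ->.
have mr2 (f : MR * MR -> R) : measurable_fun setT f -> measurable_fun setT (fun x : MR * MR => f (x.1, - x.2)).
  by move=> mf; exact: (measurableT_comp mf (@measurable_refl2 R)).
have K : \int[leb2]_x (U x * (eta' n x.2 * phi x - eta' n (- x.2) * phi (x.1, - x.2))) @[n --> \oo] -->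
    \int[leb2]_x (U x * 0).
  apply: (cvg_Rintegral_mul (C := L * (2 * C)) iU (hlim := fun=> 0)) => //.
  - move=> n; apply: measurable_funB; first exact: measurable_funM.
    by apply: (mr2 (fun x => eta' n x.2 * phi x)); exact: measurable_funM.
  - move=> n [x1 x2] /=; rewrite etasym -mulrBr normrM.
    apply: le_trans (_ : `|eta' n x2| * (L * (2 * `|x2|)) <= _).
      rewrite ler_wpM2l//; apply: le_trans (hL _ _ _) _.
      by rewrite opprK -mulr2n normrMn mulr_natl.
    rewrite mulrCA [`|_| * (2 * _)]mulrCA ler_wpM2l// ?ler_wpM2l//.
    by have := hL 0 0 1; rewrite sub0r normrN1 mulr1; apply: le_trans.
  - move: ae_neq0; apply: ae_mono => x x20.
    by apply: filterS (eta'0 _ x20) => n h; rewrite etasym h !mul0r subrr.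
have main n : \int[leb2]_x (U x * (eta n x.2 * 'D_e phi x)) +
    e.2 * (2^-1 * \int[leb2]_x (U x * (eta' n x.2 * phi x - eta' n (- x.2) * phi (x.1, - x.2)))) =
    - \int[leb2]_x (G x * (eta n x.2 * phi x)).
  have w := wUG (tphin n).
  have b1 (x : MR * MR) : `|eta' n x.2 * phi x| <= n%:R * C * M by rewrite normrM ler_pM.
  have m1 : measurable_fun setT (fun x : MR * MR => eta' n x.2 * phi x) by exact: measurable_funM.
  have iK := integrable_mulb2 iU m1 b1.
  have iA : leb2.-integrable setT (EFin \o (fun x => U x * (eta n x.2 * 'D_e phi x))).
    apply: (integrable_mulb2 (C := 1 * M') iU); first exact: measurable_funM.
    by move=> x; rewrite normrM ler_pM.
  have half : 2^-1 * \int[leb2]_x (U x * (eta' n x.2 * phi x - eta' n (- x.2) * phi (x.1, - x.2))) =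
      \int[leb2]_x (U x * (eta' n x.2 * phi x)).
    by rewrite -(integral_odd_even m1 b1) mulKf.
  rewrite half.
  rewrite -RintegralZl// -RintegralD//; last exact: (integrableZl measurableT e.2 iK).
  transitivity (\int[leb2]_x (U x * 'D_e (phin n) x)).
    by apply: eq_Rintegral => x _; rewrite dphin; ring.
  by rewrite w; congr (- _); apply: eq_Rintegral => x _; rewrite /phin e0.
have L1 : (\int[leb2]_x (U x * (eta n x.2 * 'D_e phi x)) +
    e.2 * (2^-1 * \int[leb2]_x (U x * (eta' n x.2 * phi x - eta' n (- x.2) * phi (x.1, - x.2)))))
   @[n --> \oo] --> \int[leb2]_x (U x * (pos x * 'D_e phi x)) + e.2 * (2^-1 * \int[leb2]_x (U x * 0)).
  by apply: cvgD => //; apply: cvgM; [exact: cvg_cst|apply: cvgM => //; exact: cvg_cst].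
have L2 : (- \int[leb2]_x (G x * (eta n x.2 * phi x))) @[n --> \oo] --> - \int[leb2]_x (G x * (pos x * phi x)).
  exact: cvgN.
have z : \int[leb2]_x (U x * 0) = 0.
  by under eq_Rintegral do rewrite mulr0; rewrite Rintegral_cst// mul0r.
move: L1; under eq_fun do rewrite main; move=> L1.
have := cvg_unique (@Rhausdorff R) L1 L2; rewrite z !mulr0 addr0 => h.
transitivity (\int[leb2]_x (U x * (pos x * 'D_e phi x))); first by apply: eq_Rintegral => x _; rewrite mulrA.
by rewrite h; congr (- _); apply: eq_Rintegral => x _; rewrite mulrA.
Qed.
End Cutting.
End Cut.

(** * Dyadic squares and the weight *)

Section Dyadic.
Context {R : realType}.
Local Notation MR := (measurableTypeR R).
Local Notation leb := (@lebesgue_measure R).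
Local Notation leb2 := (leb \x leb)%E.
Local Notation B := (@unit_ball R).

Definition square (p : R * R) (r : R) : set (MR * MR) :=
  `]p.1 - r, p.1 + r[ `*` `]p.2 - r, p.2 + r[.

Lemma squareE p r x : square p r x <-> Num.max `|x.1 - p.1| `|x.2 - p.2| < r.
Proof.
by rewrite /square /= !in_itv/= gt_max !ltr_distl; split=> [[-> ->]//|/andP].
Qed.

Lemma measurable_square p r : measurable (square p r).
Proof. by apply: measurableX; exact: measurable_itv. Qed.

Lemma leb2_square p r : 0 < r -> leb2 (square p r) = (4 * r ^+ 2)%:E.
Proof.
move=> r0; rewrite leb2_box; first by congr EFin; ring.
  by lra.
by lra.
Qed.

(** The alternative n = N lets the same lemma serve points that are closer
    than the last scale. *)
Lemma dyadic_scale (r : R) N : r < 2 -> exists n,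
  [/\ (n <= N)%N, r < 2 * 2^-1 ^+ n & 2^-1 ^+ n <= r \/ n = N].
Proof.
move=> r2; elim: N => [|N [n [nN rn h]]].
  by exists 0%N; split=> //; [rewrite expr0 mulr1|right].
have [nr|nr] := leP (2^-1 ^+ n) r.
  by exists n; split=> //; [exact: leq_trans nN _|left].
case: h => [/le_lt_trans /(_ nr)|nE]; first by rewrite ltxx.
exists N.+1; split=> //; last by right.
by rewrite exprS mulrA divff// mul1r -nE.
Qed.

(** F is dominated by the sum of c_n times the indicator of a square of area
    16 / 4^n. *)
Lemma dyadic_bound (D : set (MR * MR)) (F : MR * MR -> R) (c : nat -> R) (p : R * R) (C : R) :
  measurable D -> measurable_fun D F -> (forall x, 0 <= F x) -> (forall n, 0 <= c n) ->
  (forall x, D x -> exists2 n, square p (2 * 2^-1 ^+ n) x & F x <= c n) ->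
  (forall k, \sum_(0 <= n < k) (c n * (16 * 4^-1 ^+ n)) <= C) ->
  (\int[leb2]_(x in D) (F x)%:E <= C%:E)%E.
Proof.
move=> mD mF F0 c0 cover sumC.
have ms n := @measurable_square p (2 * 2^-1 ^+ n).
pose g n (x : MR * MR) := (c n * \1_(square p (2 * 2^-1 ^+ n)) x)%:E.
have mg n : measurable_fun D (g n).
  by apply/measurable_EFinP; apply: measurable_funM => //.
have g0 n x : (0 <= g n x)%E by rewrite lee_fin mulr_ge0// indicE ler0n.
apply: (@le_trans _ _ (\int[leb2]_(x in D) \sum_(0 <= n <oo) g n x)%E).
  apply: ge0_le_integral => //.
  - by move=> x _; rewrite lee_fin.
  - exact/measurable_EFinP.
  - by apply: ge0_emeasurable_sum => // n x _ _; exact: g0.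
  move=> x Dx; have [n nx Fc] := cover x Dx.
  apply: le_trans (nneseries_lim_ge n.+1 _) => //.
  rewrite big_nat_recr//= -[leLHS]add0e leeD//; first by apply: sume_ge0 => i _; exact: g0.
  by rewrite lee_fin indicE mem_set// mulr1.
rewrite integral_nneseries//.
have intg n : (\int[leb2]_(x in D) g n x <= (c n * (16 * 4^-1 ^+ n))%:E)%E.
  apply: (@le_trans _ _ (\int[leb2]_x g n x)%E).
    apply: ge0_subset_integral => //.
    apply/measurable_EFinP; apply: measurable_funM => //; exact: measurable_indic.
  rewrite /g; under eq_integral do rewrite EFinM.
  rewrite ge0_integralZl_EFin//; last by apply/measurable_EFinP; exact: measurable_indic.
  have -> : (\int[leb2]_x (\1_(square p (2 * 2^-1 ^+ n)) x)%:E = (4 * (2 * 2^-1 ^+ n) ^+ 2)%:E)%E.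
    rewrite integral_indic// setIT; apply: leb2_square.
    by rewrite mulr_gt0 ?exprn_gt0 ?invr_gt0.
  rewrite -EFinM lee_fin; apply: ler_wpM2l => //.
  rewrite exprMn -exprM mulnC exprM mulrA.
  have -> : (2^-1 : R) ^+ 2 = 4^-1 by rewrite exprVn -natrX.
  by rewrite -natrX -natrM.
apply: lime_le.
  by apply: is_cvg_nneseries => n _ _; apply: integral_ge0 => x _; exact: g0.
apply: nearW => k; apply: (@le_trans _ _ (\sum_(0 <= n < k) (c n * (16 * 4^-1 ^+ n))%:E)%E).
  by apply: lee_sum => n _; exact: intg.
by rewrite sumEFin lee_fin.
Qed.

Lemma measurable_unit_ball : measurable (B : set (MR * MR)).
Proof.
have -> : (B : set (MR * MR)) = (fun x : MR * MR => x.1 ^+ 2 + x.2 ^+ 2) @^-1` `]-oo, 1[.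
  by apply/seteqP; split=> x; rewrite /= in_itv/= => /unit_ballE.
rewrite -[_ @^-1` _]setTI; apply: (@continuous_measurable2 _ (fun x : R * R => x.1 ^+ 2 + x.2 ^+ 2)) => // x.
by apply: cvgD; apply: (@continuous_comp _ _ _ _ (fun y : R => y ^+ 2));
   [exact: cvg_fst|exact: exprn_continuous|exact: cvg_snd|exact: exprn_continuous].
Qed.

Lemma enorm_ge_max (x : R * R) : Num.max `|x.1| `|x.2| <= enorm x.
Proof.
rewrite /enorm ge_max -!sqrtr_sqr; apply/andP; split; apply: ler_wsqrtr.
  by rewrite lerDl sqr_ge0.
by rewrite lerDr sqr_ge0.
Qed.

Lemma measurable_enorm : measurable_fun [set: MR * MR] (enorm : R * R -> R).
Proof.
apply: continuous_measurable2 => x.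
apply: (@continuous_comp _ _ _ (fun x : R * R => x.1 ^+ 2 + x.2 ^+ 2) (@Num.sqrt R)).
  apply: cvgD; apply: (@continuous_comp _ _ _ _ (fun y : R => y ^+ 2));
   [exact: cvg_fst|exact: exprn_continuous|exact: cvg_snd|exact: exprn_continuous].
exact: sqrt_continuous.
Qed.

Lemma measurable_weight b : measurable_fun [set: MR * MR] (weight b).
Proof. exact: (measurableT_comp (measurable_powR _) measurable_enorm). Qed.

Lemma weight_ge0 b x : 0 <= weight b x :> R.
Proof. exact: powR_ge0. Qed.

Lemma powR_half (b : R) n : (2 `^ (- b)) ^+ n = (2^-1 ^+ n) `^ b.
Proof.
rewrite -(powR_mulrn n (powR_ge0 2 (- b))) -powRrM exprVn.
rewrite -(powR_invn n (ler0n R 2)) -powRrM; congr (_ `^ _); ring.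
Qed.

Lemma weight_antitone (b y : R) x : b <= 0 -> 0 < y -> y <= enorm x -> weight b x <= y `^ b.
Proof.
move=> b0 y0 yx; rewrite /weight -[b]opprK powRN [leRHS]powRN lef_pV2 ?posrE ?powR_gt0//.
  by apply: ge0_ler_powR; rewrite ?oppr_ge0// nnegrE ?(ltW y0)// (le_trans (ltW y0)).
exact: lt_le_trans yx.
Qed.

(** At distance at least 2^-n the weight is at most 2^(-bn), so the dyadic
    bound is a geometric series of ratio 2^(-b-2) < 1. *)
Lemma weight_integral_fin (b : R) : -2 < b < 0 ->
  (\int[leb2]_(x in B) (weight b x)%:E < +oo)%E.
Proof.
move=> /andP[b2 b0].
pose r : R := 2 `^ (- b) * 4^-1.
have r0 : 0 <= r by rewrite mulr_ge0 ?powR_ge0.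
have r1 : r < 1.
  rewrite /r ltr_pdivrMr// mul1r.
  have -> : (4 : R) = 2 `^ 2 by rewrite powR_mulrn// -natrX.
  have -> : (2 : R) `^ 2 = 2 `^ (- b) * 2 `^ (2 + b).
    by rewrite -powRD; [congr (_ `^ _); ring|rewrite pnatr_eq0 implybT].
  rewrite -[ltLHS]mulr1 ltr_pM2l ?powR_gt0//.
  apply: (@le_lt_trans _ _ (1 `^ (2 + b))); first by rewrite powR1.
  by apply: gt0_ltr_powR; rewrite ?nnegrE ?ltr1n//; lra.
apply: (@le_lt_trans _ _ (16 / (1 - r))%:E); last exact: ltry.
apply: (@dyadic_bound _ _ (fun n => (2 `^ (- b)) ^+ n) 0).
- exact: measurable_unit_ball.
- by apply: measurable_funTS; exact: measurable_weight.
- exact: weight_ge0.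
- by move=> n; rewrite exprn_ge0// powR_ge0.
- move=> x Bx; have := enorm_ge_max x; set m := Num.max _ _ => mx.
  have m1 : m < 2 by apply: (le_lt_trans mx); apply: (lt_trans Bx); lra.
  (* m <= 0 only at the origin, where the weight is 0. *)
  have [m0|m0] := leP m 0.
    exists 0%N.
      rewrite squareE/= !subr0 expr0 mulr1; exact: m1.
    rewrite expr0 /weight.
    suff -> : enorm x = 0 by rewrite powR0 ?lt_eqF.
    move: m0; rewrite /m ge_max !normr_le0 => /andP[/eqP x1 /eqP x2].
    by rewrite /enorm x1 x2 expr0n addr0 sqrtr0.
  have [N hN] : exists N, 2^-1 ^+ N <= m.
    have h : `|2^-1 : R| < 1 by rewrite gtr0_norm ?invr_gt0// invf_lt1 ?ltr1n.
    have /cvgrPdist_lt /(_ _ m0) [N _ /(_ N (leqnn N))] := cvg_expr h.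
    by rewrite /= sub0r normrN ger0_norm ?exprn_ge0 ?invr_ge0// => /ltW; exists N.
  have [n [nN h1 h2]] := dyadic_scale N m1.
  exists n; first by rewrite squareE/= !subr0.
  have {}h2 : 2^-1 ^+ n <= enorm x.
    by apply: le_trans mx; case: h2 => // ->.
  have en0 : 0 < enorm x by apply: lt_le_trans h2; rewrite exprn_gt0// invr_gt0.
  rewrite powR_half; by apply: weight_antitone => //; rewrite ?ltW// exprn_gt0// invr_gt0.
move=> k.
have -> : \sum_(0 <= n < k) (2 `^ (- b) ^+ n * (16 * 4^-1 ^+ n)) = 16 * \sum_(n < k) r ^+ n.
  rewrite mulr_sumr big_mkord; apply: eq_bigr => n _; rewrite /r exprMn; ring.
have r1' : 0 < 1 - r by rewrite subr_gt0.
rewrite ler_pM2l// -(ler_pM2r r1') mulVf ?gt_eqF//.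
have := subrX1 r k; have : 0 <= r ^+ k by rewrite exprn_ge0.
by set S := \sum_(_ < _) _; lra.
Qed.

(** F stands for 1 / (4^-N + |x - p|^2): each of the N + 1 dyadic scales down
    to 2^-N contributes at most 16. *)
Lemma integral_regularized_inverse (D : set (MR * MR)) (p : R * R) (N : nat) (F : MR * MR -> R) :
  measurable D -> measurable_fun D F -> (forall x, 0 <= F x) ->
  D `<=` square p 2 ->
  (forall x, F x * (4^-1 ^+ N) <= 1) ->
  (forall x, F x * Num.max `|x.1 - p.1| `|x.2 - p.2| ^+ 2 <= 1) ->
  (\int[leb2]_(x in D) (F x)%:E <= (16 * N.+1%:R)%:E)%E.
Proof.
move=> mD mF F0 Dp FN Fm.
apply: (@dyadic_bound _ _ (fun n => if (n <= N)%N then 4 ^+ n else 0) p) => //.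
- by move=> n; case: ifP.
- move=> x /Dp /squareE; set m := Num.max _ _ => m2.
  have [n [nN h1 h2]] := dyadic_scale N m2.
  exists n; first by rewrite squareE.
  rewrite nN -[leLHS]mulr1 -[leRHS]mul1r -ler_pdivrMr ?exprn_gt0// mulr1 -exprVn.
  case: h2 => [h|->//]; apply: le_trans (Fm x); apply: ler_wpM2l => //.
  have -> : (4^-1 : R) = 2^-1 ^+ 2 by rewrite exprVn -natrX.
  by rewrite -exprM mulnC exprM ler_sqr// nnegrE// ?exprn_ge0 ?invr_ge0 //; apply: le_trans h; rewrite exprn_ge0// invr_ge0.
move=> k; apply: (@le_trans _ _ (\sum_(0 <= n < maxn k N.+1) (if (n <= N)%N then 16 else 0))).
  rewrite (@big_cat_nat _ _ _ k _ _ _ _ _ (leq_maxl _ _))//=.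
  rewrite -[leLHS]addr0 lerD//; last by apply: sumr_ge0 => i _; case: ifP.
  apply: ler_sum => n _; case: ifP; last by rewrite mul0r.
  by rewrite mulrCA -exprMn divff// expr1n mulr1.
rewrite (@big_cat_nat _ _ _ N.+1 _ _ _ _ _ (leq_maxr _ _))//=.
rewrite [X in _ + X]big1_seq ?addr0; last first.
  by move=> i; rewrite mem_index_iota /= => /andP[h _]; rewrite leqNgt h.
rewrite (@eq_big_nat _ _ _ _ _ _ (fun=> 16)); last by move=> i; rewrite ltnS => /andP[_ ->].
by rewrite big_const_nat subn0 iter_addr addr0 mulr_natr.
Qed.
End Dyadic.

(** * Continuously differentiable functions and their weak derivatives *)

Section IntegrationByParts.
Context {R : realType}.
Local Notation MR := (measurableTypeR R).
Local Notation leb := (@lebesgue_measure R).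
Local Notation leb2 := (leb \x leb)%E.
Local Notation B := (@unit_ball R).

Lemma integral_derivative_eq0 (f d : R -> R) : (forall t : R, is_derive t 1 f (d t)) ->
  continuous d -> (forall t, 1 <= `|t| -> f t = 0) -> (forall t, 1 <= `|t| -> d t = 0) ->
  (\int[leb]_t (d t)%:E = 0)%E.
Proof.
move=> fd cd f0 d0.
have cf : continuous f.
  by move=> t; apply: differentiable_continuous; apply/derivable1_diffP; case: (fd t).
transitivity (\int[leb]_(t in `[(-1)%R, 1%R]) (d t)%:E)%E.
  rewrite [RHS]integral_mkcond; apply: eq_integral => t _; rewrite patchE.
  case: ifPn => // /negP h; congr EFin; apply: d0; apply/ltW; rewrite ltNge; apply/negP => h'.
  by apply: h; rewrite inE/= in_itv/= -ler_norml.
rewrite (@continuous_FTC2 _ d f) ?f0 ?normrN1 ?normr1 ?subee//.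
- exact: continuous_subspaceT.
- split.
  + by move=> t _; case: (fd t).
  + exact/cvg_at_right_filter/cf.
  + exact/cvg_at_left_filter/cf.
- by move=> t _; rewrite derive1E; case: (fd t).
Qed.

Lemma integrable_bounded_ball (d : MR * MR -> R) (C : R) : measurable_fun setT d ->
  (forall x, `|d x| <= C) -> (forall x, ~ B x -> d x = 0) ->
  leb2.-integrable setT (EFin \o d).
Proof.
move=> md dC d0.
have iB : leb2.-integrable B (EFin \o d).
  apply: measurable_bounded_integrable; first exact: measurable_unit_ball.
  - by apply: le_lt_trans (leb2_in_ball measurable_unit_ball _) _ => //; exact: ltry.
  - exact: measurable_funTS.
  - exists C; split; first exact: num_real.
    by move=> M CM x _; apply: (le_trans (dC x)); exact: ltW.
move/(integrable_mkcond _ measurable_unit_ball): iB; congr (leb2.-integrable _ _).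
apply/funext => x; rewrite patchE; case: ifPn => // /negP Bx.
by rewrite /= d0// => /mem_set.
Qed.

Lemma continuous_slice1 (d : R * R -> R) (t : R) : continuous d -> continuous (fun s => d (s, t)).
Proof.
move=> cd s; apply: (@continuous_comp _ _ _ (fun s : R => (s, t)) d); last exact: cd.
by apply: (@cvg_pair _ _ _ _ (nbhs s) (nbhs t)); [exact: cvg_id|exact: cvg_cst].
Qed.

Lemma continuous_slice2 (d : R * R -> R) (t : R) : continuous d -> continuous (fun s => d (t, s)).
Proof.
move=> cd s; apply: (@continuous_comp _ _ _ (fun s : R => (t, s)) d); last exact: cd.
by apply: (@cvg_pair _ _ _ _ (nbhs t) (nbhs s)); [exact: cvg_cst|exact: cvg_id].
Qed.

(** Fubini, and the fundamental theorem of calculus on each line parallel to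
    e. *)
Lemma integral_partial_eq0 (f d : R * R -> R) (e : R * R) (C : R) : e \in [:: e1; e2] ->
  (forall x, is_derive x e f (d x)) -> continuous d -> (forall x, `|d x| <= C) ->
  (forall x, ~ B x -> f x = 0) -> (forall x, ~ B x -> d x = 0) ->
  \int[leb2]_x d x = 0.
Proof.
move=> ee fd cd dC f0 d0.
have id := integrable_bounded_ball (continuous_measurable2 cd) dC d0.
have out (x : R * R) : 1 <= `|x.1| \/ 1 <= `|x.2| -> ~ B x.
  by move=> h /unit_ball_box; rewrite -!ltr_norml => -[]; rewrite !ltNge; case: h => ->.
move: ee; rewrite !inE => /orP[/eqP E|/eqP E].
  rewrite /Rintegral -(integral21_prod_meas1 id) integral0_eq// => t _.
  apply: (@integral_derivative_eq0 (fun s => f (s, t)) (fun s => d (s, t))).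
  - by move=> s; apply/(is_derive_e1 f (s, t)); rewrite -E.
  - exact: continuous_slice1.
  - by move=> s h; apply: f0; apply: out; left.
  - by move=> s h; apply: d0; apply: out; left.
rewrite /Rintegral -(integral12_prod_meas1 id) integral0_eq// => t _.
apply: (@integral_derivative_eq0 (fun s => f (t, s)) (fun s => d (t, s))).
- by move=> s; apply/(is_derive_e2 f (t, s)); rewrite -E.
- exact: continuous_slice2.
- by move=> s h; apply: f0; apply: out; right.
- by move=> s h; apply: d0; apply: out; right.
Qed.

Lemma mul_test_bounded (f phi : R * R -> R) : continuous f -> test_function phi ->
  exists C, forall x, `|f x * phi x| <= C.
Proof.
move=> cf tphi; have cphi := test_function_continuous tphi.
have cfp : continuous (fun x => f x * phi x) by move=> x; apply: cvgM; [exact: cf|exact: cphi].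
have [_ [K [cK KB K0]]] := tphi.
have : compact ((fun x => f x * phi x) @` K).
  by apply: continuous_compact => //; exact: continuous_subspaceT.
move=> /compact_bounded [M [_ hM]]; exists (`|M| + 1) => x.
have [Kx|nKx] := pselect (K x).
  by apply: (hM (`|M| + 1)); [rewrite ltr_pwDr// ler_norm|exists x].
by rewrite K0// mulr0 normr0 addr_ge0.
Qed.

(** The product f phi has compact support in the disc, so the integral of its
    derivative vanishes. *)
Lemma weak_derivative_C1 (f d phi : R * R -> R) (e : R * R) : e \in [:: e1; e2] ->
  (forall x, is_derive x e f (d x)) -> continuous f -> continuous d ->
  test_function phi ->
  [/\ leb2.-integrable setT (fun x => (f x * 'D_e phi x)%:E),
      leb2.-integrable setT (fun x => (d x * phi x)%:E) &
      \int[leb2]_x (f x * 'D_e phi x) = - \int[leb2]_x (d x * phi x)].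
Proof.
move=> ee fd cf cd tphi; have tD := test_function_derive tphi ee.
have cphi := test_function_continuous tphi; have cD := test_function_continuous tD.
have [C1 hC1] := mul_test_bounded cf tD; have [C2 hC2] := mul_test_bounded cd tphi.
have c1 : continuous (fun x => f x * 'D_e phi x) by move=> x; apply: cvgM; [exact: cf|exact: cD].
have c2 : continuous (fun x => d x * phi x) by move=> x; apply: cvgM; [exact: cd|exact: cphi].
have z1 x : ~ B x -> f x * 'D_e phi x = 0 by move=> nB; rewrite (test_function_outside tD nB) mulr0.
have z2 x : ~ B x -> d x * phi x = 0 by move=> nB; rewrite (test_function_outside tphi nB) mulr0.
have i1 := integrable_bounded_ball (continuous_measurable2 c1) hC1 z1.
have i2 := integrable_bounded_ball (continuous_measurable2 c2) hC2 z2.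
split => //; apply/eqP; rewrite -addr_eq0 -RintegralD//; apply/eqP.
apply: (@integral_partial_eq0 (fun x => f x * phi x) _ e (C1 + C2)) => //.
- move=> x; have dphi : is_derive x e phi ('D_e phi x) by apply: smooth_is_derive => //; case: tphi.
  have [h1 h2] := is_deriveM (fd x) dphi; apply: DeriveDef; first exact: h1.
  by apply: (etrans h2); rewrite /GRing.scale/= [phi x * _]mulrC.
- by move=> x; apply: cvgD; [exact: c1|exact: c2].
- by move=> x; apply: (le_trans (ler_normD _ _)); apply: lerD.
- by move=> x nB; rewrite (test_function_outside tphi nB) mulr0.
- by move=> x nB; rewrite z1// z2// addr0.
Qed.

Lemma integral_test_derive (phi : R * R -> R) (e : R * R) : e \in [:: e1; e2] ->
  test_function phi -> \int[leb2]_x 'D_e phi x = 0.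
Proof.
move=> ee tphi.
have c2 (c : R) : continuous (fun _ : R * R => c) by move=> ?; exact: cvg_cst.
have [_ _] := weak_derivative_C1 ee (fun x => is_derive_cst (1 : R) x e) (c2 1) (c2 0) tphi.
under eq_Rintegral do rewrite mul1r.
by under [in RHS]eq_Rintegral do rewrite mul0r; rewrite Rintegral_cst// mul0r oppr0.
Qed.
End IntegrationByParts.

(** * Extension by zero outside the disc *)

Section Extension.
Context {R : realType}.
Local Notation MR := (measurableTypeR R).
Local Notation leb := (@lebesgue_measure R).
Local Notation leb2 := (leb \x leb)%E.
Local Notation B := (@unit_ball R).

Lemma enorm_sqr (x : R * R) : enorm x ^+ 2 = x.1 ^+ 2 + x.2 ^+ 2.
Proof. by rewrite sqr_sqrtr// addr_ge0// sqr_ge0. Qed.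

Lemma weight_ge1 (a : R) (x : R * R) : a <= 0 -> B x -> x.2 != 0 -> 1 <= weight a x.
Proof.
move=> a0 Bx x2; have e0 : 0 < enorm x.
  rewrite sqrtr_gt0 ltr_wpDl ?sqr_ge0// lt_neqAle sqr_ge0 andbT eq_sym sqrf_eq0 //.
by rewrite /weight -[leLHS](powRr0 (enorm x)); apply: ger_powR => //; rewrite e0 ltW.
Qed.

(** The exponent is nonpositive and the norm is at most 1; the origin, where
    the weight is 0, is a null set. *)
Lemma ae_weight_ge1 (a : R) : a <= 0 -> {ae leb2, forall x, B x -> 1 <= weight a x}.
Proof.
by move=> a0; move: (@ae_neq0 R); apply: ae_mono => x x2 Bx; exact: weight_ge1.
Qed.

Lemma integral_ball_le_weight (a : R) (f : MR * MR -> R) : a <= 0 -> measurable_fun B f ->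
  (forall x, 0 <= f x) ->
  (\int[leb2]_(x in B) (f x)%:E <= \int[leb2]_(x in B) (f x * weight a x)%:E)%E.
Proof.
move=> a0 mf f0; apply: ae_ge0_le_integral => //.
- exact: measurable_unit_ball.
- by move=> x _; rewrite lee_fin.
- exact/measurable_EFinP.
- by move=> x _; rewrite lee_fin mulr_ge0// weight_ge0.
- apply/measurable_EFinP; apply: measurable_funM => //.
  by apply: measurable_funTS; exact: measurable_weight.
- move: (ae_weight_ge1 a0); apply: ae_mono => x h Bx.
  by rewrite lee_fin ler_peMr// h.
Qed.

Lemma integral_ball_cst (c : R) : 0 <= c -> (\int[leb2]_(x in B) c%:E <= (c * 4)%:E)%E.
Proof.
move=> c0; rewrite integral_cst; last exact: measurable_unit_ball.
by rewrite EFinM lee_wpmul2l//; apply: leb2_in_ball; [exact: measurable_unit_ball|].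
Qed.

(** On the disc |f| <= 1 + |f|^2, and the weight is at least 1 almost
    everywhere. *)
Lemma integrable_ball_of_sqr (a : R) (f : MR * MR -> R) : a <= 0 -> measurable_fun B f ->
  (\int[leb2]_(x in B) (`|f x| ^+ 2 * weight a x)%:E < +oo)%E ->
  leb2.-integrable setT (EFin \o f \_ B).
Proof.
move=> a0 mf fin.
have mB := @measurable_unit_ball R.
have m2 : measurable_fun B (fun x : MR * MR => `|f x| ^+ 2).
  by apply: measurable_funX; exact: measurableT_comp.
have : leb2.-integrable B (EFin \o f).
  apply/integrableP; split; first exact/measurable_EFinP.
  apply: (@le_lt_trans _ _ (\int[leb2]_(x in B) (1%:E + (`|f x| ^+ 2)%:E))%E).
    apply: ge0_le_integral => //.
    - by apply: measurableT_comp => //; exact/measurable_EFinP.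
    - by apply: emeasurable_funD => //; exact/measurable_EFinP.
    - move=> x _; rewrite /= lee_fin.
      have := sqr_ge0 (`|f x| - 1); rewrite sqrrB1; have := normr_ge0 (f x).
      by set y := `|f x|; nra.
  rewrite ge0_integralD//; last exact/measurable_EFinP.
  rewrite lte_add_pinfty//.
    by apply: le_lt_trans (integral_ball_cst _) _ => //; exact: ltry.
  by apply: le_lt_trans (integral_ball_le_weight a0 m2 _) fin => x; exact: sqr_ge0.
by move/(integrable_mkcond _ mB); rewrite restrict_EFin.
Qed.

Lemma weak_pair_of_weak_partial (e : R * R) (u f : MR * MR -> R) :
  weak_partial e u f -> weak_pair (u \_ B) e (f \_ B).
Proof.
move=> [_ _ h] phi tphi; rewrite /Rintegral.
have E (v psi : MR * MR -> R) : (\int[leb2]_x ((v \_ B) x * psi x)%:E)%E = (\int[leb2]_(x in B) (v x * psi x)%:E)%E.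
  rewrite [RHS]integral_mkcond; apply: eq_integral => x _; rewrite !patchE.
  by case: ifP => // _; rewrite mul0r.
by rewrite !E h// fineN.
Qed.

(** Constants can be subtracted since the derivatives of test functions have
    zero integral. *)
Lemma weak_partial_of_weak_pair (e : R * R) (V G : MR * MR -> R) (c : R) : e \in [:: e1; e2] ->
  leb2.-integrable setT (EFin \o V) -> leb2.-integrable setT (EFin \o G) ->
  weak_pair V e G -> weak_partial e (fun x => V x - c) G.
Proof.
move=> ee iV iG w.
have mB := @measurable_unit_ball R.
have mV := integrable_measurable iV; have mG := integrable_measurable iG.
have loc f : measurable_fun setT f -> leb2.-integrable B (EFin \o f) -> locally_integrable2 f.
  move=> mf /integrableP[_ fin]; split; first exact: measurable_funTS.
  move=> K cK KB; apply: le_lt_trans fin; apply: ge0_subset_integral => //.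
  - have cl : closed K by apply: compact_closed => //; exact: norm_hausdorff.
    by rewrite -(setCK K); apply: measurableC; apply: open_measurable2; exact: closed_openC.
  - by apply: measurable_funTS; apply/measurable_EFinP; exact: measurableT_comp.
have iVB : leb2.-integrable B (EFin \o V) by exact: integrableS iV.
have iGB : leb2.-integrable B (EFin \o G) by exact: integrableS iG.
split.
- apply: loc; first exact: measurable_funB.
  have ic : leb2.-integrable B (EFin \o (fun _ : MR * MR => c)).
    apply: measurable_bounded_integrable => //.
      by apply: le_lt_trans (leb2_in_ball mB _) _ => //; exact: ltry.
    by exists `|c|; split; [exact: num_real|move=> M /ltW cM x _].
  exact: (integrableB mB iVB ic).
- exact: loc.
move=> phi tphi; have tD := test_function_derive tphi ee.
have [C1 b1] := test_function_bounded tphi; have [C2 b2] := test_function_bounded tD.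
have i1 := integrable_mulb2 iV (measurable_test_function tD) b2.
have i2 := integrable_mulb2 iG (measurable_test_function tphi) b1.
have i3 := integrable_bounded_ball (measurable_test_function tD) b2 (fun x => @test_function_outside _ _ x tD).
have E (v psi : MR * MR -> R) : (forall x, ~ B x -> psi x = 0) ->
    (\int[leb2]_(x in B) (v x * psi x)%:E)%E = (\int[leb2]_x (v x * psi x)%:E)%E.
  move=> z; rewrite [LHS]integral_mkcond; apply: eq_integral => x _; rewrite !patchE.
  case: ifPn => // /negP nB; rewrite z ?mulr0// => Bx; exact/nB/mem_set.
rewrite (E (fun x => V x - c)); last by move=> x; exact: test_function_outside tD.
rewrite (E G); last by move=> x; exact: test_function_outside tphi.
have := congr1 EFin (w phi tphi); rewrite /Rintegral.
rewrite EFinN !fineK; [|exact: integrable_fin_num..] => <-.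
transitivity (\int[leb2]_x ((V x * 'D_e phi x)%:E - (c * 'D_e phi x)%:E))%E.
  by apply: eq_integral => x _; rewrite mulrBl EFinB.
have i4 : leb2.-integrable setT (fun x => (c * 'D_e phi x)%:E).
  by under eq_fun do rewrite EFinM; exact: integrableZl.
rewrite integralB//.
under [X in (_ - X)%E]eq_integral do rewrite EFinM.
rewrite integralZl//.
have := congr1 EFin (integral_test_derive ee tphi); rewrite /Rintegral.
by rewrite fineK; [move=> ->; rewrite mule0 sube0|exact: integrable_fin_num].
Qed.

End Extension.

(** * Bounds by the energy *)

Section Embedding.
Context {R : realType}.
Local Notation MR := (measurableTypeR R).
Local Notation leb := (@lebesgue_measure R).
Local Notation leb2 := (leb \x leb)%E.
Local Notation B := (@unit_ball R).

(** A Sobolev function on the half disc that admits an extension by zero, with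
    its energy bounded by E. *)
Definition half_sobolev (V G1 G2 : MR * MR -> R) (E : R) : Prop :=
  [/\ leb2.-integrable setT (EFin \o V), leb2.-integrable setT (EFin \o G1),
      leb2.-integrable setT (EFin \o G2) &
      forall x, ~ half_ball x -> [/\ V x = 0, G1 x = 0 & G2 x = 0]] /\
  [/\ weak_pair V e1 G1, weak_pair V e2 G2, 0 <= E &
      (\int[leb2]_x (G1 x ^+ 2 + G2 x ^+ 2)%:E <= E%:E)%E].

Lemma half_sobolev_moment V G1 G2 E k : half_sobolev V G1 G2 E ->
  (\int[leb2]_(x in half_ball) (`|V x| ^+ k.*2)%:E <=
   (4 ^+ k.+1 * k`!%:R ^+ 2 * E ^+ k)%:E)%E.
Proof.
move=> [[iV iG1 iG2 z] [w1 w2 E0 hE]].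
by apply: (moment_bound iV iG1 iG2 _ _ _ w1 w2 E0 hE) => x /z[].
Qed.

(** Young's inequality without its constants, for the exponents 2(k+1) and
    2(k+1)/(2k+1): compare y with x^(2k+1). *)
Lemma young_conjugate (k : nat) (x y : R) : 0 <= x -> 0 <= y ->
  x * y <= x ^+ k.+1.*2 + y `^ (k.+1.*2%:R / k.*2.+1%:R).
Proof.
move=> x0 y0; set r := _ / _.
have [yx|xy] := leP y (x ^+ k.*2.+1).
  apply: ler_wpDr; first exact: powR_ge0.
  by rewrite doubleS exprS; apply: ler_wpM2l.
apply: ler_wpDl; first exact: exprn_ge0.
have y1 : 0 < y by apply: le_lt_trans xy; exact: exprn_ge0.
have -> : r = k.*2.+1%:R^-1 + 1.
  by rewrite /r doubleS -[k.*2.+2]addn1 natrD mulrDl divff ?pnatr_eq0// mul1r addrC.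
rewrite powRD ?gt_eqF ?implybT// powRr1//; apply: ler_wpM2r => //.
have -> : x = (x ^+ k.*2.+1) `^ (k.*2.+1%:R^-1).
  by rewrite -powR_mulrn// -powRrM divff ?pnatr_eq0// powRr1.
by apply: ge0_ler_powR; rewrite ?nnegrE ?invr_ge0 ?exprn_ge0// ltW.
Qed.

(** The conjugate exponent tends to 1, so its product with a stays above the
    critical value -2 for large k. *)
Lemma subcritical_exponent (a : R) : -2 < a < 0 -> exists k,
  -2 < a * (k.+1.*2%:R / k.*2.+1%:R) < 0.
Proof.
move=> /andP[a2 a0].
have [k hk] : exists k : nat, (2 + a)^-1 < k%:R.
  by exists (Num.bound (2 + a)^-1); apply: le_lt_trans (archi_boundP _); rewrite ?invr_ge0 ?ler_norm//; lra.
have a20 : 0 < 2 + a by lra.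
exists k; apply/andP; split; last first.
  by rewrite nmulr_rlt0// divr_gt0// ltr0n.
rewrite mulrA ltr_pdivlMr ?ltr0n// doubleS.
move: hk; rewrite -(ltr_pM2l a20) divff ?gt_eqF//.
rewrite -[k.*2.+2]addn2 -[k.*2.+1]addn1 -muln2 !natrD natrM.
have : (0 : R) <= k%:R by [].
nra.
Qed.

Lemma weight_powR (a r : R) x : weight a x `^ r = weight (a * r) x.
Proof. by rewrite /weight powRrM. Qed.

Lemma integral_half_le_ball (f : MR * MR -> R) : measurable_fun B f ->
  (forall x, 0 <= f x) ->
  (\int[leb2]_(x in half_ball) (f x)%:E <= \int[leb2]_(x in B) (f x)%:E)%E.
Proof.
move=> mf f0; apply: ge0_subset_integral => //.
- exact: measurable_half_ball.
- exact: measurable_unit_ball.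
- exact/measurable_EFinP.
- by move=> x _; rewrite lee_fin.
- by move=> x [].
Qed.

(** Young's inequality for V / sqrt E and the weight: by homogeneity both
    resulting terms are multiples of sqrt E. *)
Lemma weighted_mean_bound (a : R) : -2 < a < 0 -> exists2 K, 0 <= K &
  forall V G1 G2 E, half_sobolev V G1 G2 E -> 0 < E ->
    (\int[leb2]_(x in half_ball) (`|V x| * weight a x)%:E <= (K * Num.sqrt E)%:E)%E.
Proof.
move=> ha; have [k hb] := subcritical_exponent ha; set b := a * _ in hb.
have Wfin := weight_integral_fin hb.
set W := (\int[leb2]_(x in B) _)%E in Wfin.
have W0 : (0 <= W)%E by apply: integral_ge0 => x _; rewrite lee_fin weight_ge0.
have Wf : W \is a fin_num by rewrite ge0_fin_numE.
pose C : R := 4 ^+ k.+2 * k.+1`!%:R ^+ 2.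
have C0 : 0 <= C by rewrite mulr_ge0 ?exprn_ge0.
exists (C + fine W); first by rewrite addr_ge0 ?fine_ge0.
move=> V G1 G2 E hV E0; have mom := half_sobolev_moment k.+1 hV.
have [[iV _ _ _] _] := hV; have mV := integrable_measurable iV.
set s := Num.sqrt E.
have s0 : 0 < s by rewrite sqrtr_gt0.
have s0' : 0 <= s by exact: ltW.
have c0 : 0 <= s * s^-1 ^+ k.+1.*2 by rewrite mulr_ge0// exprn_ge0// invr_ge0.
have sE : s ^+ 2 = E by rewrite sqr_sqrtr// ltW.
have mw (c : R) D : measurable_fun D (weight c) by apply: measurable_funTS; exact: measurable_weight.
have mhb := @measurable_half_ball R.
have mV2 (c : R) D : measurable_fun D (fun x => c * `|V x| ^+ k.+1.*2).
  by apply: measurable_funTS; apply: measurable_funM => //; apply: measurable_funX; exact: measurableT_comp.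
apply: (@le_trans _ _ (\int[leb2]_(x in half_ball)
    ((s * s^-1 ^+ k.+1.*2 * `|V x| ^+ k.+1.*2)%:E + (s * weight b x)%:E))%E).
  apply: ge0_le_integral => //.
  - by move=> x _; rewrite lee_fin mulr_ge0// weight_ge0.
  - apply/measurable_EFinP; apply: measurable_funM; last exact: mw.
    by apply: measurable_funTS; exact: measurableT_comp.
  - apply: emeasurable_funD; apply/measurable_EFinP; first exact: mV2.
    by apply: measurable_funM => //; exact: mw.
  - move=> x _; rewrite -EFinD lee_fin.
    have := young_conjugate k (mulr_ge0 (normr_ge0 (V x)) (ltW (_ : 0 < s^-1))) (weight_ge0 a x).
    rewrite invr_gt0 => /(_ s0); rewrite weight_powR -/b => h.
    have -> : `|V x| * weight a x = s * (`|V x| / s * weight a x) by field; rewrite gt_eqF.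
    apply: le_trans (ler_wpM2l (ltW s0) h) _.
    by rewrite mulrDr exprMn [_ ^+ _ * s^-1 ^+ _]mulrC [s * (s^-1 ^+ _ * _)]mulrA.
rewrite ge0_integralD//; last 4 first.
- by move=> x _; rewrite lee_fin mulr_ge0.
- exact/measurable_EFinP.
- by move=> x _; rewrite lee_fin mulr_ge0// weight_ge0.
- by apply/measurable_EFinP; apply: measurable_funM => //; exact: mw.
rewrite mulrDl EFinD; apply: leeD.
  under eq_integral do rewrite EFinM.
  rewrite ge0_integralZl_EFin//; last first.
    by apply/measurable_EFinP; have := mV2 1 half_ball; under eq_fun do rewrite mul1r.
  apply: le_trans (lee_wpmul2l _ mom) _; first by rewrite lee_fin.
  rewrite -EFinM lee_fin -sE -/C -exprM mul2n [C * _]mulrC mulrA -[s * _ * _]mulrA -exprMn mulVf ?gt_eqF//.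
  by rewrite expr1n mulr1 mulrC.
under eq_integral do rewrite EFinM.
rewrite ge0_integralZl_EFin//; last 2 first.
- by move=> x _; rewrite lee_fin weight_ge0.
- by apply/measurable_EFinP; exact: mw.
rewrite mulrC EFinM fineK//; apply: lee_wpmul2l; first by rewrite lee_fin.
by apply: integral_half_le_ball => // x; exact: weight_ge0.
Qed.

End Embedding.

(** * The two halves of the disc *)

Section Halves.
Context {R : realType}.
Local Notation MR := (measurableTypeR R).
Local Notation leb := (@lebesgue_measure R).
Local Notation leb2 := (leb \x leb)%E.
Local Notation B := (@unit_ball R).
Local Notation half := (@half_ball R).

(** By Young's inequality the integrand is dominated by the sum of a constant,
    an integrable power of the weight and an even power of V. *)
Lemma half_sobolev_moment_fin (a q : R) V G1 G2 E : -2 < a < 0 -> 0 <= q ->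
  half_sobolev V G1 G2 E ->
  (\int[leb2]_(x in half_ball) (`|V x| `^ q * weight a x)%:E < +oo)%E.
Proof.
move=> ha q0 hV; have [k hb] := subcritical_exponent ha; set b := a * _ in hb.
pose n := Num.bound (q * k.+1.*2%:R).
have qn : q * k.+1.*2%:R <= n.*2%:R.
  apply: ltW; apply: lt_le_trans (archi_boundP _) _; first by rewrite mulr_ge0.
  by rewrite ler_nat -/n -addnn leq_addr.
have [[iV _ _ _] _] := hV; have mV := integrable_measurable iV.
have mhb := @measurable_half_ball R.
have mnV : measurable_fun setT (fun x => `|V x|) by exact: measurableT_comp.
have mw (c : R) D : measurable_fun D (weight c) by apply: measurable_funTS; exact: measurable_weight.
apply: (@le_lt_trans _ _ (\int[leb2]_(x in half_ball) ((1 + weight b x)%:E + (`|V x| ^+ n.*2)%:E))%E).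
  apply: ge0_le_integral => //.
  - by move=> x _; rewrite lee_fin mulr_ge0// ?weight_ge0// powR_ge0.
  - apply/measurable_EFinP; apply: measurable_funM; last exact: mw.
    apply: measurable_funTS.
    exact: (measurableT_comp (measurable_powR _) mnV).
  - apply: emeasurable_funD; apply/measurable_EFinP.
      by apply: measurable_funD => //; exact: mw.
    by apply: measurable_funTS; exact: measurable_funX.
  - move=> x _; rewrite -EFinD lee_fin.
    apply: le_trans (young_conjugate k (powR_ge0 _ _) (weight_ge0 a x)) _.
    rewrite weight_powR -/b [1 + _]addrC -addrA [leLHS]addrC lerD2l.
    rewrite -powR_mulrn ?powR_ge0// -powRrM.
    have [v1|v1] := leP `|V x| 1.
      apply: ler_wpDr; first exact: exprn_ge0.
      rewrite -[leRHS](congr1 (@^~ (q * k.+1.*2%:R)) (@powR1 R)).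
      by apply: ge0_ler_powR; rewrite ?nnegrE ?mulr_ge0.
    apply: ler_wpDl => //; rewrite -powR_mulrn//.
    by apply: ler_powR => //; exact: ltW.
rewrite ge0_integralD//; last 3 first.
- by move=> x _; rewrite lee_fin addr_ge0// weight_ge0.
- by apply/measurable_EFinP; apply: measurable_funD => //; exact: mw.
- by apply/measurable_EFinP; apply: measurable_funTS; exact: measurable_funX.
apply: lte_add_pinfty; last by apply: le_lt_trans (half_sobolev_moment n hV) _; exact: ltry.
apply: (@le_lt_trans _ _ (\int[leb2]_(x in B) (1%:E + (weight b x)%:E))%E).
  under eq_integral do rewrite EFinD.
  apply: ge0_subset_integral => //.
  - exact: measurable_unit_ball.
  - by apply: emeasurable_funD => //; apply/measurable_EFinP; exact: mw.
  - by move=> x _; rewrite adde_ge0// lee_fin weight_ge0.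
  - by move=> x [].
have mB := @measurable_unit_ball R.
rewrite ge0_integralD//; last 2 first.
- by move=> x _; rewrite lee_fin weight_ge0.
- by apply/measurable_EFinP; exact: mw.
apply: lte_add_pinfty; last exact: weight_integral_fin.
by apply: le_lt_trans (integral_ball_cst _) _ => //; exact: ltry.
Qed.

Definition lower_ball : set (MR * MR) := [set x | B x /\ x.2 <= 0].

Lemma ball_halves : B = half `|` lower_ball.
Proof.
apply/seteqP; split=> [x Bx|x [[]|[]]//].
by have [x2|x2] := leP x.2 0; [right|left].
Qed.

Lemma half_lower_disj : [disjoint half & lower_ball].
Proof. by apply/disj_setPS => x [[_ h] [_]]; rewrite leNgt h. Qed.

Lemma measurable_lower_ball : measurable lower_ball.
Proof.
have -> : lower_ball = B `\` half.
  apply/seteqP; split=> x; first by move=> [Bx x2]; split=> // -[_]; rewrite ltNge x2.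
  by move=> [Bx h]; split=> //; rewrite leNgt; apply/negP => x2; exact: h.
apply: measurableD; [exact: measurable_unit_ball|exact: measurable_half_ball].
Qed.

Lemma integral_ball_halves (f : MR * MR -> R) : measurable_fun B f -> (forall x, 0 <= f x) ->
  (\int[leb2]_(x in B) (f x)%:E =
   \int[leb2]_(x in half) (f x)%:E + \int[leb2]_(x in lower_ball) (f x)%:E)%E.
Proof.
move=> mf f0; rewrite ball_halves ge0_integral_setU//.
- exact: measurable_half_ball.
- exact: measurable_lower_ball.
- by apply/measurable_EFinP; rewrite -ball_halves.
- by move=> x _; rewrite lee_fin.
- exact: half_lower_disj.
Qed.

Lemma ball_refl2 x : B (x.1, - x.2) <-> B x.
Proof. by rewrite !unit_ballE /= sqrrN. Qed.

(** The reflection exchanges the two halves up to the segment x.2 = 0, which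
    is null. *)
Lemma integral_lower_half (f : MR * MR -> R) : measurable_fun setT f -> (forall x, 0 <= f x) ->
  {ae leb2, forall x, B x -> f (x.1, - x.2) = f x} ->
  (\int[leb2]_(x in lower_ball) (f x)%:E = \int[leb2]_(x in half) (f x)%:E)%E.
Proof.
move=> mf f0 ev.
have mh := @measurable_half_ball R; have ml := measurable_lower_ball.
rewrite integral_mkcond [RHS]integral_mkcond.
have mfl : measurable_fun setT ((fun x => (f x)%:E) \_ lower_ball).
  by apply/(measurable_restrictT _ _).1 => //; apply: measurable_funTS; exact/measurable_EFinP.
rewrite -(ge0_integral_preserving (@measurable_refl2 R) (@leb2_refl2 R) mfl); last first.
  by move=> x; rewrite patchE; case: ifP => // _; rewrite lee_fin.
apply: ge0_ae_eq_integral => //.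
- exact: (measurableT_comp mfl (@measurable_refl2 R)).
- by apply/(measurable_restrictT _ _).1 => //; apply: measurable_funTS; exact/measurable_EFinP.
- by move=> x _; rewrite patchE; case: ifP => // _; rewrite lee_fin.
- by move=> x _; rewrite patchE; case: ifP => // _; rewrite lee_fin.
move: (ae_and (@ae_neq0 R) ev); apply: ae_mono => x [x2 h] _.
rewrite !patchE /refl2.
have [Bx|nB] := pselect (B x); last first.
  rewrite !memNset//; first by move=> [].
  by move=> [/ball_refl2].
have [p|p] := ltP 0 x.2.
  rewrite !mem_set//; first by rewrite h.
  by split; [exact/ball_refl2|rewrite /= oppr_le0 ltW].
rewrite !memNset//; first by move=> [_]; rewrite ltNge p.
move=> [_] /=; rewrite oppr_le0 => p'; move: x2.
by rewrite eq_le p p'.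
Qed.

End Halves.

(** * Competitors supported in a half disc *)

Section Candidates.
Context {R : realType}.
Local Notation MR := (measurableTypeR R).
Local Notation leb := (@lebesgue_measure R).
Local Notation leb2 := (leb \x leb)%E.
Local Notation B := (@unit_ball R).
Local Notation half := (@half_ball R).

Lemma W12_sub_cst (a c : R) (V h1 h2 : MR * MR -> R) : -2 < a < 0 ->
  leb2.-integrable setT (EFin \o V) -> leb2.-integrable setT (EFin \o h1) ->
  leb2.-integrable setT (EFin \o h2) -> weak_pair V e1 h1 -> weak_pair V e2 h2 ->
  (\int[leb2]_(x in B) (`|V x| ^+ 2 * weight a x)%:E < +oo)%E ->
  (\int[leb2]_(x in B) (enorm (h1 x, h2 x) ^+ 2 * weight a x)%:E < +oo)%E ->
  W12 a (fun x => V x - c) (fun x => (h1 x, h2 x)).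
Proof.
move=> ha iV i1 i2 w1 w2 fV fh; have mV := integrable_measurable iV.
have mB := @measurable_unit_ball R.
have c20 : 0 <= 2 * c ^+ 2 by rewrite mulr_ge0// sqr_ge0.
have mw : measurable_fun B (weight a) by apply: measurable_funTS; exact: measurable_weight.
split=> //.
  by split; apply: weak_partial_of_weak_pair => //; rewrite !inE eqxx ?orbT.
have mVw : measurable_fun B (fun x : MR * MR => `|V x| ^+ 2 * weight a x).
  apply: measurable_funM => //; apply: measurable_funTS.
  by apply: measurable_funX; exact: measurableT_comp.
apply: (@le_lt_trans _ _ (\int[leb2]_(x in B) (2%:E * (`|V x| ^+ 2 * weight a x)%:E +
    (2 * c ^+ 2)%:E * (weight a x)%:E))%E).
  apply: ge0_le_integral => //.
  - by move=> x _; rewrite lee_fin mulr_ge0 ?weight_ge0.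
  - apply/measurable_EFinP; apply: measurable_funM => //; apply: measurable_funTS.
    by apply: measurable_funX; apply: measurableT_comp => //; exact: measurable_funB.
  - by apply: emeasurable_funD; apply: measurable_funeM; exact/measurable_EFinP.
  - move=> x _; rewrite -!EFinM -EFinD lee_fin mulrA -mulrDl.
    apply: ler_wpM2r; first exact: weight_ge0.
    rewrite !(real_normK (num_real _)).
    by have := sqr_ge0 (V x + c); nra.
rewrite ge0_integralD//; last 4 first.
- by move=> x _; rewrite mule_ge0// lee_fin mulr_ge0// weight_ge0.
- by apply: measurable_funeM; exact/measurable_EFinP.
- by move=> x _; rewrite mule_ge0// lee_fin// weight_ge0.
- by apply: measurable_funeM; exact/measurable_EFinP.
rewrite !ge0_integralZl_EFin//; last 4 first.
- by move=> x _; rewrite lee_fin weight_ge0.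
- exact/measurable_EFinP.
- by move=> x _; rewrite lee_fin mulr_ge0 ?weight_ge0.
- exact/measurable_EFinP.
by rewrite lte_add_pinfty// lte_mul_pinfty// ?lee_fin// weight_integral_fin.
Qed.

Lemma integral_ball_patch (S : set (MR * MR)) (f f' : MR * MR -> R) : S `<=` B ->
  (forall x, S x -> f' x = f x) -> (forall x, ~ S x -> f' x = 0) ->
  (\int[leb2]_(x in B) (f' x)%:E = \int[leb2]_(x in S) (f x)%:E)%E.
Proof.
move=> SB fS fN; rewrite integral_mkcond [RHS]integral_mkcond.
apply: eq_integral => x _; rewrite !patchE.
have [Sx|nS] := pselect (S x).
  by rewrite !mem_set//; [rewrite fS|exact: SB].
by rewrite (memNset nS) fN//; case: ifP.
Qed.

(** What the comparison uses of one half of a minimizer of energy A and mass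
    M: at most half of the energy, exactly half of the mass, and a weighted
    mean of size K sqrt A.  The constant that restores mean zero is chosen
    later, hence the quantifier over c. *)
Definition competitor (a q A M K : R) : Prop := exists (V : R * R -> R) (h : R * R -> R * R),
  [/\ forall c, W12 a (fun x => V x - c) h,
      (\int[leb2]_(x in B) (enorm (h x) ^+ 2 * weight a x)%:E <= (A / 2)%:E)%E,
      (\int[leb2]_(x in B) (`|V x| `^ q * weight a x)%:E = (M / 2)%:E)%E,
      measurable_fun setT (V : MR * MR -> MR) &
      (\int[leb2]_(x in B) (`|V x| * weight a x)%:E <= (K * Num.sqrt A)%:E)%E].

Lemma W12_integrable (a : R) (u : MR * MR -> R) (g : MR * MR -> R * R) : a <= 0 -> W12 a u g ->
  [/\ leb2.-integrable setT (EFin \o u \_ B),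
      leb2.-integrable setT (EFin \o (fun x => (g x).1) \_ B) &
      leb2.-integrable setT (EFin \o (fun x => (g x).2) \_ B)].
Proof.
move=> a0 [[wp1 wp2] fu fg].
have mB := @measurable_unit_ball R.
have mw : measurable_fun B (weight a) by apply: measurable_funTS; exact: measurable_weight.
have [[mu _] [m1 _] _] := wp1; have [_ [m2 _] _] := wp2.
have mg : measurable_fun B (fun x : MR * MR => enorm (g x) ^+ 2).
  by under eq_fun do rewrite enorm_sqr; apply: measurable_funD; apply: measurable_funX.
have fg1 : (\int[leb2]_(x in B) (`|(g x).1| ^+ 2 * weight a x)%:E < +oo)%E.
  apply: le_lt_trans fg; apply: ge0_le_integral => //.
  - by move=> x _; rewrite lee_fin mulr_ge0 ?weight_ge0.
  - apply/measurable_EFinP; apply: measurable_funM => //.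
    by apply: measurable_funX; exact: measurableT_comp.
  - by apply/measurable_EFinP; apply: measurable_funM.
  - move=> x _; rewrite lee_fin ler_wpM2r ?weight_ge0// enorm_sqr (real_normK (num_real _)).
    by rewrite lerDl sqr_ge0.
have fg2 : (\int[leb2]_(x in B) (`|(g x).2| ^+ 2 * weight a x)%:E < +oo)%E.
  apply: le_lt_trans fg; apply: ge0_le_integral => //.
  - by move=> x _; rewrite lee_fin mulr_ge0 ?weight_ge0.
  - apply/measurable_EFinP; apply: measurable_funM => //.
    by apply: measurable_funX; exact: measurableT_comp.
  - by apply/measurable_EFinP; apply: measurable_funM.
  - move=> x _; rewrite lee_fin ler_wpM2r ?weight_ge0// enorm_sqr (real_normK (num_real _)).
    by rewrite lerDr sqr_ge0.
split; [exact: (integrable_ball_of_sqr a0 mu fu)|exact: (integrable_ball_of_sqr a0 m1 fg1)|exact: (integrable_ball_of_sqr a0 m2 fg2)].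
Qed.

Lemma integrable_patch_sub (S : set (MR * MR)) (f : MR * MR -> R) : measurable S -> S `<=` B ->
  leb2.-integrable setT (EFin \o f \_ B) -> leb2.-integrable setT (EFin \o f \_ S).
Proof.
have mB := @measurable_unit_ball R.
move=> mS SB; rewrite -restrict_EFin => /(integrable_mkcond _ mB) iB.
by rewrite -restrict_EFin; apply/(integrable_mkcond _ mS); exact: integrableS iB.
Qed.

Lemma candidate_restricted (a q A M K : R) (S : set (MR * MR)) (u : MR * MR -> R) (g : MR * MR -> R * R) :
  -2 < a < 0 -> 0 < q -> measurable S -> S `<=` B -> W12 a u g ->
  weak_pair (u \_ S) e1 ((fun x => (g x).1) \_ S) ->
  weak_pair (u \_ S) e2 ((fun x => (g x).2) \_ S) ->
  (\int[leb2]_(x in S) (enorm (g x) ^+ 2 * weight a x)%:E <= (A / 2)%:E)%E ->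
  (\int[leb2]_(x in S) (`|u x| `^ q * weight a x)%:E = (M / 2)%:E)%E ->
  (\int[leb2]_(x in S) (`|u x| * weight a x)%:E <= (K * Num.sqrt A)%:E)%E ->
  competitor a q A M K.
Proof.
move=> ha q0 mS SB Hu w1 w2 hA hM hK.
have [[wp1 wp2] fu fg] := Hu.
have mB := @measurable_unit_ball R.
have mw : measurable_fun B (weight a) by apply: measurable_funTS; exact: measurable_weight.
have /andP[_ /ltW a0] := ha.
have [iu i1 i2] : [/\ leb2.-integrable setT (EFin \o u \_ S),
      leb2.-integrable setT (EFin \o (fun x => (g x).1) \_ S) &
      leb2.-integrable setT (EFin \o (fun x => (g x).2) \_ S)].
  by have [? ? ?] := W12_integrable a0 Hu; split; exact: integrable_patch_sub.
have [[mu _] _ _] := wp1.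
have fuS : (\int[leb2]_(x in B) (`|(u \_ S) x| ^+ 2 * weight a x)%:E < +oo)%E.
  apply: le_lt_trans fu; apply: ge0_le_integral => //.
  - by move=> x _; rewrite lee_fin mulr_ge0 ?weight_ge0.
  - apply/measurable_EFinP; apply: measurable_funM => //; apply: measurable_funTS.
    by apply: measurable_funX; apply: measurableT_comp => //; exact: integrable_measurable.
  - apply/measurable_EFinP; apply: measurable_funM => //.
    by apply: measurable_funX; exact: measurableT_comp.
  - move=> x _; rewrite lee_fin ler_wpM2r ?weight_ge0// patchE; case: ifP => // _.
    by rewrite normr0 expr0n/= sqr_ge0.
have Eh : (\int[leb2]_(x in B) (enorm (((fun x => (g x).1) \_ S) x, ((fun x => (g x).2) \_ S) x) ^+ 2 * weight a x)%:E
   = \int[leb2]_(x in S) (enorm (g x) ^+ 2 * weight a x)%:E)%E.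
  apply: integral_ball_patch => // x Sx; rewrite !enorm_sqr/= !patchE.
    by rewrite mem_set.
  by rewrite memNset// !expr0n addr0 mul0r.
have Eh' : (\int[leb2]_(x in S) (enorm (g x) ^+ 2 * weight a x)%:E < +oo)%E.
  by apply: le_lt_trans hA _; exact: ltry.
exists (u \_ S), (fun x => (((fun x => (g x).1) \_ S) x, ((fun x => (g x).2) \_ S) x)); split.
- by move=> c; apply: W12_sub_cst => //; rewrite Eh.
- by rewrite Eh.
- rewrite -hM; apply: integral_ball_patch => // x Sx; rewrite patchE; first by rewrite mem_set.
  by rewrite memNset// normr0 powR0 ?gt_eqF// mul0r.
- exact: integrable_measurable.
- apply: le_trans hK; rewrite le_eqVlt; apply/orP; left; apply/eqP.
  apply: integral_ball_patch => // x Sx; rewrite patchE; first by rewrite mem_set.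
  by rewrite memNset// normr0 mul0r.
Qed.

End Candidates.

(** * The halves of an odd function *)

Section OddFunctions.
Context {R : realType}.
Local Notation MR := (measurableTypeR R).
Local Notation leb := (@lebesgue_measure R).
Local Notation leb2 := (leb \x leb)%E.
Local Notation B := (@unit_ball R).
Local Notation half := (@half_ball R).
Local Notation lower := (@lower_ball R).

Lemma lee_other_half (c : R) (P Q : \bar R) : (0 <= Q)%E -> (c%:E = P + Q)%E ->
  ((c / 2)%:E < P)%E -> (Q <= (c / 2)%:E)%E.
Proof.
case: Q => [r _|_|//]; case: P => [s||] //= [E]; rewrite lte_fin lee_fin; lra.
Qed.

Variables (a q K : R) (u : MR * MR -> R) (g : MR * MR -> R * R).
Hypotheses (ha : -2 < a < 0) (q0 : 0 < q) (Hu : W12 a u g) (odd_u : antisymmetric_x2 u).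
Hypothesis hK : forall V G1 G2 E, half_sobolev V G1 G2 E -> 0 < E ->
    (\int[leb2]_(x in half_ball) (`|V x| * weight a x)%:E <= (K * Num.sqrt E)%:E)%E.

Let A := fine (\int[leb2]_(x in B) (enorm (g x) ^+ 2 * weight a x)%:E)%E.
Let M := fine (\int[leb2]_(x in B) (`|u x| `^ q * weight a x)%:E)%E.
Let g1 (x : MR * MR) := (g x).1.
Let g2 (x : MR * MR) := (g x).2.

Let a0 : a <= 0. Proof. by case/andP: ha => _ /ltW. Qed.
Let mu : measurable_fun B u. Proof. by case: Hu => -[[[]]]. Qed.
Let mg1 : measurable_fun B g1. Proof. by case: Hu => -[[_ []]]. Qed.
Let mg2 : measurable_fun B g2. Proof. by case: Hu => -[_ [_ []]]. Qed.
Let mB := @measurable_unit_ball R.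
Let mw : measurable_fun B (weight a).
Proof. by apply: measurable_funTS; exact: measurable_weight. Qed.
Let me : measurable_fun B (fun x : MR * MR => enorm (g x) ^+ 2 * weight a x).
Proof.
apply: measurable_funM => //; under eq_fun do rewrite enorm_sqr.
by apply: measurable_funD; apply: measurable_funX.
Qed.
Let iu : leb2.-integrable setT (EFin \o u \_ B). Proof. by case: (W12_integrable a0 Hu). Qed.
Let i1 : leb2.-integrable setT (EFin \o g1 \_ B). Proof. by case: (W12_integrable a0 Hu). Qed.
Let i2 : leb2.-integrable setT (EFin \o g2 \_ B). Proof. by case: (W12_integrable a0 Hu). Qed.

Lemma energyE : (\int[leb2]_(x in B) (enorm (g x) ^+ 2 * weight a x)%:E = A%:E)%E.
Proof.
have [_ _ fg] := Hu; rewrite /A fineK// ge0_fin_numE//.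
by apply: integral_ge0 => x _; rewrite lee_fin mulr_ge0 ?weight_ge0 ?sqr_ge0.
Qed.

Lemma energy_ge0 : 0 <= A.
Proof.
by rewrite -lee_fin -energyE; apply: integral_ge0 => x _; rewrite lee_fin mulr_ge0 ?weight_ge0 ?sqr_ge0.
Qed.

Lemma odd_extension : {ae leb2, forall x : MR * MR, (u \_ B) (x.1, - x.2) = - (u \_ B) x}.
Proof.
move: odd_u; apply: ae_mono => x ux; rewrite !patchE.
have [Bx|nB] := pselect (B x).
  by rewrite !mem_set//; [exact: ux|exact/ball_refl2].
by rewrite !memNset// ?oppr0// => /ball_refl2.
Qed.

Lemma patch_halfE (f : MR * MR -> R) :
  (fun x => (f \_ B) x * (if 0 < x.2 then 1 else 0)) = f \_ half.
Proof.
apply/funext => x; rewrite !patchE; have [Bx|nB] := pselect (B x); last first.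
  by rewrite !memNset ?mul0r// => -[].
rewrite mem_set//; case: ifPn => x2; first by rewrite mem_set ?mulr1.
by rewrite memNset ?mulr0// => -[_]; exact/negP.
Qed.

Lemma patch_lowerE (f : MR * MR -> R) x : (f \_ lower) x = (f \_ B) x - (f \_ half) x.
Proof.
rewrite !patchE; have [Bx|nB] := pselect (B x); last first.
  by rewrite !memNset ?subr0// => -[].
rewrite (mem_set Bx); have [x2|x2] := leP x.2 0.
  by rewrite mem_set// memNset ?subr0// => -[_]; rewrite ltNge x2.
by rewrite memNset ?mem_set ?subrr// => -[_]; rewrite leNgt x2.
Qed.

Let iS (S : set (MR * MR)) (f : MR * MR -> R) : measurable S -> S `<=` B ->
  leb2.-integrable setT (EFin \o f \_ B) -> leb2.-integrable setT (EFin \o f \_ S).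
Proof. exact: integrable_patch_sub. Qed.

Let halfB : half `<=` B. Proof. by move=> x []. Qed.
Let lowB : lower `<=` B. Proof. by move=> x []. Qed.
Let mh := @measurable_half_ball R.
Let ml := @measurable_lower_ball R.

Let wB1 : weak_pair (u \_ B) e1 (g1 \_ B).
Proof. by case: Hu => -[h _] _ _; exact: weak_pair_of_weak_partial. Qed.
Let wB2 : weak_pair (u \_ B) e2 (g2 \_ B).
Proof. by case: Hu => -[_ h] _ _; exact: weak_pair_of_weak_partial. Qed.

Let wh1 : weak_pair (u \_ half) e1 (g1 \_ half).
Proof.
rewrite -!patch_halfE; apply: (weak_pair_cut _ iu i1 wB1 odd_extension).
by rewrite !inE eqxx.
Qed.
Let wh2 : weak_pair (u \_ half) e2 (g2 \_ half).
Proof.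
rewrite -!patch_halfE; apply: (weak_pair_cut _ iu i2 wB2 odd_extension).
by rewrite !inE eqxx orbT.
Qed.

Lemma weak_pair_sub (V V' G G' : MR * MR -> R) e : e \in [:: e1; e2] ->
  leb2.-integrable setT (EFin \o V) -> leb2.-integrable setT (EFin \o V') ->
  leb2.-integrable setT (EFin \o G) -> leb2.-integrable setT (EFin \o G') ->
  weak_pair V e G -> weak_pair V' e G' ->
  weak_pair (fun x => V x - V' x) e (fun x => G x - G' x).
Proof.
move=> ee iV iV' iG iG' w w' phi tphi; have tD := test_function_derive tphi ee.
have [C1 b1] := test_function_bounded tphi; have [C2 b2] := test_function_bounded tD.
have mphi := measurable_test_function tphi; have mD := measurable_test_function tD.
have j1 := integrable_mulb2 iV mD b2; have j2 := integrable_mulb2 iV' mD b2.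
have j3 := integrable_mulb2 iG mphi b1; have j4 := integrable_mulb2 iG' mphi b1.
under eq_Rintegral do rewrite mulrBl.
under [in RHS]eq_Rintegral do rewrite mulrBl.
by rewrite !RintegralB// w// w'// opprB opprK addrC.
Qed.

Let ih (f : MR * MR -> R) : leb2.-integrable setT (EFin \o f \_ B) ->
  leb2.-integrable setT (EFin \o f \_ half).
Proof. exact: iS. Qed.

Let wl1 : weak_pair (u \_ lower) e1 (g1 \_ lower).
Proof.
have E (f : MR * MR -> R) : f \_ lower = (fun x => (f \_ B) x - (f \_ half) x).
  by apply/funext => x; exact: patch_lowerE.
rewrite (E u) (E g1); apply: (weak_pair_sub _ iu (ih iu) i1 (ih i1) wB1 wh1).
by rewrite !inE eqxx.
Qed.

Let wl2 : weak_pair (u \_ lower) e2 (g2 \_ lower).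
Proof.
have E (f : MR * MR -> R) : f \_ lower = (fun x => (f \_ B) x - (f \_ half) x).
  by apply/funext => x; exact: patch_lowerE.
rewrite (E u) (E g2); apply: (weak_pair_sub _ iu (ih iu) i2 (ih i2) wB2 wh2).
by rewrite !inE eqxx orbT.
Qed.

(** The weight is at least 1, so the unweighted energy is at most the weighted
    one. *)
Lemma half_sobolev_odd : half_sobolev (u \_ half) (g1 \_ half) (g2 \_ half) A.
Proof.
split; split; [exact: ih|exact: ih|exact: ih| |exact: wh1|exact: wh2|exact: energy_ge0|].
  by move=> x nh; rewrite !patchE !memNset.
rewrite -energyE.
apply: (@le_trans _ _ (\int[leb2]_(x in half) (enorm (g x) ^+ 2)%:E)%E).
  rewrite [leRHS]integral_mkcond le_eqVlt; apply/orP; left; apply/eqP.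
  apply: eq_integral => x _; rewrite !patchE; case: ifP => _; last by rewrite !expr0n addr0.
  by rewrite enorm_sqr.
have me2 : measurable_fun B (fun x : MR * MR => enorm (g x) ^+ 2).
  by under eq_fun do rewrite enorm_sqr; apply: measurable_funD; apply: measurable_funX.
apply: le_trans (integral_half_le_ball me2 _) _; first by move=> x; exact: sqr_ge0.
by apply: integral_ball_le_weight => // x; exact: sqr_ge0.
Qed.

Lemma integral_halves_even (F : R -> R) : measurable_fun setT F -> (forall r, 0 <= F r) ->
  (\int[leb2]_(x in lower) (F `|u x| * weight a x)%:E =
   \int[leb2]_(x in half) (F `|u x| * weight a x)%:E)%E.
Proof.
move=> mF F0.
pose f x := F `|(u \_ B) x| * weight a x.
have E (S : set (MR * MR)) : S `<=` B -> (\int[leb2]_(x in S) (F `|u x| * weight a x)%:E =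
    \int[leb2]_(x in S) (f x)%:E)%E.
  by move=> SB; apply: eq_integral => x /set_mem Sx; rewrite /f patchE mem_set//; exact: SB.
rewrite !E//; apply: integral_lower_half.
- apply: measurable_funM; last exact: measurable_weight.
  apply: (measurableT_comp mF); apply: measurableT_comp => //; exact: integrable_measurable.
- by move=> x; rewrite mulr_ge0 ?weight_ge0.
- move: odd_extension; apply: ae_mono => x h Bx; rewrite /f h normrN.
  by rewrite /weight /enorm /= sqrrN.
Qed.

Lemma integral_ball_even (F : R -> R) : measurable_fun setT F -> (forall r, 0 <= F r) ->
  (\int[leb2]_(x in B) (F `|u x| * weight a x)%:E =
   2%:E * \int[leb2]_(x in half) (F `|u x| * weight a x)%:E)%E.
Proof.
move=> mF F0; rewrite integral_ball_halves.
- by rewrite integral_halves_even// -mule2n mule_natl.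
- apply: measurable_funM => //; apply: (measurableT_comp mF); exact: measurableT_comp.
- by move=> x; rewrite mulr_ge0 ?weight_ge0.
Qed.

Lemma half_patchE (F : R -> R) :
  (\int[leb2]_(x in half) (F `|(u \_ half) x| * weight a x)%:E =
   \int[leb2]_(x in half) (F `|u x| * weight a x)%:E)%E.
Proof. by apply: eq_integral => x hx; rewrite patchE hx. Qed.

Let mq : measurable_fun setT (fun r : R => r `^ q).
Proof. exact: measurable_powR. Qed.

Lemma odd_moment_fin : (\int[leb2]_(x in B) (`|u x| `^ q * weight a x)%:E < +oo)%E.
Proof.
rewrite (integral_ball_even mq); last by move=> r; exact: powR_ge0.
rewrite -(half_patchE (fun r => r `^ q)) lte_mul_pinfty//.
by apply: (half_sobolev_moment_fin ha _ half_sobolev_odd); exact: ltW.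
Qed.

Lemma odd_momentE : (\int[leb2]_(x in B) (`|u x| `^ q * weight a x)%:E = M%:E)%E.
Proof.
rewrite /M fineK// ge0_fin_numE; first exact: odd_moment_fin.
by apply: integral_ge0 => x _; rewrite lee_fin mulr_ge0 ?weight_ge0 ?powR_ge0.
Qed.

Lemma half_moment : (\int[leb2]_(x in half) (`|u x| `^ q * weight a x)%:E = (M / 2)%:E)%E.
Proof.
have := odd_momentE; rewrite (integral_ball_even mq); last by move=> r; exact: powR_ge0.
have : (0 <= \int[leb2]_(x in half) (`|u x| `^ q * weight a x)%:E)%E.
  by apply: integral_ge0 => x _; rewrite lee_fin mulr_ge0 ?weight_ge0 ?powR_ge0.
case: (integral _ _ _) => [r _|_|//].
  by rewrite -EFinM => -[<-]; congr EFin; field.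
by rewrite gt0_muley// lte_fin.
Qed.

(** Choose the half with the smaller energy. *)
Lemma odd_competitor : 0 < A -> competitor a q A M K.
Proof.
move=> A0.
have hKh : (\int[leb2]_(x in half) (`|u x| * weight a x)%:E <= (K * Num.sqrt A)%:E)%E.
  by rewrite -(half_patchE id); exact: (hK half_sobolev_odd A0).
have e0 x : 0 <= enorm (g x) ^+ 2 * weight a x by rewrite mulr_ge0 ?weight_ge0 ?sqr_ge0.
have := integral_ball_halves me e0; rewrite energyE => EA.
have [h|h] := leP (\int[leb2]_(x in half) (enorm (g x) ^+ 2 * weight a x)%:E)%E (A / 2)%:E.
  by apply: (candidate_restricted ha q0 mh halfB Hu wh1 wh2 h half_moment hKh).
apply: (candidate_restricted ha q0 ml lowB Hu wl1 wl2).
- have l0 : (0 <= \int[leb2]_(x in lower) (enorm (g x) ^+ 2 * weight a x)%:E)%E.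
    by apply: integral_ge0 => x _; rewrite lee_fin.
  exact: lee_other_half EA h.
- by rewrite (integral_halves_even mq) ?half_moment// => r; exact: powR_ge0.
- have mn : measurable_fun setT (fun r : R => `|r|) by exact: measurableT_comp.
  have := integral_halves_even mn (@normr_ge0 R _).
  under eq_integral do rewrite normr_id.
  by under [in RHS]eq_integral do rewrite normr_id; move=> ->.
Qed.

(** If the energy vanished, the second moment of the upper half would vanish
    by [half_sobolev_moment], and u would be zero. *)
Lemma odd_energy_gt0 : ~ {ae leb2, forall x, B x -> u x = 0} -> 0 < A.
Proof.
move=> nu; rewrite lt_neqAle energy_ge0 andbT; apply/negP => /eqP A0; apply: nu.
have := half_sobolev_moment 1 half_sobolev_odd; rewrite -A0 expr1n.
rewrite expr1 mulr0 => I0.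
have mU := integrable_measurable (ih iu).
have mU2 : measurable_fun half (fun x => (`|(u \_ half) x| ^+ 1.*2)%:E).
  apply/measurable_EFinP; apply: measurable_funTS; apply: measurable_funX; exact: measurableT_comp.
have z : {ae leb2, forall x, half x -> u x = 0}.
  have : (\int[leb2]_(x in half) `|(`|(u \_ half) x| ^+ 1.*2)%:E| = 0)%E.
    apply/eqP; rewrite eq_le integral_ge0// andbT; apply: le_trans I0.
    rewrite le_eqVlt; apply/orP; left; apply/eqP; apply: eq_integral => x _.
    by rewrite gee0_abs// lee_fin exprn_ge0.
  move/(ae_eq_integral_abs leb2 mh mU2).1; apply: ae_mono => x h hx.
  have := h hx => -[] /eqP; rewrite patchE mem_set// expf_eq0 normr_eq0 /=.
  by move=> /eqP.
have z' := ae_preserving (@measurable_refl2 R) (@leb2_refl2 R) z.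
move: (ae_and z (ae_and z' (ae_and odd_u (@ae_neq0 R)))); apply: ae_mono => x [h [h' [ox x2]]] Bx.
have [p|p] := ltP 0 x.2; first by apply: h.
apply/eqP; rewrite -oppr_eq0 -ox//; apply/eqP; apply: h'.
split; first exact/ball_refl2.
by rewrite /= oppr_gt0 lt_neqAle x2.
Qed.

End OddFunctions.

(** * The shifted half beats the minimizer *)

Section Comparison.
Context {R : realType}.
Local Notation MR := (measurableTypeR R).
Local Notation leb := (@lebesgue_measure R).
Local Notation leb2 := (leb \x leb)%E.
Local Notation B := (@unit_ball R).

(** This replaces Minkowski's inequality: x + y is at most 10x/9 or at most
    10y, according to whether 9y <= x. *)
Lemma powR_add_le (q x y : R) : 0 <= q -> 0 <= x -> 0 <= y ->
  (x + y) `^ q <= (10 / 9 * x) `^ q + (10 * y) `^ q.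
Proof.
move=> q0 x0 y0; have [h|h] := leP (9 * y) x.
  apply: ler_wpDr; first exact: powR_ge0.
  by apply: ge0_ler_powR; rewrite ?nnegrE//; lra.
apply: ler_wpDl; first exact: powR_ge0.
by apply: ge0_ler_powR; rewrite ?nnegrE//; lra.
Qed.

(** Numerically, 2 * (7/16)^(1/2) * (9/10)^2 > 1, and (7/16)^(2/q) is smallest
    at q = 4. *)
Lemma powR_gain (q M z : R) : 4 <= q -> 0 < M ->
  7 / 16 * M <= (10 / 9) `^ q * z -> M `^ (2 / q) < 2 * z `^ (2 / q).
Proof.
move=> q4 M0 h; have q0 : 0 < q by lra.
have r0 : 0 < 2 / q by rewrite divr_gt0.
have c0 : 0 < (10 / 9 : R) `^ q by rewrite powR_gt0//; lra.
have z0 : 0 <= z.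
  by rewrite -(pmulr_rge0 _ c0); apply: le_trans h; rewrite mulr_ge0// ltW.
have : (7 / 16 * M) `^ (2 / q) <= ((10 / 9) `^ q * z) `^ (2 / q).
  apply: ge0_ler_powR => //; rewrite ?nnegrE ?(ltW r0)// mulr_ge0// ltW//; lra.
rewrite (@powRM _ (7 / 16) M) ?(@powRM _ _ z) ?powR_ge0 ?(ltW M0)//.
rewrite -powRrM [q * _]mulrCA divff ?gt_eqF// mulr1.
have -> : (10 / 9 : R) `^ 2 = (10 / 9) ^+ 2 by rewrite powR_mulrn//; lra.
have : 66 / 100 <= (7 / 16 : R) `^ (2 / q).
  apply: (@le_trans _ _ ((7 / 16) `^ 2^-1)).
    rewrite powR12_sqrt; last lra.
    rewrite -[leLHS]ger0_norm; last lra.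
    rewrite -sqrtr_sqr; apply: ler_wsqrtr; lra.
  apply: ger_powR; first lra.
  by rewrite ler_pdivrMr//; lra.
set P := (7 / 16) `^ _; set m := M `^ _; set zz := z `^ _.
have m0 : 0 < m by exact: powR_gt0.
move=> hP; have := ler_wpM2r (ltW m0) hP; lra.
Qed.

(** The disc contains a square of side 1, on which the weight is at least 1
    almost everywhere. *)
Lemma weight_mass_ge1 (a : R) : a <= 0 -> (1 <= \int[leb2]_(x in B) (weight a x)%:E)%E.
Proof.
move=> a0; have mB := @measurable_unit_ball R.
apply: (@le_trans _ _ (\int[leb2]_(x in B) 1%:E)%E); last first.
  under [leRHS]eq_integral do rewrite -[weight a _]mul1r.
  by apply: integral_ball_le_weight.
rewrite integral_cst// mul1e.
apply: (@le_trans _ _ (leb2 (square 0 2^-1))).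
  rewrite leb2_square ?invr_gt0// lee_fin exprVn -natrX divff//.
apply: le_measure; rewrite ?inE//; first exact: measurable_square.
move=> x /squareE; rewrite !subr0 gt_max => /andP[h1 h2]; apply/unit_ballE.
rewrite -!(real_normK (num_real x.1)) -!(real_normK (num_real x.2)).
have := normr_ge0 x.1; have := normr_ge0 x.2; nra.
Qed.

(** Let c be the weighted mean of V.  By [powR_add_le] the mass M / 2 of V is
    at most (10/9)^q times the mass of V - c plus (10|c|)^q times the total
    weight; the smallness assumption makes the last term at most M / 16.
    Hence the mass of V - c is at least 7M/16 (9/10)^q, and halving the energy
    wins by [powR_gain]. *)
Lemma competitor_beats (a q A M K : R) : -2 < a < 0 -> 4 <= q -> 0 < A -> 0 < M -> 0 <= K ->
  20 * K * Num.sqrt A <= M `^ (q^-1) -> competitor a q A M K ->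
  exists v h, admissible a v h /\ (quotient a q v h < (A / M `^ (2 / q))%:E)%E.
Proof.
move=> ha q4 A0 M0 K0 small [V [h [WV hA hM mV hK]]].
have q0 : 0 < q by lra.
have mB := @measurable_unit_ball R.
have mw : measurable_fun B (weight a) by apply: measurable_funTS; exact: measurable_weight.
have /andP[_ /ltW a0] := ha.
have Wfin := weight_integral_fin ha; have W1 := weight_mass_ge1 a0.
have iw : leb2.-integrable B (EFin \o weight a).
  apply/integrableP; split; first exact/measurable_EFinP.
  by under eq_integral do rewrite /= ger0_norm ?weight_ge0//.
have iwV : leb2.-integrable B (fun x => (weight a x * V x)%:E).
  apply/integrableP; split.
    by apply/measurable_EFinP; apply: measurable_funM => //; exact: measurable_funTS.
  apply: le_lt_trans (ltry (K * Num.sqrt A)); apply: le_trans hK.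
  rewrite le_eqVlt; apply/orP; left; apply/eqP; apply: eq_integral => x _.
  by rewrite abse_EFin normrM (ger0_norm (weight_ge0 a x)) mulrC.
set W := (\int[leb2]_(x in B) (weight a x)%:E)%E in Wfin W1.
have Wf : W \is a fin_num by rewrite ge0_fin_numE// (le_trans _ W1).
set w := fine W; have wE : W = w%:E by rewrite fineK.
have w1 : 1 <= w by rewrite -lee_fin -wE.
set J := (\int[leb2]_(x in B) (weight a x * V x)%:E)%E.
have Jf : J \is a fin_num by exact: integrable_fin_num.
set j := fine J; have jE : J = j%:E by rewrite fineK.
have jK : `|j| <= K * Num.sqrt A.
  rewrite -lee_fin -abse_EFin -jE; apply: le_trans hK.
  apply: le_trans (le_abse_integral leb2 mB _) _; first by case/integrableP: iwV.
  rewrite le_eqVlt; apply/orP; left; apply/eqP; apply: eq_integral => x _.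
  by rewrite abse_EFin normrM (ger0_norm (weight_ge0 a x)) mulrC.
pose c := j / w.
have w0 : 0 < w by lra.
have mean0 : (\int[leb2]_(x in B) (weight a x * (V x - c))%:E = 0)%E.
  transitivity (\int[leb2]_(x in B) ((weight a x * V x)%:E - c%:E * (weight a x)%:E))%E.
    by apply: eq_integral => x _; rewrite mulrBr EFinB [_ * c]mulrC EFinM.
  rewrite integralB//; last exact: integrableZl.
  rewrite integralZl// -/W -/J jE wE -EFinM -EFinB /c divfK ?subrr// gt_eqF//.
set Z := (\int[leb2]_(x in B) (`|V x - c| `^ q * weight a x)%:E)%E.
have mp (f : MR * MR -> R) : measurable_fun setT f -> measurable_fun B (fun x => `|f x| `^ q * weight a x).
  move=> mf; apply: measurable_funM => //; apply: measurable_funTS.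
  by apply: (measurableT_comp (measurable_powR _)); exact: measurableT_comp.
have mVc : measurable_fun setT (fun x => V x - c) by exact: measurable_funB.
have Z0 : (0 <= Z)%E by apply: integral_ge0 => x _; rewrite lee_fin mulr_ge0 ?weight_ge0 ?powR_ge0.
have main : ((M / 2)%:E <= ((10 / 9) `^ q)%:E * Z + ((10 * `|c|) `^ q * w)%:E)%E.
  have -> : (((10 * `|c|) `^ q * w)%:E = \int[leb2]_(x in B) ((10 * `|c|) `^ q * weight a x)%:E)%E.
    rewrite EFinM -wE; under [RHS]eq_integral do rewrite EFinM.
    rewrite ge0_integralZl_EFin//; [by move=> x _; rewrite lee_fin weight_ge0|exact/measurable_EFinP].
  have -> : (((10 / 9) `^ q)%:E * Z = \int[leb2]_(x in B) ((10 / 9) `^ q * (`|V x - c| `^ q * weight a x))%:E)%E.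
    under [RHS]eq_integral do rewrite EFinM.
    rewrite ge0_integralZl_EFin//; [by move=> x _; rewrite lee_fin mulr_ge0 ?weight_ge0 ?powR_ge0|by apply/measurable_EFinP; exact: mp].
  rewrite -hM -ge0_integralD//; last 4 first.
  - by move=> x _; rewrite lee_fin !mulr_ge0 ?weight_ge0 ?powR_ge0.
  - by apply/measurable_EFinP; apply: measurable_funM => //; exact: mp.
  - by move=> x _; rewrite lee_fin mulr_ge0 ?weight_ge0 ?powR_ge0.
  - by apply/measurable_EFinP; exact: measurable_funM.
  apply: ge0_le_integral => //.
  - by move=> x _; rewrite lee_fin mulr_ge0 ?weight_ge0 ?powR_ge0.
  - by apply/measurable_EFinP; exact: mp.
  - apply: emeasurable_funD; apply/measurable_EFinP; apply: measurable_funM => //; exact: mp.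
  move=> x _; rewrite -EFinD lee_fin mulrA -mulrDl; apply: ler_wpM2r; first exact: weight_ge0.
  rewrite -powRM//; apply: le_trans (powR_add_le _ _ _); rewrite ?(ltW q0)//.
  apply: ge0_ler_powR; rewrite ?nnegrE ?addr_ge0 ?(ltW q0)//.
  by rewrite -[X in `|X| <= _](subrK c) ler_normD.
have cw : 10 * `|c| * w <= 2^-1 * M `^ (q^-1).
  rewrite /c normrM normfV (gtr0_norm w0) mulrA divfK ?gt_eqF//; lra.
have cM : (10 * `|c|) `^ q * w <= M / 16.
  apply: (@le_trans _ _ ((10 * `|c| * w) `^ q)).
    rewrite [leRHS]powRM ?mulr_ge0// ?(ltW w0)//; apply: ler_wpM2l; first exact: powR_ge0.
    by apply: le1r_powR => //; lra.
  apply: (@le_trans _ _ ((2^-1 * M `^ (q^-1)) `^ q)).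
    by apply: ge0_ler_powR; rewrite ?nnegrE ?mulr_ge0 ?powR_ge0 ?(ltW q0) ?(ltW w0).
  rewrite powRM ?powR_ge0 ?invr_ge0// -powRrM mulVf ?gt_eqF// powRr1 ?(ltW M0)// mulrC.
  rewrite ler_pM2l//.
  apply: (@le_trans _ _ (2^-1 `^ 4)).
    by apply: ger_powR => //; lra.
  by rewrite powR_mulrn ?invr_ge0// exprVn -natrX.
have zM z : Z = z%:E -> 7 / 16 * M <= (10 / 9) `^ q * z.
  by move=> zE; move: main; rewrite zE -EFinM -EFinD lee_fin; lra.
have ZM z : Z = z%:E -> M `^ (2 / q) < 2 * z `^ (2 / q).
  by move=> /zM; exact: powR_gain.
exists (fun x => V x - c), h; split.
  split; [exact: WV| |exact: mean0].
  move=> ae0; have : Z = 0%:E.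
    rewrite /Z (ge0_ae_eq_integral _ _ (measurable_cst (0%E : \bar R)))//.
    - by rewrite integral0.
    - by apply/measurable_EFinP; exact: mp.
    - by move=> x _; rewrite lee_fin mulr_ge0 ?weight_ge0 ?powR_ge0.
    - move: ae0; apply: ae_mono => x h0 Bx.
      by rewrite h0// normr0 powR0 ?gt_eqF// mul0r.
  move/ZM; rewrite powR0; first by rewrite mulr0 ltNge powR_ge0.
  by rewrite mulf_neq0 ?invr_eq0 ?gt_eqF.
rewrite /quotient -/Z.
set E := (\int[leb2]_(x in B) _)%E in hA *.
have E0 : (0 <= E)%E by apply: integral_ge0 => x _; rewrite lee_fin mulr_ge0 ?weight_ge0 ?sqr_ge0.
have q20 : 2 / q != 0 by rewrite mulf_neq0 ?invr_eq0 ?gt_eqF.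
have Mq : 0 < M `^ (2 / q) by exact: powR_gt0.
case: (Z) Z0 ZM => [z|_ _|//] => [_ /(_ _ erefl) zM'|]; last first.
  by rewrite poweRyr// invey mule0 lte_fin divr_gt0.
rewrite poweR_EFin inver; have zq : 0 < z `^ (2 / q) by lra.
rewrite gt_eqF//; apply: le_lt_trans (lee_wpmul2r _ hA) _; first by rewrite lee_fin invr_ge0 ltW.
rewrite -EFinM lte_fin ltr_pdivlMr// mulrAC ltr_pdivrMr//.
nra.
Qed.
End Comparison.

(** * A logarithmic dipole *)

Section LogDipole.
Context {R : realType}.
Local Notation MR := (measurableTypeR R).
Local Notation leb := (@lebesgue_measure R).
Local Notation leb2 := (leb \x leb)%E.
Local Notation B := (@unit_ball R).

(** The disc lies in a compact square. *)
Lemma continuous_bounded_ball (f : R * R -> R) : continuous f ->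
  exists C, forall x, B x -> `|f x| <= C.
Proof.
move=> cf.
have cK : compact (`[(-1 : R), 1] `*` `[(-1 : R), 1]).
  by apply: compact_setX; exact: segment_compact.
have : compact (f @` (`[(-1 : R), 1] `*` `[(-1 : R), 1])).
  by apply: continuous_compact => //; exact: continuous_subspaceT.
move=> /compact_bounded [M [_ hM]]; exists (`|M| + 1) => x Bx.
apply: (hM (`|M| + 1)); first by rewrite ltr_pwDr// ler_norm.
exists x => //; have [/andP[a b] /andP[c d]] := unit_ball_box Bx.
by split; rewrite /= in_itv/= !ltW.
Qed.

Lemma weak_pair_patch (f d : R * R -> R) (e : R * R) : e \in [:: e1; e2] ->
  (forall x, is_derive x e f (d x)) -> continuous f -> continuous d ->
  weak_pair (f \_ B : MR * MR -> R) e (d \_ B).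
Proof.
move=> ee fd cf cd phi tphi.
have tD := test_function_derive tphi ee.
have [_ _ h] := weak_derivative_C1 ee fd cf cd tphi.
have E (v psi : MR * MR -> R) : (forall x, ~ B x -> psi x = 0) ->
    \int[leb2]_x ((v \_ B) x * psi x) = \int[leb2]_x (v x * psi x).
  move=> z; apply: eq_Rintegral => x _; rewrite patchE; case: ifPn => // /negP nB.
  by rewrite z ?mulr0// => Bx; exact/nB/mem_set.
rewrite (E f); last by move=> x; exact: test_function_outside tD.
by rewrite (E d)//; move=> x; exact: test_function_outside tphi.
Qed.

Variable N : nat.
Let eps2 : R := 4^-1 ^+ N.
Let eps20 : 0 < eps2. Proof. by rewrite exprn_gt0// invr_gt0. Qed.

(** A regularization of the squared distance to the point (-s, 0), at scale
    2^-N. *)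
Definition pole (s : R) (x : R * R) : R := eps2 + (x.1 + s) ^+ 2 + x.2 ^+ 2.

Lemma pole_gt0 s x : 0 < pole s x.
Proof. by rewrite /pole -addrA ltr_wpDr// addr_ge0// sqr_ge0. Qed.

Lemma continuous_pole s : continuous (pole s).
Proof.
move=> x; apply: cvgD; first apply: cvgD; first exact: cvg_cst.
  apply: (@continuous_comp _ _ _ (fun x : R * R => x.1 + s) (fun y : R => y ^+ 2)); last exact: exprn_continuous.
  by apply: cvgD; [exact: cvg_fst|exact: cvg_cst].
by apply: (@continuous_comp _ _ _ snd (fun y : R => y ^+ 2)); [exact: cvg_snd|exact: exprn_continuous].
Qed.

Lemma continuous_ln_pole s : continuous (fun x => ln (pole s x)).
Proof.
move=> x; apply: (@continuous_comp _ _ _ (pole s) (@ln R)); first exact: continuous_pole.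
exact: continuous_ln (pole_gt0 s x).
Qed.

Lemma is_derive_ln_pole1 s (x : R * R) :
  is_derive x e1 (fun x => ln (pole s x)) (2 * (x.1 + s) / pole s x).
Proof.
apply/is_derive_e1 => /=.
have h : is_derive x.1 (1 : R) (fun t : R => eps2 + (t + s) ^+ 2 + x.2 ^+ 2) (2 * (x.1 + s)).
  apply: is_derive_eq; rewrite /GRing.scale/=; ring.
by have := @is_derive1_comp _ (@ln R) _ x.1 _ _ (is_derive1_ln (pole_gt0 s x)) h; rewrite mulrC.
Qed.

Lemma is_derive_ln_pole2 s (x : R * R) :
  is_derive x e2 (fun x => ln (pole s x)) (2 * x.2 / pole s x).
Proof.
apply/is_derive_e2 => /=.
have h : is_derive x.2 (1 : R) (fun t : R => eps2 + (x.1 + s) ^+ 2 + t ^+ 2) (2 * x.2).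
  apply: is_derive_eq; rewrite /GRing.scale/=; ring.
by have := @is_derive1_comp _ (@ln R) _ x.2 _ _ (is_derive1_ln (pole_gt0 s x)) h; rewrite mulrC.
Qed.

(** Odd in x.1, hence of weighted mean zero.  Its gradient is of order 1/|x -
    p| near the poles p = (-1/2, 0) and (1/2, 0), down to distance 2^-N, which
    makes its energy of order N. *)
Definition dipole (x : R * R) : R := ln (pole 2^-1 x) - ln (pole (- 2^-1) x).
Definition dipole1 (x : R * R) : R :=
  2 * (x.1 + 2^-1) / pole 2^-1 x - 2 * (x.1 - 2^-1) / pole (- 2^-1) x.
Definition dipole2 (x : R * R) : R := 2 * x.2 / pole 2^-1 x - 2 * x.2 / pole (- 2^-1) x.

Lemma continuous_dipole : continuous dipole.
Proof. by move=> x; apply: cvgB; exact: continuous_ln_pole. Qed.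

Lemma continuous_inv_pole s : continuous (fun x => (pole s x)^-1).
Proof. by move=> x; apply: cvgV; [rewrite gt_eqF// pole_gt0|exact: continuous_pole]. Qed.

Lemma continuous_dipole1 : continuous dipole1.
Proof.
have c s : continuous (fun x : R * R => 2 * (x.1 + s) / pole s x).
  move=> x; apply: cvgM; last exact: continuous_inv_pole.
  by apply: cvgM; [exact: cvg_cst|apply: cvgD; [exact: cvg_fst|exact: cvg_cst]].
by move=> x; apply: cvgB; exact: c.
Qed.

Lemma continuous_dipole2 : continuous dipole2.
Proof.
have c s : continuous (fun x : R * R => 2 * x.2 / pole s x).
  move=> x; apply: cvgM; last exact: continuous_inv_pole.
  by apply: cvgM; [exact: cvg_cst|exact: cvg_snd].
by move=> x; apply: cvgB; exact: c.
Qed.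

Lemma is_derive_dipole1 (x : R * R) : is_derive x e1 dipole (dipole1 x).
Proof. exact: (is_deriveB (is_derive_ln_pole1 _ _) (is_derive_ln_pole1 _ _)). Qed.

Lemma is_derive_dipole2 (x : R * R) : is_derive x e2 dipole (dipole2 x).
Proof. exact: (is_deriveB (is_derive_ln_pole2 _ _) (is_derive_ln_pole2 _ _)). Qed.

Lemma dipole_grad_le (x : R * R) :
  dipole1 x ^+ 2 + dipole2 x ^+ 2 <= 8 * ((pole 2^-1 x)^-1 + (pole (- 2^-1) x)^-1).
Proof.
have key s : (2 * (x.1 + s) / pole s x) ^+ 2 + (2 * x.2 / pole s x) ^+ 2 <= 4 * (pole s x)^-1.
  rewrite !exprMn -mulrDl expr2 [(_^-1) ^+ 2]expr2.
  rewrite mulrA; apply: ler_wpM2r; first by rewrite invr_ge0 ltW// pole_gt0.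
  rewrite ler_pdivrMr ?pole_gt0// /pole; have := eps20; lra.
have gen (a b c d P Q : R) : a ^+ 2 + b ^+ 2 <= 4 * P -> c ^+ 2 + d ^+ 2 <= 4 * Q ->
    (a - c) ^+ 2 + (b - d) ^+ 2 <= 8 * (P + Q).
  by have := sqr_ge0 (a + c); have := sqr_ge0 (b + d); nra.
exact: gen (key _) (key _).
Qed.

Lemma dipole_odd x : dipole (- x.1, x.2) = - dipole x.
Proof.
rewrite /dipole opprB; congr (ln _ - ln _); rewrite /pole /=; ring.
Qed.

Lemma dipole_large x : (3 < N)%N -> square (2^-1, 0) (2^-1 ^+ N) x ->
  B x /\ N%:R * ln 2 <= dipole x.
Proof.
move=> N4 /squareE; rewrite gt_max /= subr0 => /andP[h1 h2].
have rN : 2^-1 ^+ N <= (16^-1 : R).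
  have -> : (16^-1 : R) = 2^-1 ^+ 4 by rewrite exprVn -natrX.
  by apply: ler_wiXn2l; rewrite ?invr_ge0// invf_le1// ler1n.
have e2E : eps2 = (2^-1 ^+ N) ^+ 2.
  by rewrite -exprM mulnC exprM exprVn -natrX.
set r : R := 2^-1 ^+ N in h1 h2 rN e2E *.
have r0 : 0 < r by rewrite exprn_gt0// invr_gt0.
move: h1 h2; rewrite !ltr_norml => /andP[a1 a2] /andP[b1 b2].
split.
  by apply/unit_ballE; nra.
have p1 : 4^-1 <= pole 2^-1 x.
  by rewrite /pole; have := sqr_ge0 x.2; have := eps20; nra.
have p2 : pole (- 2^-1) x <= 3 * r ^+ 2.
  by rewrite /pole e2E; nra.
apply: (@le_trans _ _ (ln 4^-1 - ln (3 * r ^+ 2))).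
  rewrite -ln_div ?posrE ?mulr_gt0 ?exprn_gt0 ?invr_gt0//.
  have -> : N%:R * ln 2 = ln (r^-1).
    by rewrite mulr_natl -lnXn// /r exprVn invrK.
  rewrite ler_ln ?posrE ?divr_gt0 ?mulr_gt0 ?exprn_gt0 ?invr_gt0//.
  rewrite ler_pdivlMr ?mulr_gt0 ?exprn_gt0//.
  have -> : r^-1 * (3 * r ^+ 2) = 3 * r by field; rewrite gt_eqF.
  lra.
apply: lerB; rewrite ler_ln ?posrE ?invr_gt0 ?pole_gt0//.
by rewrite mulr_gt0// exprn_gt0.
Qed.

Variable a : R.
Hypothesis ha : -2 < a < 0.
Let a0 : a <= 0. Proof. by case/andP: ha => _ /ltW. Qed.
Let mB := @measurable_unit_ball R.
Let mw : measurable_fun B (weight a).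
Proof. by apply: measurable_funTS; exact: measurable_weight. Qed.
Let W := fine (\int[leb2]_(x in B) (weight a x)%:E)%E.
Let WE : (\int[leb2]_(x in B) (weight a x)%:E)%E = W%:E.
Proof.
rewrite /W fineK// ge0_fin_numE; first exact: weight_integral_fin.
by apply: integral_ge0 => x _; rewrite lee_fin weight_ge0.
Qed.

Let mcont (f : R * R -> R) : continuous f -> measurable_fun setT (f : MR * MR -> R).
Proof. exact: continuous_measurable2. Qed.

Lemma integral_inv_pole (s : R) : `|s| <= 2^-1 ->
  (\int[leb2]_(x in B) ((pole s x)^-1)%:E <= (16 * N.+1%:R)%:E)%E.
Proof.
move=> s1; apply: (@integral_regularized_inverse _ _ (- s, 0)) => //.
- by apply: measurable_funTS; apply: mcont; exact: continuous_inv_pole.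
- by move=> x; rewrite invr_ge0 ltW// pole_gt0.
- move=> x /unit_ball_box[/andP[x1 x2] /andP[y1 y2]]; apply/squareE => /=.
  move: s1; rewrite ler_norml => /andP[s1 s2].
  by rewrite gt_max !ltr_norml; apply/andP; split; apply/andP; split; lra.
- move=> x; rewrite mulrC ler_pdivrMr ?pole_gt0// mul1r /pole -/eps2 -addrA lerDl.
  by rewrite addr_ge0// sqr_ge0.
- move=> x; rewrite mulrC ler_pdivrMr ?pole_gt0// mul1r /= subr0 opprK.
  have := sqr_ge0 (x.1 + s); have := sqr_ge0 x.2; have := eps20; rewrite /pole.
  rewrite /Num.max; case: ifP => _; rewrite (real_normK (num_real _)); lra.
Qed.

(** Near the origin both poles are far and the gradient is bounded; elsewhere
    the weight is bounded. *)
Lemma dipole_grad_weight_le x : enorm (dipole1 x, dipole2 x) ^+ 2 * weight a x <=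
  256 * weight a x + (8 * 4^-1 `^ a) * ((pole 2^-1 x)^-1 + (pole (- 2^-1) x)^-1).
Proof.
have i0 s : 0 <= (pole s x)^-1 by rewrite invr_ge0 ltW// pole_gt0.
have := dipole_grad_le x; rewrite enorm_sqr; move: (_ ^+ 2 + _) => D; set P := _ + _ => DP.
have P0 : 0 <= P by rewrite /P addr_ge0.
have w0 := weight_ge0 a x.
have [ex|ex] := ltP (enorm x) 4^-1.
  (* Both poles are at distance at least 1/4. *)
  have P32 : P <= 32.
    have small s : `|s| = 2^-1 -> (pole s x)^-1 <= 16.
      move=> s1; rewrite -[16]invrK lef_pV2 ?posrE ?pole_gt0 ?invr_gt0//.
      have x1 : `|x.1| < 4^-1.
        by apply: le_lt_trans ex; apply: le_trans (enorm_ge_max x); rewrite le_max lexx.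
      have xs : 4^-1 <= `|x.1 + s|.
        have := ler_normD (x.1 + s) (- x.1); rewrite addrAC subrr add0r s1 normrN; lra.
      have : 4^-1 ^+ 2 <= (x.1 + s) ^+ 2.
        by rewrite -[leRHS](real_normK (num_real _)) ler_sqr ?nnegrE ?invr_ge0.
      rewrite /pole; have := sqr_ge0 x.2; have := eps20; lra.
    by rewrite /P (_ : 32 = 16 + 16); [apply: lerD; apply: small; rewrite ?normrN gtr0_norm ?invr_gt0|ring].
  apply: ler_wpDr; first by rewrite mulr_ge0// mulr_ge0// powR_ge0.
  by apply: ler_wpM2r => //; lra.
apply: ler_wpDl; first by apply: mulr_ge0.
have hw : weight a x <= 4^-1 `^ a by apply: weight_antitone; rewrite ?invr_gt0.
apply: le_trans (ler_wpM2r w0 DP) _.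
rewrite [leRHS]mulrAC; apply: ler_wpM2l hw.
by rewrite mulr_ge0.
Qed.

Lemma dipole_energy :
  (\int[leb2]_(x in B) (enorm (dipole1 x, dipole2 x) ^+ 2 * weight a x)%:E <=
   ((256 * W + 256 * 4^-1 `^ a) * N.+1%:R)%:E)%E.
Proof.
have [c [c0 cE]] : exists c : R, 0 <= c /\ 8 * 4^-1 `^ a = c.
  by exists (8 * 4^-1 `^ a); rewrite mulr_ge0// powR_ge0.
have -> : 256 * W + 256 * 4^-1 `^ a = 256 * W + c * 32 by rewrite -cE; ring.
have [k [k0 kE]] : exists k : R, 0 <= k /\ 256 = k by exists 256.
rewrite kE.
have mi s : measurable_fun B (fun x : MR * MR => (pole s x)^-1).
  by apply: measurable_funTS; apply: mcont; exact: continuous_inv_pole.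
have mP : measurable_fun B (fun x : MR * MR => (pole 2^-1 x)^-1 + (pole (- 2^-1) x)^-1).
  by apply: measurable_funD; exact: mi.
have i0 s x : 0 <= (pole s x)^-1 by rewrite invr_ge0 ltW// pole_gt0.
have md : measurable_fun B (fun x : MR * MR => enorm (dipole1 x, dipole2 x) ^+ 2).
  under eq_fun do rewrite enorm_sqr/=.
  apply: measurable_funTS; apply: measurable_funD; apply: measurable_funX; apply: mcont.
    exact: continuous_dipole1.
  exact: continuous_dipole2.
apply: (@le_trans _ _ (\int[leb2]_(x in B) (k%:E * (weight a x)%:E +
    c%:E * ((pole 2^-1 x)^-1 + (pole (- 2^-1) x)^-1)%:E))%E).
  apply: ge0_le_integral => //.
  - by move=> x _; rewrite lee_fin mulr_ge0 ?weight_ge0 ?sqr_ge0.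
  - by apply/measurable_EFinP; exact: measurable_funM.
  - apply: emeasurable_funD; apply: measurable_funeM; apply/measurable_EFinP => //.
  - by move=> x _; rewrite -!EFinM -EFinD lee_fin -kE -cE; exact: dipole_grad_weight_le.
rewrite ge0_integralD//; last 4 first.
- by move=> x _; rewrite mule_ge0// lee_fin// weight_ge0.
- by apply: measurable_funeM; exact/measurable_EFinP.
- by move=> x _; rewrite mule_ge0// lee_fin// addr_ge0.
- by apply: measurable_funeM; apply/measurable_EFinP; exact: mP.
rewrite !ge0_integralZl_EFin//; last 4 first.
- by move=> x _; rewrite lee_fin addr_ge0.
- by apply/measurable_EFinP; exact: mP.
- by move=> x _; rewrite lee_fin weight_ge0.
- exact/measurable_EFinP.
rewrite WE; under [X in (_ + _ * X)%E]eq_integral do rewrite EFinD.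
rewrite ge0_integralD//; last 4 first.
- by move=> x _; rewrite lee_fin.
- by apply/measurable_EFinP; exact: mi.
- by move=> x _; rewrite lee_fin.
- by apply/measurable_EFinP; exact: mi.
have h : `|2^-1 : R| <= 2^-1 by rewrite ger0_norm ?invr_ge0.
have h' : `|- 2^-1 : R| <= 2^-1 by rewrite normrN.
apply: (@le_trans _ _ ((k * W)%:E + c%:E * ((16 * N.+1%:R)%:E + (16 * N.+1%:R)%:E))%E).
  by rewrite EFinM leeD2l// lee_wpmul2l// leeD// integral_inv_pole.
change (((k * W + c * (16 * N.+1%:R + 16 * N.+1%:R))%:E <=
  ((k * W + c * 32) * N.+1%:R)%:E)%E).
rewrite lee_fin [leRHS]mulrDl; apply: lerD.
  apply: ler_peMr; last by rewrite ler1n.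
  by rewrite mulr_ge0// -lee_fin -WE; apply: integral_ge0 => x _; rewrite lee_fin weight_ge0.
by rewrite le_eqVlt; apply/orP; left; apply/eqP; ring.
Qed.

End LogDipole.

(** * The infimum tends to zero *)

Section SmallQuotient.
Context {R : realType}.
Local Notation MR := (measurableTypeR R).
Local Notation leb := (@lebesgue_measure R).
Local Notation leb2 := (leb \x leb)%E.
Local Notation B := (@unit_ball R).

(** Monotonicity of the quotient; the mass of v may be infinite. *)
Lemma quotient_le (a q e z : R) (v : R * R -> R) (h : R * R -> R * R) : 0 < q -> 0 < z ->
  (\int[leb2]_(x in B) (enorm (h x) ^+ 2 * weight a x)%:E <= e%:E)%E ->
  (z%:E <= \int[leb2]_(x in B) (`|v x| `^ q * weight a x)%:E)%E ->
  (quotient a q v h <= (e / z `^ (2 / q))%:E)%E.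
Proof.
move=> q0 z0; rewrite /quotient.
set E := (\int[leb2]_(x in B) _)%E; set Z := (\int[leb2]_(x in B) _)%E => hE hZ.
have E0 : (0 <= E)%E by apply: integral_ge0 => x _; rewrite lee_fin mulr_ge0 ?weight_ge0 ?sqr_ge0.
have r0 : 0 < 2 / q by rewrite divr_gt0.
have zp : 0 < z `^ (2 / q) by exact: powR_gt0.
rewrite EFinM; apply: lee_pmul => //.
  by rewrite inve_ge0 poweR_ge0.
have -> : (z `^ (2 / q))^-1%:E = ((z `^ (2 / q))%:E^-1)%E by rewrite inver gt_eqF.
rewrite lee_pV2 ?inE/= ?poweR_ge0 ?lee_fin ?powR_ge0// -poweR_EFin.
apply: gt0_ler_poweR => //; rewrite ?(ltW r0)// in_itv/= ?leey ?andbT ?lee_fin ?(ltW z0)//.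
by apply: le_trans hZ; rewrite lee_fin ltW.
Qed.

Variables (N : nat) (a : R).
Hypotheses (ha : -2 < a < 0) (N4 : (3 < N)%N).
Let a0 : a <= 0. Proof. by case/andP: ha => _ /ltW. Qed.
Let mB := @measurable_unit_ball R.
Let v : MR * MR -> R := dipole N \_ B.
Let h1 : MR * MR -> R := dipole1 N \_ B.
Let h2 : MR * MR -> R := dipole2 N \_ B.

Let integrable_patch (f : R * R -> R) : continuous f -> leb2.-integrable setT (EFin \o (f \_ B : MR * MR -> R)).
Proof.
move=> cf; have [C hC] := continuous_bounded_ball cf.
have mf := continuous_measurable2 cf.
apply: (@integrable_bounded_ball _ _ `|C|).
- by apply/(measurable_restrictT _ _).1 => //; exact: measurable_funTS.
- move=> x; rewrite patchE; case: ifPn => [/set_mem Bx|_]; last by rewrite normr0.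
  by apply: le_trans (hC x Bx) _; exact: ler_norm.
- by move=> x nB; rewrite patchE memNset.
Qed.

Lemma dipole_W12 : W12 a v (fun x => (h1 x, h2 x)).
Proof.
have -> : v = fun x => v x - 0 by apply/funext => x; rewrite subr0.
have iv := integrable_patch (@continuous_dipole R N).
apply: (W12_sub_cst _ ha iv).
- by apply: integrable_patch; exact: continuous_dipole1.
- by apply: integrable_patch; exact: continuous_dipole2.
- apply: weak_pair_patch; [by rewrite !inE eqxx|exact: is_derive_dipole1|exact: continuous_dipole|exact: continuous_dipole1].
- apply: weak_pair_patch; [by rewrite !inE eqxx orbT|exact: is_derive_dipole2|exact: continuous_dipole|exact: continuous_dipole2].
- have [C hC] := continuous_bounded_ball (@continuous_dipole R N).
  have mw : measurable_fun B (weight a) by apply: measurable_funTS; exact: measurable_weight.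
  have mv := integrable_measurable iv.
  apply: (@le_lt_trans _ _ (\int[leb2]_(x in B) ((C ^+ 2)%:E * (weight a x)%:E))%E).
    apply: ge0_le_integral => //.
    + by move=> x _; rewrite lee_fin mulr_ge0 ?weight_ge0.
    + apply/measurable_EFinP; apply: measurable_funM => //; apply: measurable_funTS.
      by apply: measurable_funX; exact: measurableT_comp.
    + by apply: measurable_funeM; exact/measurable_EFinP.
    + move=> x Bx; rewrite -EFinM lee_fin; apply: ler_wpM2r; first exact: weight_ge0.
      rewrite patchE mem_set// lerXn2r ?nnegrE ?hC//.
      exact: le_trans (hC x Bx).
  rewrite ge0_integralZl_EFin//; last 3 first.
  + by move=> x _; rewrite lee_fin weight_ge0.
  + exact/measurable_EFinP.
  + exact: sqr_ge0.
  by rewrite lte_mul_pinfty ?lee_fin ?sqr_ge0//; exact: weight_integral_fin.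
- apply: (@le_lt_trans _ _ (\int[leb2]_(x in B) (enorm (dipole1 N x, dipole2 N x) ^+ 2 * weight a x)%:E)%E).
    rewrite le_eqVlt; apply/orP; left; apply/eqP; apply: eq_integral => x Bx.
    by rewrite /h1 /h2 !patchE Bx.
  by apply: le_lt_trans (dipole_energy N ha) _; exact: ltry.
Qed.

Let mw : measurable_fun B (weight a).
Proof. by apply: measurable_funTS; exact: measurable_weight. Qed.

Lemma dipole_mean0 : (\int[leb2]_(x in B) (weight a x * v x)%:E = 0)%E.
Proof.
have iv := integrable_patch (@continuous_dipole R N).
have mv : measurable_fun setT v by exact: integrable_measurable iv.
have [C hC] := continuous_bounded_ball (@continuous_dipole R N).
have iw : leb2.-integrable B (EFin \o weight a).
  apply/integrableP; split; first exact/measurable_EFinP.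
  under eq_integral do rewrite /= ger0_norm ?weight_ge0//.
  exact: weight_integral_fin.
have iF : leb2.-integrable B (fun x => (v x * weight a x)%:E).
  apply: (integrable_mulb (C := C) mB iw); first exact: measurable_funTS.
  by move=> x Bx; rewrite /v patchE mem_set//; exact: hC.
under eq_integral do rewrite mulrC.
rewrite integral_mkcond; set F := (_ \_ _).
have {}iF : leb2.-integrable setT F by apply/(integrable_mkcond _ mB).
have FN x : F (refl1 x) = (- F x)%E.
  rewrite /F !patchE.
  have E : (refl1 x \in (B : set (MR * MR))) = (x \in (B : set (MR * MR))).
    by apply/idP/idP => /set_mem /unit_ballE h; apply/mem_set/unit_ballE; move: h; rewrite /= sqrrN.
  rewrite E; case: ifP => Bx; last by rewrite oppe0.
  rewrite /v !patchE E Bx /refl1 dipole_odd mulNr EFinN; congr (- (_ * _)%:E)%E.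
  by rewrite /weight /enorm /= sqrrN.
have mF : measurable_fun setT F by case/integrableP: iF.
have := integral_preserving (@measurable_refl1 R) (@leb2_refl1 R) mF.
under eq_integral do rewrite FN.
rewrite integralN; last by apply: integrable_add_def.
have := integrable_fin_num measurableT iF.
by case: (integral _ _ F) => // r _ [] h; congr EFin; lra.
Qed.

Lemma dipole_mass (q : R) : 0 <= q ->
  (((N%:R * ln 2) `^ q * (4 * 4^-1 ^+ N))%:E <= \int[leb2]_(x in B) (`|v x| `^ q * weight a x)%:E)%E.
Proof.
move=> q0; have iv := integrable_patch (@continuous_dipole R N).
have mv : measurable_fun setT v by exact: integrable_measurable iv.
have mq : measurable_fun setT (fun x => `|v x| `^ q).
  by apply: (measurableT_comp (measurable_powR _)); exact: measurableT_comp.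
pose S := @square R (2^-1, 0) (2^-1 ^+ N).
have mS : measurable S by exact: measurable_square.
have SB : S `<=` B by move=> x /(dipole_large N4)[].
have mqB D : measurable_fun D (fun x => `|v x| `^ q) by exact: measurable_funTS.
apply: (@le_trans _ _ (\int[leb2]_(x in S) ((N%:R * ln 2) `^ q)%:E)%E).
  rewrite integral_cst//.
  have E : (leb2 S = (4 * 4^-1 ^+ N)%:E)%E.
    rewrite leb2_square ?exprn_gt0 ?invr_gt0//; congr (_ * _)%:E.
    by rewrite -exprM mulnC exprM; congr (_ ^+ N); rewrite exprVn -natrX.
  by rewrite EFinM -E; exact: lexx.
apply: (@le_trans _ _ (\int[leb2]_(x in S) (`|v x| `^ q)%:E)%E).
  apply: ge0_le_integral => //.
  - by move=> x _; rewrite lee_fin powR_ge0.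
  - exact/measurable_EFinP.
  - move=> x Sx; have [Bx lx] := dipole_large N4 Sx.
    rewrite lee_fin; apply: ge0_ler_powR; rewrite ?nnegrE ?mulr_ge0 ?ln_ge0 ?ler1n//.
    by apply: le_trans lx _; rewrite /v patchE mem_set// ler_norm.
apply: (@le_trans _ _ (\int[leb2]_(x in B) (`|v x| `^ q)%:E)%E).
  by apply: ge0_subset_integral => //; exact/measurable_EFinP.
exact: (integral_ball_le_weight a0 (mqB B) (fun x => powR_ge0 _ _)).
Qed.

(** For q >= 2N, the measure 4^(1-N) to the power 2/q is at least 1/4. *)
Lemma dipole_mass_powR (q : R) : (N.*2)%:R <= q ->
  (N%:R * ln 2) ^+ 2 / 4 <= ((N%:R * ln 2) `^ q * (4 * 4^-1 ^+ N)) `^ (2 / q).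
Proof.
move=> Nq; have N0 : (0 < N)%N by apply: leq_trans N4.
have NR : 0 < N%:R :> R by rewrite ltr0n.
have q0 : 0 < q by apply: lt_le_trans Nq; rewrite ltr0n double_gt0.
have l2 : 0 <= N%:R * ln 2 :> R by rewrite mulr_ge0 ?ln_ge0 ?ler1n.
have e0 : 0 < 4^-1 ^+ N :> R by rewrite exprn_gt0// invr_gt0.
have e1 : 4^-1 ^+ N <= 1 :> R by rewrite exprn_ile1 ?invr_ge0// invf_le1// ler1n.
rewrite powRM ?powR_ge0 ?mulr_ge0 ?(ltW e0)// -powRrM [q * _]mulrCA divff ?gt_eqF// mulr1.
rewrite powR_mulrn//; apply: ler_wpM2l; first exact: sqr_ge0.
apply: (@le_trans _ _ ((4^-1 ^+ N) `^ (2 / q))).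
  apply: (@le_trans _ _ ((4^-1 ^+ N) `^ (N%:R^-1))).
    rewrite -powR_mulrn ?invr_ge0// -powRrM divff ?gt_eqF// powRr1 ?invr_ge0//.
  apply: ger_powR; first by rewrite e0.
  rewrite ler_pdivrMr// mulrC ler_pdivlMr//.
  by move: Nq; rewrite -muln2 natrM mulrC.
apply: ge0_ler_powR; rewrite ?nnegrE ?divr_ge0 ?mulr_ge0 ?(ltW q0) ?(ltW e0)//.
by apply: ler_peMl; [exact: ltW|rewrite ler1n].
Qed.

Let W := fine (\int[leb2]_(x in B) (weight a x)%:E)%E.

Lemma dipole_quotient (q : R) : (N.*2)%:R <= q ->
  admissible a v (fun x => (h1 x, h2 x)) /\
  (quotient a q v (fun x => (h1 x, h2 x)) <=
   (((256 * W + 256 * 4^-1 `^ a) * N.+1%:R) / ((N%:R * ln 2) ^+ 2 / 4))%:E)%E.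
Proof.
move=> Nq; have N0 : (0 < N)%N by apply: leq_trans N4.
have q0 : 0 < q by apply: lt_le_trans Nq; rewrite ltr0n double_gt0.
have l2 : 0 < N%:R * ln 2 :> R by rewrite mulr_gt0 ?ltr0n ?ln_gt0 ?ltr1n.
have z0 : 0 < (N%:R * ln 2) `^ q * (4 * 4^-1 ^+ N) :> R.
  by rewrite mulr_gt0 ?powR_gt0// mulr_gt0// exprn_gt0// invr_gt0.
have mass := dipole_mass (ltW q0).
split.
  split; [exact: dipole_W12| |exact: dipole_mean0] => v0.
  have : (\int[leb2]_(x in B) (`|v x| `^ q * weight a x)%:E = 0)%E.
    rewrite (ge0_ae_eq_integral _ _ (measurable_cst (0%E : \bar R)))//.
    - by rewrite integral0.
    - apply/measurable_EFinP; apply: measurable_funM => //; apply: measurable_funTS.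
      apply: (measurableT_comp (measurable_powR _)); apply: measurableT_comp => //.
      exact: integrable_measurable (integrable_patch (@continuous_dipole R N)).
    - by move=> x _; rewrite lee_fin mulr_ge0 ?weight_ge0 ?powR_ge0.
    - move: v0; apply: ae_mono => x vx Bx.
      by rewrite vx// normr0 powR0 ?gt_eqF// mul0r.
  by move=> Z0; move: mass; rewrite Z0 lee_fin leNgt z0.
have en : (\int[leb2]_(x in B) (enorm (h1 x, h2 x) ^+ 2 * weight a x)%:E <=
    ((256 * W + 256 * 4^-1 `^ a) * N.+1%:R)%:E)%E.
  apply: le_trans (dipole_energy N ha).
  rewrite le_eqVlt; apply/orP; left; apply/eqP; apply: eq_integral => x Bx.
  by rewrite /h1 /h2 !patchE Bx.
apply: le_trans (quotient_le q0 z0 en mass) _; rewrite lee_fin.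
have e0 : 0 <= (256 * W + 256 * 4^-1 `^ a) * N.+1%:R.
  rewrite -lee_fin; apply: le_trans en; apply: integral_ge0 => x _.
  by rewrite lee_fin mulr_ge0 ?weight_ge0 ?sqr_ge0.
apply: ler_wpM2l => //; rewrite lef_pV2 ?posrE ?powR_gt0//.
  exact: dipole_mass_powR.
by rewrite divr_gt0// exprn_gt0.
Qed.

End SmallQuotient.

Section QuotientLimit.
Context {R : realType}.

(** With N growing, the bound of [dipole_quotient] is of order (N + 1) / N^2.
    *)
Lemma small_quotient (a delta : R) : -2 < a < 0 -> 0 < delta ->
  exists Q : R, forall q, Q < q -> exists v h, admissible a v h /\
    (quotient a q v h <= delta%:E)%E.
Proof.
move=> ha d0.
set C := (256 * fine (\int[(@lebesgue_measure R \x @lebesgue_measure R)%E]_(x in @unit_ball R) (weight a x)%:E)%E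
  + 256 * 4^-1 `^ a).
have l0 : 0 < ln 2 :> R by rewrite ln_gt0// ltr1n.
have C0 : 0 <= C.
  apply: addr_ge0; apply: mulr_ge0; [by []| |by []|exact: powR_ge0].
  by apply: fine_ge0; apply: integral_ge0 => x _; rewrite lee_fin weight_ge0.
pose N := (Num.bound (8 * C / (delta * ln 2 ^+ 2))).+4.
have hN : 8 * C <= N%:R * (delta * ln 2 ^+ 2).
  rewrite -ler_pdivrMr ?mulr_gt0 ?exprn_gt0//.
  apply: ltW; apply: lt_le_trans (archi_boundP _) _.
    by rewrite divr_ge0// ?mulr_ge0 ?exprn_ge0// ltW.
  by rewrite ler_nat /N; do 4!apply: leqW.
have N4 : (3 < N)%N by [].
exists (N.*2)%:R => q qN.
have [adm hq] := dipole_quotient ha N4 (ltW qN).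
exists (dipole N \_ (@unit_ball R)), (fun x => ((dipole1 N \_ (@unit_ball R)) x, (dipole2 N \_ (@unit_ball R)) x)); split; first exact: adm.
apply: le_trans hq _; rewrite -/C lee_fin.
have NR : 1 <= N%:R :> R by rewrite ler1n.
clearbody N C.
rewrite ler_pdivrMr; last by rewrite divr_gt0// exprn_gt0// mulr_gt0//; lra.
rewrite exprMn -natr1.
have h : C * (N%:R + 1) <= C * (2 * N%:R) by apply: ler_wpM2l => //; lra.
apply: le_trans h _.
have := ler_wpM2l (le_trans ler01 NR) hN.
nra.
Qed.

End QuotientLimit.

(** * Minimizers are not odd for large exponents *)

(** The weight is at least 1 almost everywhere. *)
Lemma weighted_moment_eq0 (R : realType) (a q : R) (u : measurableTypeR R * measurableTypeR R -> R) :
  a <= 0 -> 0 < q -> measurable_fun (@unit_ball R) u ->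
  (\int[(@lebesgue_measure R \x @lebesgue_measure R)%E]_(x in @unit_ball R)
    (`|u x| `^ q * weight a x)%:E = 0)%E ->
  {ae (@lebesgue_measure R \x @lebesgue_measure R)%E, forall x, @unit_ball R x -> u x = 0}.
Proof.
move=> a0 q0 mu I0; have mB := @measurable_unit_ball R.
set f := fun x => (`|u x| `^ q * weight a x)%:E in I0.
have f0 x : (0 <= f x)%E by rewrite lee_fin mulr_ge0 ?weight_ge0 ?powR_ge0.
have mf : measurable_fun (@unit_ball R) f.
  apply/measurable_EFinP; apply: measurable_funM.
    by apply: (measurableT_comp (measurable_powR _)); exact: measurableT_comp.
  by apply: measurable_funTS; exact: measurable_weight.
have : (\int[(@lebesgue_measure R \x @lebesgue_measure R)%E]_(x in @unit_ball R) `|f x| = 0)%E.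
  by rewrite -[RHS]I0; apply: eq_integral => x _; rewrite gee0_abs.
move/(ae_eq_integral_abs _ mB mf).1 => z.
move: (ae_and z (ae_weight_ge1 a0)); apply: ae_mono => x [h w1] Bx.
have [] := h Bx => /eqP; rewrite mulf_eq0 powR_eq0 normr_eq0 => /orP[/andP[/eqP //]|/eqP w0].
by have := w1 Bx; rewrite w0 ler10.
Qed.

Theorem theorem1p4 (R : realType) (alpha : R) (halpha : -2 < alpha < 0) :
  exists qt : R, 2 < qt /\
    forall (q : R) (u : R * R -> R),
      qt < q -> minimizer alpha q u -> symmetric_x1 u ->
      ~ antisymmetric_x2 u.
Proof.
have [K K0 hK] := weighted_mean_bound halpha.
(* Chosen so that an infimum at most delta gives 20 K sqrt A <= M^(1/q). *)
pose delta := (20 * K + 1)^-1 ^+ 2.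
have k1 : 0 < 20 * K + 1 by lra.
have delta0 : 0 < delta by rewrite exprn_gt0// invr_gt0.
have [Q hQ] := small_quotient halpha delta0.
exists (Num.max Q 4); split; first by rewrite lt_max ltr_nat orbT.
move=> q u; rewrite gt_max => /andP[Qq q4] [g adm umin] _ oddu.
have q0 : 0 < q by lra.
have [Hu nu _] := adm.
set A := fine (\int[(@lebesgue_measure R \x @lebesgue_measure R)%E]_(x in unit_ball) (enorm (g x) ^+ 2 * weight alpha x)%:E)%E.
set M := fine (\int[(@lebesgue_measure R \x @lebesgue_measure R)%E]_(x in unit_ball) (`|u x| `^ q * weight alpha x)%:E)%E.
have A0 : 0 < A := odd_energy_gt0 halpha Hu oddu nu.
have AE := energyE Hu; have ME := odd_momentE halpha q0 Hu oddu.
have M0 : 0 < M.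
  rewrite lt_neqAle; apply/andP; split; last first.
    by rewrite -lee_fin -ME; apply: integral_ge0 => x _; rewrite lee_fin mulr_ge0 ?weight_ge0 ?powR_ge0.
  apply/negP => /eqP M0; apply: nu.
  have a0 : alpha <= 0 by case/andP: halpha => _ /ltW.
  apply: (weighted_moment_eq0 a0 q0); first by case: Hu => -[[[]]].
  by rewrite ME -/M -M0.
have uq : quotient alpha q u g = (A / M `^ (2 / q))%:E.
  rewrite /quotient AE ME poweR_EFin inver gt_eqF ?powR_gt0//.
have inf_le v h : admissible alpha v h -> (quotient alpha q u g <= quotient alpha q v h)%E.
  by move=> av; rewrite umin; apply: ereal_inf_lbound; exists v, h.
have AM : A <= delta * M `^ (2 / q).
  have [v [h [av vd]]] := hQ q Qq.
  have := le_trans (inf_le _ _ av) vd; rewrite uq lee_fin ler_pdivrMr ?powR_gt0//.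
have small : 20 * K * Num.sqrt A <= M `^ (q^-1).
  have m0 : 0 < M `^ (q^-1) by exact: powR_gt0.
  have sq : M `^ (2 / q) = (M `^ (q^-1)) ^+ 2.
    by rewrite -powR_mulrn ?powR_ge0// -powRrM mulrC.
  have : Num.sqrt A <= (20 * K + 1)^-1 * M `^ (q^-1).
    rewrite -[leRHS]ger0_norm ?mulr_ge0 ?invr_ge0 ?(ltW k1) ?powR_ge0//.
    by rewrite -sqrtr_sqr; apply: ler_wsqrtr; rewrite exprMn -sq.
  move=> h; apply: le_trans (ler_wpM2l _ h) _; first by rewrite mulr_ge0.
  rewrite mulrA; apply: ler_piMl; first exact: ltW.
  by rewrite ler_pdivrMr// mul1r; lra.
have [v [h [av]]] := competitor_beats halpha (ltW q4) A0 M0 K0 small (odd_competitor halpha q0 Hu oddu hK A0).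
by rewrite -uq ltNge inf_le.
Qed.
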